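(* Let $\frac12<\alpha<1$, suppose that $s<\frac{1-\alpha}{2}$, and let $r>0$ and $T>0$ be arbitrarily small constants. Assume that the data-to-solution map $u_0\mapsto u(\cdot)$ associated with $$ i\partial_t u+(-\Delta)^{\alpha}u=-|u|^2u,\qquad u(x,0)=u_0(x),\qquad x\in\mathbb{T},$$ for smooth initial data $u_0$ extends continuously to a map from the closed ball in $H^s(\mathbb{T})$ of radius $r$ centered at the origin into $C^0([0,T]\to H^s(\mathbb{T}))$. Then this map is not $C^3$ at the origin.
   Context: $\mathbb{T}=\mathbb{R}/(2\pi\mathbb{Z})$, and $(-\Delta)^\alpha$ is the Fourier multiplier operator on $\mathbb{T}$ with symbol $|k|^{2\alpha}$, $k\in\mathbb{Z}$. $H^s(\mathbb{T})$ is the completion of smooth functions under the weighted $\ell^2$ norm of $\langle k\rangle^s\hat f(k)$, $\langle k\rangle=(1+|k|^2)^{1/2}$. ''Not $C^3$ at the origin'' refers to differentiability as a map between the Banach spaces $H^s(\mathbb{T})$ and $C^0([0,T]\to H^s(\mathbb{T}))$. *)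

(* Defs.v *)
From Stdlib Require Import Reals ZArith Lra Lia FunctionalExtensionality ProofIrrelevance.
From Coquelicot Require Import Coquelicot.
Open Scope R_scope.

Record subspace (X : Type) (W : ModuleSpace R_Ring) := Subspace {
  mem :> (X -> W) -> Prop;
  mem_zero : mem (fun _ => zero);
  mem_plus : forall f g, mem f -> mem g -> mem (fun x => plus (f x) (g x));
  mem_scal : forall a f, mem f -> mem (fun x => scal a (f x))
}.
Arguments mem {X W} _ _.
Arguments mem_zero {X W} _.
Arguments mem_plus {X W} _ _ _ _ _.
Arguments mem_scal {X W} _ _ _ _.

Definition subspace_sort {X W} (S : subspace X W) : Type := {f : X -> W | S f}.

Lemma subspace_eq {X W} (S : subspace X W) (f g : subspace_sort S) :
  (forall x, proj1_sig f x = proj1_sig g x) -> f = g.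
Proof.
destruct f as [f Hf], g as [g Hg]; simpl; intro H.
assert (f = g) by (apply functional_extensionality; exact H). subst g.
f_equal; apply proof_irrelevance.
Qed.

Section SubspaceModule.
Context {X : Type} {W : ModuleSpace R_Ring} (S : subspace X W).

Definition subspace_zero : subspace_sort S := exist _ _ (mem_zero S).
Definition subspace_plus (f g : subspace_sort S) : subspace_sort S :=
  exist _ _ (mem_plus S _ _ (proj2_sig f) (proj2_sig g)).
Definition subspace_scal (a : R) (f : subspace_sort S) : subspace_sort S :=
  exist _ _ (mem_scal S a _ (proj2_sig f)).
Definition subspace_opp (f : subspace_sort S) : subspace_sort S :=
  subspace_scal (opp one) f.

Definition subspace_AbelianMonoid_mixin : AbelianMonoid.mixin_of (subspace_sort S).
Proof.
apply (AbelianMonoid.Mixin _ subspace_plus subspace_zero); intros;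
  apply subspace_eq; intro t; simpl.
- apply plus_comm.
- apply plus_assoc.
- apply plus_zero_r.
Defined.

Definition subspace_AbelianMonoid : AbelianMonoid :=
  AbelianMonoid.Pack _ subspace_AbelianMonoid_mixin (subspace_sort S).

Definition subspace_AbelianGroup_mixin : AbelianGroup.mixin_of subspace_AbelianMonoid.
Proof.
apply (AbelianGroup.Mixin subspace_AbelianMonoid subspace_opp).
intro x; apply subspace_eq; intro t; simpl.
rewrite scal_opp_one; apply (plus_opp_r (G := W)).
Defined.

Definition subspace_AbelianGroup : AbelianGroup :=
  AbelianGroup.Pack _
    (AbelianGroup.Class _ subspace_AbelianMonoid_mixin subspace_AbelianGroup_mixin)
    (subspace_sort S).

Definition subspace_ModuleSpace_mixin : ModuleSpace.mixin_of R_Ring subspace_AbelianGroup.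
Proof.
apply (ModuleSpace.Mixin R_Ring subspace_AbelianGroup subspace_scal); intros;
  apply subspace_eq; intro t; simpl.
- apply (scal_assoc (V := W)).
- apply (scal_one (V := W)).
- apply (scal_distr_l (V := W)).
- apply (scal_distr_r (V := W)).
Defined.

Definition subspace_ModuleSpace : ModuleSpace R_Ring :=
  ModuleSpace.Pack R_Ring _
    (ModuleSpace.Class R_Ring _ (AbelianGroup.class subspace_AbelianGroup)
       subspace_ModuleSpace_mixin)
    (subspace_sort S).
End SubspaceModule.

Record is_norm (M : ModuleSpace R_Ring) (N : M -> R) : Prop := IsNorm {
  is_norm_triangle : forall x y, N (plus x y) <= N x + N y;
  is_norm_scal : forall a x, N (scal a x) <= Rabs a * N x;
  is_norm_eq0 : forall x, N x = 0 -> x = zero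
}.

Section NormedOfNorm.
Context (M : ModuleSpace R_Ring) (N : M -> R) (HN : is_norm M N).

Lemma is_norm_zero : N zero = 0.
Proof.
pose proof (is_norm_triangle M N HN zero zero) as H1.
pose proof (is_norm_scal M N HN 0 zero) as H2.
assert (Hz : scal (0 : R) (zero : M) = zero) by apply (scal_zero_r (V := M)).
rewrite plus_zero_l in H1; rewrite Hz, Rabs_R0 in H2; lra.
Qed.

Lemma is_norm_opp x : N (opp x) <= N x.
Proof.
rewrite <- scal_opp_one.
eapply Rle_trans; [apply (is_norm_scal M N HN)|].
change (Rabs (opp one)) with (Rabs (Ropp 1)); rewrite Rabs_Ropp, Rabs_R1; lra.
Qed.

Definition norm_UniformSpace_mixin : UniformSpace.mixin_of M.
Proof.
apply (UniformSpace.Mixin M zero (fun x e y => N (minus y x) < e)).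
- intros x e; change (N (minus x x) < e).
  rewrite minus_eq_zero; change (N zero < e); rewrite is_norm_zero; apply cond_pos.
- intros x y e H; rewrite <- opp_minus.
  eapply Rle_lt_trans; [apply is_norm_opp|exact H].
- intros x y z e1 e2 H1 H2. rewrite (minus_trans y).
  eapply Rle_lt_trans; [apply (is_norm_triangle M N HN)|]. lra.
Defined.

Definition norm_NormedModuleAux : NormedModuleAux R_AbsRing :=
  NormedModuleAux.Pack R_AbsRing M
    (NormedModuleAux.Class R_AbsRing M (ModuleSpace.class R_Ring M) norm_UniformSpace_mixin)
    M.

Definition norm_NormedModule_mixin : NormedModule.mixin_of R_AbsRing norm_NormedModuleAux.
Proof.
apply (NormedModule.Mixin R_AbsRing norm_NormedModuleAux N 1).
- exact (is_norm_triangle M N HN).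
- exact (is_norm_scal M N HN).
- intros x y eps H; exact H.
- intros x y eps H; rewrite Rmult_1_l; exact H.
- exact (is_norm_eq0 M N HN).
Defined.

Definition normed_space : NormedModule R_AbsRing :=
  NormedModule.Pack R_AbsRing M
    (NormedModule.Class R_AbsRing M
       (NormedModuleAux.class R_AbsRing norm_NormedModuleAux) norm_NormedModule_mixin)
    M.
End NormedOfNorm.

Section SupNorm.
Context {X : Type} {W : NormedModule R_AbsRing} (D : X -> Prop).

Definition sup_norm (f : X -> W) : R :=
  real (Lub_Rbar (fun r => exists x, D x /\ r = norm (f x))).

Definition bounded_on (f : X -> W) : Prop :=
  exists B, forall x, D x -> norm (f x) <= B.

Hypothesis D_nonempty : exists x, D x.

Lemma sup_norm_spec (f : X -> W) : bounded_on f ->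
  (forall x, D x -> norm (f x) <= sup_norm f) /\
  (forall B, (forall x, D x -> norm (f x) <= B) -> sup_norm f <= B).
Proof.
intros [B HB]; unfold sup_norm.
set (E := fun r => _).
destruct (Lub_Rbar_correct E) as [Hub Hlub].
assert (HBE : forall C, (forall x, D x -> norm (f x) <= C) -> is_ub_Rbar E (Finite C)).
{ intros C HC r [x [Hx ->]]; exact (HC x Hx). }
assert (Hle := Hlub _ (HBE B HB)).
destruct D_nonempty as [x0 Hx0].
assert (Hge := Hub _ (ex_intro _ x0 (conj Hx0 eq_refl))).
destruct (Lub_Rbar E) as [l| |]; simpl in *; try contradiction.
split.
- intros x Hx; exact (Hub _ (ex_intro _ x (conj Hx eq_refl))).
- intros C HC; exact (Hlub _ (HBE C HC)).
Qed.

Lemma bounded_on_plus f g : bounded_on f -> bounded_on g ->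
  bounded_on (fun x => plus (f x) (g x)).
Proof.
intros [B HB] [C HC]; exists (B + C); intros x Hx.
eapply Rle_trans; [apply (norm_triangle (V := W))|].
apply Rplus_le_compat; auto.
Qed.

Lemma bounded_on_scal (a : R) f : bounded_on f -> bounded_on (fun x => scal a (f x)).
Proof.
intros [B HB]; exists (Rabs a * B); intros x Hx.
eapply Rle_trans; [apply (norm_scal (V := W))|].
apply Rmult_le_compat_l; [apply Rabs_pos|auto].
Qed.

Lemma sup_norm_plus f g : bounded_on f -> bounded_on g ->
  sup_norm (fun x => plus (f x) (g x)) <= sup_norm f + sup_norm g.
Proof.
intros Hf Hg.
apply (sup_norm_spec _ (bounded_on_plus f g Hf Hg)); intros x Hx.
eapply Rle_trans; [apply (norm_triangle (V := W))|].
apply Rplus_le_compat; apply sup_norm_spec; auto.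
Qed.

Lemma sup_norm_scal (a : R) f : bounded_on f ->
  sup_norm (fun x => scal a (f x)) <= Rabs a * sup_norm f.
Proof.
intros Hf.
apply (sup_norm_spec _ (bounded_on_scal a f Hf)); intros x Hx.
eapply Rle_trans; [apply (norm_scal (V := W))|].
apply Rmult_le_compat_l; [apply Rabs_pos|]. apply sup_norm_spec; auto.
Qed.

Lemma sup_norm_eq0 f : bounded_on f -> sup_norm f = 0 -> forall x, D x -> f x = zero.
Proof.
intros Hf H0 x Hx; apply norm_eq_zero.
apply Rle_antisym; [|apply norm_ge_0].
rewrite <- H0; apply sup_norm_spec; auto.
Qed.
End SupNorm.

Section Lin.
Context (V W : NormedModule R_AbsRing).

Definition lin_subspace : subspace V W.
Proof.
apply (Subspace V W (fun l => is_linear l)).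
- exact is_linear_zero.
- intros f g Hf Hg.
  destruct Hf as [pf sf [Mf [Mf0 Hf]]], Hg as [pg sg [Mg [Mg0 Hg]]].
  split.
  + intros x y; rewrite pf, pg, <- !plus_assoc; f_equal.
    rewrite plus_comm, <- plus_assoc; f_equal; apply plus_comm.
  + intros k x; rewrite sf, sg; symmetry; apply (scal_distr_l (V := W)).
  + exists (Mf + Mg); split; [lra|]. intro x.
    eapply Rle_trans; [apply (norm_triangle (V := W))|].
    rewrite Rmult_plus_distr_r; apply Rplus_le_compat; auto.
- intros a f [pf sf [Mf [Mf0 Hf]]]; split.
  + intros x y; rewrite pf; apply (scal_distr_l (V := W)).
  + intros k x; rewrite sf, !scal_assoc; f_equal; apply Rmult_comm.
  + exists (Rabs a * Mf + 1); split.
    { pose proof (Rabs_pos a); nra. }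
    intro x; eapply Rle_trans; [apply (norm_scal (V := W))|].
    change (abs a) with (Rabs a).
    pose proof (Rabs_pos a); pose proof (norm_ge_0 x); pose proof (Hf x); nra.
Defined.

Definition op_norm (l : subspace_ModuleSpace lin_subspace) : R :=
  sup_norm (fun x : V => norm x <= 1) (proj1_sig l).

Lemma unit_ball_nonempty : exists x : V, norm x <= 1.
Proof. exists zero; rewrite norm_zero; lra. Qed.

Lemma linear_bounded_on (l : V -> W) : is_linear l -> bounded_on (fun x => norm x <= 1) l.
Proof.
intros [_ _ [B [B0 HB]]]; exists B; intros x Hx.
eapply Rle_trans; [apply HB|]; nra.
Qed.

Lemma op_norm_is_norm : is_norm (subspace_ModuleSpace lin_subspace) op_norm.
Proof.
split.
- intros [f Hf] [g Hg]; apply (sup_norm_plus _ unit_ball_nonempty); apply linear_bounded_on; auto.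
- intros a [f Hf]; apply (sup_norm_scal _ unit_ball_nonempty); apply linear_bounded_on; auto.
- intros [f Hf] H0; apply subspace_eq; intro x; simpl.
  pose proof (sup_norm_eq0 _ unit_ball_nonempty f (linear_bounded_on f Hf) H0) as Hz.
  destruct Hf as [pf sf Hb].
  pose proof (norm_ge_0 x) as Hx.
  set (c := 1 + norm x) in *.
  assert (Hc : 0 < c) by (unfold c; lra).
  assert (Hu : f (scal (/ c : R) x) = zero).
  { apply Hz. eapply Rle_trans; [apply (norm_scal (V := V))|].
    change (Rabs (/ c) * norm x <= 1).
    rewrite Rabs_pos_eq by (left; apply Rinv_0_lt_compat; exact Hc).
    apply Rmult_le_reg_l with c; [exact Hc|].
    rewrite <- Rmult_assoc, Rinv_r, Rmult_1_l, Rmult_1_r by lra. unfold c; lra. }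
  replace x with (scal (c : R) (scal (/ c : R) x)).
  + rewrite sf, Hu; apply (scal_zero_r (V := W)).
  + rewrite scal_assoc; change (scal (c * / c : R) x = x).
    rewrite Rinv_r by lra; apply (scal_one (V := V)).
Qed.

Definition Lin : NormedModule R_AbsRing :=
  normed_space (subspace_ModuleSpace lin_subspace) op_norm op_norm_is_norm.

Definition lin_app (l : Lin) : V -> W := proj1_sig l.
End Lin.
Arguments lin_app {V W} l _.

(** [f] is [C^n] at [x]: the Fréchet derivatives up to order [n] exist on a
    neighbourhood of [x], and the [n]-th one is continuous at [x]. *)
Fixpoint Ck_at (n : nat) {V W : NormedModule R_AbsRing} (f : V -> W) (x : V) : Prop :=
  match n with
  | O => continuous f x
  | S m => exists Df : V -> Lin V W,
      locally x (fun y => filterdiff f (locally y) (lin_app (Df y))) /\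
      Ck_at m Df x
  end.

Section C0.
Context (T : posreal) (W : NormedModule R_AbsRing).

Definition Icc : Type := {t : R | 0 <= t <= T}.

Definition Icc0 : Icc := exist _ 0 (conj (Rle_refl 0) (Rlt_le _ _ (cond_pos T))).

Definition Icc_UniformSpace_mixin : UniformSpace.mixin_of Icc.
Proof.
apply (UniformSpace.Mixin Icc Icc0
  (fun x e y => ball (proj1_sig x) e (proj1_sig y))).
- intros x e; apply ball_center.
- intros x y e; apply ball_sym.
- intros x y z e1 e2; apply ball_triangle.
Defined.

Canonical Icc_UniformSpace : UniformSpace :=
  UniformSpace.Pack Icc Icc_UniformSpace_mixin Icc.

Definition C0_subspace : subspace Icc W.
Proof.
apply (Subspace Icc W (fun u => forall t : Icc, continuous u t)).
- intro t; apply continuous_const.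
- intros f g Hf Hg t; apply (continuous_plus (V := W)); auto.
- intros a f Hf t; apply (continuous_scal_r (V := W)); auto.
Defined.

Definition C0_norm (u : subspace_ModuleSpace C0_subspace) : R :=
  sup_norm (fun _ : Icc => True) (proj1_sig u).

Lemma clamp_bounds (t : R) : 0 <= Rmax 0 (Rmin T t) <= T.
Proof.
pose proof (cond_pos T); split; [apply Rmax_l|].
apply Rmax_lub; [lra|apply Rmin_l].
Qed.

Definition clamp (t : R) : Icc := exist _ (Rmax 0 (Rmin T t)) (clamp_bounds t).

Lemma clamp_continuous (t : R) : continuous (clamp : R -> Icc) t.
Proof.
intros P [e He]; exists e; intros y Hy; apply He.
change (Rabs (y - t) < e) in Hy.
change (Rabs (Rmax 0 (Rmin T y) - Rmax 0 (Rmin T t)) < e).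
eapply Rle_lt_trans; [|exact Hy].
unfold Rmax, Rmin, Rabs; repeat destruct Rle_dec; repeat destruct Rcase_abs; lra.
Qed.

Lemma C0_bounded_on (u : Icc -> W) :
  (forall t : Icc, continuous u t) -> bounded_on (fun _ : Icc => True) u.
Proof.
intro Hu.
assert (Hc : forall t, 0 <= t <= T -> continuity_pt (fun t => norm (u (clamp t))) t).
{ intros t _; apply continuity_pt_filterlim.
  apply (continuous_comp (fun t => u (clamp t)) (fun w => norm w)).
  - apply (continuous_comp (clamp : R -> Icc) u); [apply clamp_continuous|apply Hu].
  - apply (filterlim_norm (V := W)). }
destruct (continuity_ab_maj _ 0 T (Rlt_le _ _ (cond_pos T)) Hc) as [m [Hm _]].
exists (norm (u (clamp m))); intros [t Ht] _.
replace (exist _ t Ht : Icc) with (clamp t).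
- apply (Hm t Ht).
- unfold clamp; generalize (clamp_bounds t).
  replace (Rmax 0 (Rmin T t)) with t.
  + intro H; f_equal; apply proof_irrelevance.
  + rewrite Rmin_right, Rmax_right by tauto; reflexivity.
Qed.

Lemma Icc_nonempty : exists x : Icc, True.
Proof. exists Icc0; exact I. Qed.

Lemma C0_norm_is_norm : is_norm (subspace_ModuleSpace C0_subspace) C0_norm.
Proof.
split.
- intros [f Hf] [g Hg]; apply (sup_norm_plus _ Icc_nonempty); apply C0_bounded_on; auto.
- intros a [f Hf]; apply (sup_norm_scal _ Icc_nonempty); apply C0_bounded_on; auto.
- intros [f Hf] H0; apply subspace_eq; intro t.
  exact (sup_norm_eq0 _ Icc_nonempty f (C0_bounded_on f Hf) H0 t I).
Qed.

Definition C0 : NormedModule R_AbsRing :=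
  normed_space (subspace_ModuleSpace C0_subspace) C0_norm C0_norm_is_norm.

Definition C0_app (u : C0) : Icc -> W := proj1_sig u.
End C0.
Arguments C0_app {T W} u _.

Definition Zsummable (a : Z -> R) : Prop :=
  ex_series (fun n => a (Z.of_nat n)) /\ ex_series (fun n => a (- Z.of_nat (S n))%Z).

Definition Zsum (a : Z -> R) : R :=
  Series (fun n => a (Z.of_nat n)) + Series (fun n => a (- Z.of_nat (S n))%Z).

Lemma Zsummable_le (a b : Z -> R) :
  (forall k, 0 <= a k <= b k) -> Zsummable b -> Zsummable a.
Proof.
intros H [H1 H2]; split.
- apply (@ex_series_le R_AbsRing R_CompleteNormedModule _ (fun n => b (Z.of_nat n)));
    [|exact H1].
  intro n; change (Rabs (a (Z.of_nat n)) <= b (Z.of_nat n)).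
  rewrite Rabs_pos_eq; apply H.
- apply (@ex_series_le R_AbsRing R_CompleteNormedModule _ (fun n => b (- Z.of_nat (S n))%Z));
    [|exact H2].
  intro n; change (Rabs (a (- Z.of_nat (S n))%Z) <= b (- Z.of_nat (S n))%Z).
  rewrite Rabs_pos_eq; apply H.
Qed.

Lemma Zsum_le (a b : Z -> R) :
  (forall k, 0 <= a k <= b k) -> Zsummable b -> Zsum a <= Zsum b.
Proof. intros H [H1 H2]; apply Rplus_le_compat; apply Series_le; auto. Qed.

Lemma Zsummable_lin (c d : R) (a b : Z -> R) : Zsummable a -> Zsummable b ->
  Zsummable (fun k => c * a k + d * b k).
Proof.
intros [H1 H2] [H3 H4]; split; apply (ex_series_plus (V := R_NormedModule));
  apply (ex_series_scal (V := R_NormedModule)); auto.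
Qed.

Lemma Zsum_lin (c d : R) (a b : Z -> R) : Zsummable a -> Zsummable b ->
  Zsum (fun k => c * a k + d * b k) = c * Zsum a + d * Zsum b.
Proof.
intros [H1 H2] [H3 H4]; unfold Zsum.
rewrite !Series_plus by (apply (ex_series_scal (V := R_NormedModule)); auto).
rewrite !Series_scal_l; ring.
Qed.

Lemma Zsum_zero : Zsummable (fun _ => 0) /\ Zsum (fun _ => 0) = 0.
Proof.
assert (H : is_series (fun _ : nat => 0) 0).
{ apply (filterlim_ext (fun _ => 0)).
  - intro n; rewrite sum_n_const; ring.
  - apply filterlim_const. }
split.
- split; exists 0; exact H.
- unfold Zsum; rewrite (is_series_unique _ _ H); ring.
Qed.

Lemma Zsum_ge_term (a : Z -> R) (k : Z) :
  (forall j, 0 <= a j) -> Zsummable a -> a k <= Zsum a.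
Proof.
intros Ha [H1 H2].
assert (Hs : forall (b : nat -> R) n, (forall m, 0 <= b m) -> ex_series b -> b n <= Series b).
{ intros b n Hb Hex.
  assert (Hincr : forall m, 0 <= sum_n b m).
  { intro m; induction m; [rewrite sum_O; auto|].
    rewrite sum_Sn; apply Rplus_le_le_0_compat; auto. }
  apply Rle_trans with (sum_n b n).
  - destruct n; [rewrite sum_O; lra|].
    rewrite sum_Sn; change (b (S n) <= sum_n b n + b (S n)).
    specialize (Hincr n); lra.
  - apply (is_lim_seq_incr_compare (sum_n b)).
    + exact (Series_correct _ Hex).
    + intro m; rewrite sum_Sn; change (sum_n b m <= sum_n b m + b (S m)).
      specialize (Hb (S m)); lra. }
unfold Zsum.
assert (P1 := Hs _ 0%nat (fun m => Ha (Z.of_nat m)) H1).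
assert (P2 := Hs _ 0%nat (fun m => Ha (- Z.of_nat (S m))%Z) H2).
assert (Q1 := Ha (Z.of_nat 0)); assert (Q2 := Ha (- Z.of_nat 1)%Z).
destruct (Z_le_gt_dec 0 k) as [Hk|Hk].
- assert (P := Hs _ (Z.to_nat k) (fun m => Ha (Z.of_nat m)) H1).
  cbv beta in P; rewrite Z2Nat.id in P by exact Hk; simpl in *; lra.
- assert (P := Hs _ (pred (Z.to_nat (- k))) (fun m => Ha (- Z.of_nat (S m))%Z) H2).
  cbv beta in P.
  replace (- Z.of_nat (S (pred (Z.to_nat (- k)))))%Z with k in P by lia.
  simpl in *; lra.
Qed.

Definition jap (k : Z) : R := sqrt (1 + IZR k ^ 2).

Section Hs.
Context (s : R).

Definition Hs_term (f : Z -> C) (k : Z) : R := (Rpower (jap k) s * Cmod (f k)) ^ 2.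

Lemma Hs_term_ge0 f k : 0 <= Hs_term f k.
Proof. apply pow2_ge_0. Qed.

Lemma Hs_term_scal (a : R) f k :
  Hs_term (fun j => scal a (f j : C_R_ModuleSpace)) k = a ^ 2 * Hs_term f k.
Proof.
unfold Hs_term.
rewrite scal_R_Cmult, Cmod_mult, Cmod_R, <- (pow2_abs a); ring.
Qed.

Lemma Hs_term_plus (l : R) f g k : 0 < l ->
  Hs_term (fun j => plus (f j) (g j)) k
  <= (1 + l) * Hs_term f k + (1 + / l) * Hs_term g k.
Proof.
intro Hl; unfold Hs_term; set (w := Rpower (jap k) s).
assert (Hw : 0 < w) by apply exp_pos.
pose proof (Cmod_triangle (f k) (g k)) as Ht.
pose proof (Cmod_ge_0 (f k)) as Hf; pose proof (Cmod_ge_0 (g k)) as Hg.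
change (plus (f k) (g k)) with (f k + g k)%C.
pose proof (Cmod_ge_0 (f k + g k)%C) as Hfg.
set (x := Cmod (f k)) in *; set (y := Cmod (g k)) in *; set (z := Cmod (f k + g k)%C) in *.
apply Rle_trans with ((w * x + w * y) ^ 2).
- apply pow_incr; split; [|rewrite <- Rmult_plus_distr_l]; nra.
- generalize (w * x) (w * y); intros a b.
  assert (H : 0 <= / l * (l * a - b) ^ 2).
  { apply Rmult_le_pos; [left; apply Rinv_0_lt_compat; exact Hl|apply pow2_ge_0]. }
  replace ((1 + l) * a ^ 2 + (1 + / l) * b ^ 2)
    with ((a + b) ^ 2 + / l * (l * a - b) ^ 2) by (field; lra).
  lra.
Qed.

Lemma Hs_term_zero k : Hs_term (fun _ => zero) k = 0.
Proof. unfold Hs_term; change (Cmod zero) with (Cmod 0); rewrite Cmod_0; ring. Qed.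

(** A distribution on the torus is given by its Fourier coefficients: the
    completion of the smooth functions for the weighted l^2 norm of the
    coefficients is the space of all sequences for which that norm is finite. *)
Definition Hs_subspace : subspace Z C_R_ModuleSpace.
Proof.
apply (Subspace Z C_R_ModuleSpace (fun f => Zsummable (Hs_term f))).
- apply (Zsummable_le _ (fun _ => 0)); [|apply Zsum_zero].
  intro k; split; [apply Hs_term_ge0|right; apply Hs_term_zero].
- intros f g Hf Hg.
  apply (Zsummable_le _ (fun k => (1 + 1) * Hs_term f k + (1 + / 1) * Hs_term g k)).
  + intro k; split; [apply Hs_term_ge0|apply Hs_term_plus; lra].
  + apply Zsummable_lin; assumption.
- intros a f Hf.
  apply (Zsummable_le _ (fun k => a ^ 2 * Hs_term f k + 0 * Hs_term f k)).
  + intro k; split; [apply Hs_term_ge0|right; rewrite Hs_term_scal; ring].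
  + apply Zsummable_lin; assumption.
Defined.

Definition Hs_norm (f : subspace_ModuleSpace Hs_subspace) : R :=
  sqrt (Zsum (Hs_term (proj1_sig f))).

Lemma Zsum_Hs_ge0 (f : subspace_ModuleSpace Hs_subspace) : 0 <= Zsum (Hs_term (proj1_sig f)).
Proof.
eapply Rle_trans; [apply (Hs_term_ge0 (proj1_sig f) 0)|].
apply Zsum_ge_term; [intro; apply Hs_term_ge0|exact (proj2_sig f)].
Qed.

Lemma Zsum_Hs_eq0 (f : subspace_ModuleSpace Hs_subspace) :
  Zsum (Hs_term (proj1_sig f)) = 0 -> f = zero.
Proof.
intro H0; apply subspace_eq; intro k.
assert (H := Zsum_ge_term _ k (Hs_term_ge0 (proj1_sig f)) (proj2_sig f)).
rewrite H0 in H; unfold Hs_term in H.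
set (w := Rpower (jap k) s) in H.
assert (Hw : 0 < w) by apply exp_pos.
apply Cmod_eq_0; pose proof (Cmod_ge_0 (proj1_sig f k)).
assert (w * Cmod (proj1_sig f k) = 0) by nra; nra.
Qed.

Lemma Hs_norm_is_norm : is_norm (subspace_ModuleSpace Hs_subspace) Hs_norm.
Proof.
split.
- intros f g.
  destruct (Zsum_Hs_ge0 f) as [Hf|Hf].
  2:{ rewrite (Zsum_Hs_eq0 f (eq_sym Hf)), plus_zero_l.
      unfold Hs_norm at 2; pose proof (sqrt_pos (Zsum (Hs_term (proj1_sig
        (zero : subspace_ModuleSpace Hs_subspace))))); lra. }
  destruct (Zsum_Hs_ge0 g) as [Hg|Hg].
  2:{ rewrite (Zsum_Hs_eq0 g (eq_sym Hg)), plus_zero_r.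
      unfold Hs_norm at 3; pose proof (sqrt_pos (Zsum (Hs_term (proj1_sig
        (zero : subspace_ModuleSpace Hs_subspace))))); lra. }
  unfold Hs_norm.
  set (A := sqrt (Zsum (Hs_term (proj1_sig f)))).
  set (B := sqrt (Zsum (Hs_term (proj1_sig g)))).
  assert (HA : 0 < A) by (apply sqrt_lt_R0; exact Hf).
  assert (HB : 0 < B) by (apply sqrt_lt_R0; exact Hg).
  assert (HA2 : Zsum (Hs_term (proj1_sig f)) = A ^ 2)
    by (unfold A; rewrite pow2_sqrt; lra).
  assert (HB2 : Zsum (Hs_term (proj1_sig g)) = B ^ 2)
    by (unfold B; rewrite pow2_sqrt; lra).
  rewrite <- (sqrt_pow2 (A + B)) by lra.
  apply sqrt_le_1_alt.
  apply Rle_trans with (Zsum (fun k => (1 + B / A) * Hs_term (proj1_sig f) k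
                                     + (1 + / (B / A)) * Hs_term (proj1_sig g) k)).
  + apply Zsum_le.
    * intro k; split; [apply Hs_term_ge0|].
      apply Hs_term_plus; apply Rdiv_lt_0_compat; assumption.
    * apply Zsummable_lin; [exact (proj2_sig f)|exact (proj2_sig g)].
  + rewrite Zsum_lin by (exact (proj2_sig f) || exact (proj2_sig g)).
    rewrite HA2, HB2; right; field; lra.
- intros a f; unfold Hs_norm.
  rewrite <- (sqrt_pow2 (Rabs a)) by apply Rabs_pos.
  rewrite <- sqrt_mult_alt by apply pow2_ge_0.
  apply sqrt_le_1_alt; rewrite pow2_abs.
  apply Rle_trans with (Zsum (fun k => a ^ 2 * Hs_term (proj1_sig f) k
                                     + 0 * Hs_term (proj1_sig f) k)).
  + apply Zsum_le.
    * intro k; split; [apply Hs_term_ge0|right].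
      transitivity (a ^ 2 * Hs_term (proj1_sig f) k); [apply Hs_term_scal|ring].
    * apply Zsummable_lin; exact (proj2_sig f).
  + rewrite Zsum_lin by exact (proj2_sig f); right; ring.
- intros f H; apply Zsum_Hs_eq0; apply sqrt_eq_0; [apply Zsum_Hs_ge0|exact H].
Qed.

(** The scalars are real because [u |-> |u|^2 u] is not complex differentiable. *)
Definition Hs : NormedModule R_AbsRing :=
  normed_space (subspace_ModuleSpace Hs_subspace) Hs_norm Hs_norm_is_norm.

Definition coef (v : Hs) : Z -> C := proj1_sig v.
End Hs.
Arguments coef {s} v _.

Definition periodic (f : R -> C) : Prop := forall x, f (x + 2 * PI) = f x.

Definition smooth (f : R -> C) : Prop :=
  forall n x, ex_derive_n (fun y => Re (f y)) n x /\ ex_derive_n (fun y => Im (f y)) n x.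

Definition cis (x : R) : C := (cos x, sin x).

Definition fourier (f : R -> C) (k : Z) : C :=
  (RtoC (/ (2 * PI)) *
   RInt (V := C_R_CompleteNormedModule)
     (fun x => (f x * cis (- (IZR k * x)))%C) 0 (2 * PI))%C.

Definition represents {s : R} (v : Hs s) (f : R -> C) : Prop :=
  forall k, coef v k = fourier f k.

(** For smooth [f] this determines [g]: a continuous periodic function is
    determined by its Fourier coefficients. *)
Definition is_fourier_multiplier (m : Z -> R) (f g : R -> C) : Prop :=
  periodic g /\
  (forall x, continuous (g : R -> C_UniformSpace) x) /\
  (forall k, fourier g k = (RtoC (m k) * fourier f k)%C).

(** [|k|^(2 alpha)]; the case split is needed since [Rpower 0 y = 1]. *)
Definition frac_symbol (alpha : R) (k : Z) : R :=
  if Z.eq_dec k 0 then 0 else Rpower (Rabs (IZR k)) (2 * alpha).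

(** Smoothness on [[0,T] x R] up to [t = 0] and [t = T]:
    [w i j] is the partial derivative of [u] of order [i] in [t] and [j] in [x]. *)
Definition smooth_on_slab (T : R) (u : R -> R -> C) : Prop :=
  exists w : nat -> nat -> R -> R -> C,
    (forall t x, 0 <= t <= T -> w 0%nat 0%nat t x = u t x) /\
    (forall i j, continuous_on (fun p : R * R => 0 <= fst p <= T)
       (fun p : R * R => w i j (fst p) (snd p) : C_UniformSpace)) /\
    (forall i j t x, 0 < t < T ->
       is_derive (V := C_R_NormedModule) (fun tau => w i j tau x) t (w (S i) j t x)) /\
    (forall i j t x, 0 <= t <= T ->
       is_derive (V := C_R_NormedModule) (fun y => w i j t y) x (w i (S j) t x)).

(** [i u_t + (-Delta)^alpha u = - |u|^2 u] classically on [(0,T)], with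
    [u(0) = u0]; [ut] is [u_t] and [Lu] is [(-Delta)^alpha u]. *)
Definition smooth_solution (alpha T : R) (u0 : R -> C) (u : R -> R -> C) : Prop :=
  smooth_on_slab T u /\
  (forall t, 0 <= t <= T -> periodic (u t)) /\
  (forall x, u 0 x = u0 x) /\
  exists ut Lu : R -> R -> C,
    forall t, 0 < t < T ->
      is_fourier_multiplier (frac_symbol alpha) (u t) (Lu t) /\
      forall x,
        is_derive (V := C_R_NormedModule) (fun tau => u tau x) t (ut t x) /\
        (Ci * ut t x + Lu t x = - (RtoC (Cmod (u t x) ^ 2) * u t x))%C.

(** Smooth solutions are unique, so this fixes [Phi] on smooth data in the
    closed ball of radius [r]. *)
Definition extends_data_to_solution (alpha s r : R) (T : posreal)
    (Phi : Hs s -> C0 T (Hs s)) : Prop :=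
  forall (u0 : R -> C) (v : Hs s),
    smooth u0 -> periodic u0 -> represents v u0 -> norm v <= r ->
    exists u, smooth_solution alpha T u0 u /\
      forall t : Icc T, represents (C0_app (Phi v) t) (u (proj1_sig t)).

(* Main.v *)
Require Import Defs.
From Stdlib Require Import Reals ZArith Lra Lia List FinFun FunctionalExtensionality.
From Coquelicot Require Import Coquelicot.
Import ListNotations.
Open Scope R_scope.

(** Take the data [e * sum_(k in I) exp(i k x)] with [I] a block of [3 M] consecutive frequencies starting
    at [N], where [M] is a small multiple of [N^(1 - alpha)]. On [I] the resonance function
    [|a|^(2 alpha) - |b|^(2 alpha) + |c|^(2 alpha) - |a - b + c|^(2 alpha)] is [O(M^2 N^(2 alpha - 2)) = O(1)],
    so for each output frequency in the middle third of [I] the [M^2] (or more) cubic interactions add up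
    coherently over [[0,T]], and the third-order term in [e] of the corresponding Fourier coefficient
    is at least [c M^2].
    Were the solution map [C^3] at [0], this term would be the third derivative in the direction of the
    data; comparing [H^s] norms gives [M <= C N^(2 s)], which fails for large [N] as [2 s < 1 - alpha].
    The expansion in [e] is justified in the Wiener algebra: the Fourier coefficients of the smooth solution
    solve Duhamel's equation, the l^1 norm of the coefficients is submultiplicative, and it stays of size
    [O(e)] on [[0,T]], whence the solution is its free evolution up to [O(e^3)] uniformly in [x]. *)

(** * Calculus of complex-valued functions and Fourier coefficients *)

(** The comparison of norms is made by duality, through real functions of [e] alone. The test
    functional sums phase-corrected coefficients over the middle third [J] at time [T]; its norm is
    O(M^(1/2) N^(-s)), while the datum has norm O(M^(1/2) N^s). A bounded third derivative thus
    yields at most O(M^2 N^(2 s)), whereas the [M] frequencies of [J], each gaining at least c T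
    M^2, yield c T M^3; the quotient is the bound M <= C N^(2 s). The obstacle is that [Phi] is
    known only through smooth solutions that come without any quantitative estimate, while the
    expansion in [e] needs errors O(e^3) and O(e^5) on the whole of [0,T]. Smoothness provides some
    finite l^1 bound for each solution, with no control in [e]; a bootstrap then turns it into O(e).
    Since [N] and [M] are frozen before [e] tends to 0, these errors may carry any powers of [M].
    The l^1 norm appears in two forms, because bounds on coefficients come from the equation while
    products and pointwise bounds come from approximation by trigonometric polynomials; Fejer means
    pass from the first form to the second. *)

Definition ccont (f : R -> C) : Prop := forall x, continuous (f : R -> C_UniformSpace) x.

Lemma continuous_C_pair (f : R -> C) x :
  continuous (fun y => fst (f y)) x -> continuous (fun y => snd (f y)) x ->
  continuous (f : R -> C_UniformSpace) x.
Proof.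
intros H1 H2.
apply (continuous_ext (fun y => (fst (f y), snd (f y)))).
- intro y; symmetry; apply surjective_pairing.
- intros P [e He].
  assert (H1' := H1 _ (locally_ball _ e)); assert (H2' := H2 _ (locally_ball _ e)).
  unfold filtermap in *; change (locally x (fun y => P (fst (f y), snd (f y)))).
  generalize (filter_and _ _ H1' H2'); apply filter_imp.
  intros y [K1 K2]; apply He; split; assumption.
Qed.

Lemma ccont_fst f : ccont f -> forall x, continuous (fun y => fst (f y)) x.
Proof. intros H x; apply (continuous_comp f fst); [apply H|apply continuous_fst]. Qed.

Lemma ccont_snd f : ccont f -> forall x, continuous (fun y => snd (f y)) x.
Proof. intros H x; apply (continuous_comp f snd); [apply H|apply continuous_snd]. Qed.

Lemma ccont_const c : ccont (fun _ => c).
Proof. intro x; apply continuous_const. Qed.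

Lemma ccont_ext f g : (forall x, f x = g x) -> ccont f -> ccont g.
Proof. intros H K x; exact (continuous_ext f g x H (K x)). Qed.

Lemma ccont_plus f g : ccont f -> ccont g -> ccont (fun x => (f x + g x)%C).
Proof. intros Hf Hg x; exact (continuous_plus (V := C_R_NormedModule) f g x (Hf x) (Hg x)). Qed.

Lemma ccont_mult f g : ccont f -> ccont g -> ccont (fun x => (f x * g x)%C).
Proof.
intros Hf Hg x; apply continuous_C_pair; simpl.
- apply (continuous_minus (V := R_NormedModule));
    apply (continuous_mult (K := R_AbsRing)); (apply ccont_fst || apply ccont_snd); auto.
- apply (continuous_plus (V := R_NormedModule));
    apply (continuous_mult (K := R_AbsRing)); (apply ccont_fst || apply ccont_snd); auto.
Qed.

Lemma ccont_opp f : ccont f -> ccont (fun x => (- f x)%C).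
Proof. intros Hf x; exact (continuous_opp (V := C_R_NormedModule) f x (Hf x)). Qed.

Lemma ccont_minus f g : ccont f -> ccont g -> ccont (fun x => (f x - g x)%C).
Proof. intros Hf Hg; apply ccont_plus; [exact Hf|apply ccont_opp, Hg]. Qed.

Lemma ccont_conj f : ccont f -> ccont (fun x => Cconj (f x)).
Proof.
intros Hf x; apply continuous_C_pair; simpl; [apply ccont_fst, Hf|].
apply (continuous_opp (V := R_NormedModule)); apply ccont_snd, Hf.
Qed.

Lemma continuous_Cmod f : ccont f -> forall x, continuous (fun y => Cmod (f y)) x.
Proof.
intros Hf x; apply (continuous_ext (fun y => @norm R_AbsRing C_R_NormedModule (f y))).
- intro y; symmetry; apply Cmod_norm.
- apply (continuous_comp f (fun c => @norm R_AbsRing C_R_NormedModule c)); [apply Hf|].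
  apply (filterlim_norm (V := C_R_NormedModule)).
Qed.

Lemma ccont_RtoC (g : R -> R) : (forall x, continuous g x) -> ccont (fun x => RtoC (g x)).
Proof. intros Hg x; apply continuous_C_pair; simpl; [apply Hg|apply continuous_const]. Qed.

Definition expi (k : Z) (x : R) : C := cis (IZR k * x).

Lemma cis_plus x y : cis (x + y) = (cis x * cis y)%C.
Proof. unfold cis, Cmult; simpl; rewrite cos_plus, sin_plus; f_equal; ring. Qed.

Lemma cis_0 : cis 0 = RtoC 1.
Proof. unfold cis; rewrite cos_0, sin_0; reflexivity. Qed.

Lemma cis_opp x : cis (- x) = Cconj (cis x).
Proof. unfold cis, Cconj; simpl; rewrite cos_neg, sin_neg; reflexivity. Qed.

Lemma Cmod_cis x : Cmod (cis x) = 1.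
Proof.
unfold Cmod, cis; simpl; replace (_ + _) with 1; [apply sqrt_1|].
pose proof (sin2_cos2 x) as H; unfold Rsqr in H; lra.
Qed.

Lemma cis_2kPI x (n : Z) : cis (x + IZR n * (2 * PI)) = cis x.
Proof.
assert (P : forall y (m : nat), cis (y + INR m * (2 * PI)) = cis y).
{ intros y m; unfold cis; replace (INR m * (2 * PI)) with (2 * INR m * PI) by ring.
  rewrite cos_period, sin_period; reflexivity. }
destruct (Z_le_gt_dec 0 n) as [H|H].
- rewrite <- (Z2Nat.id n), <- INR_IZR_INZ by exact H; apply P.
- rewrite <- (P _ (Z.to_nat (- n))); f_equal.
  rewrite INR_IZR_INZ, Z2Nat.id, opp_IZR by lia; ring.
Qed.

Lemma ccont_cis (a b : R) : ccont (fun x => cis (a * x + b)).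
Proof.
intro x; apply continuous_C_pair; simpl.
- apply (ex_derive_continuous (V := R_NormedModule) (fun y => cos (a * y + b))); auto_derive; exact I.
- apply (ex_derive_continuous (V := R_NormedModule) (fun y => sin (a * y + b))); auto_derive; exact I.
Qed.

Lemma ccont_expi k : ccont (expi k).
Proof.
apply (ccont_ext (fun x => cis (IZR k * x + 0))); [|apply ccont_cis].
intro x; unfold expi; f_equal; ring.
Qed.

Lemma expi_plus j k x : expi (j + k) x = (expi j x * expi k x)%C.
Proof. unfold expi; rewrite <- cis_plus, plus_IZR; f_equal; ring. Qed.

Lemma expi_opp k x : expi (- k) x = Cconj (expi k x).
Proof. unfold expi; rewrite <- cis_opp, opp_IZR; f_equal; ring. Qed.

Lemma expi_sub k x y : expi k (x - y) = (expi k x * Cconj (expi k y))%C.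
Proof. unfold expi; rewrite <- cis_opp, <- cis_plus; f_equal; ring. Qed.

Lemma Cmod_expi k x : Cmod (expi k x) = 1.
Proof. apply Cmod_cis. Qed.

Lemma expi_0 x : expi 0 x = RtoC 1.
Proof. unfold expi; rewrite Rmult_0_l; apply cis_0. Qed.

Lemma expi_periodic k x (n : Z) : expi k (x + IZR n * (2 * PI)) = expi k x.
Proof.
unfold expi; replace (_ * _) with (IZR k * x + IZR (k * n) * (2 * PI)).
- apply cis_2kPI.
- rewrite mult_IZR; ring.
Qed.

(** * Integrals over one period and Fourier coefficients *)

Definition CInt (f : R -> C) : C := RInt (V := C_R_CompleteNormedModule) f 0 (2 * PI).

Lemma CInt_correct f : ccont f -> is_RInt (V := C_R_CompleteNormedModule) f 0 (2 * PI) (CInt f).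
Proof.
intro Hf; apply (RInt_correct (V := C_R_CompleteNormedModule)).
apply (ex_RInt_continuous (V := C_R_CompleteNormedModule)); intros x _; apply Hf.
Qed.

Lemma CInt_unique f l : is_RInt (V := C_R_CompleteNormedModule) f 0 (2 * PI) l -> CInt f = l.
Proof. apply (is_RInt_unique (V := C_R_CompleteNormedModule)). Qed.

Lemma is_RInt_fst f a b l : is_RInt (V := C_R_NormedModule) f a b l ->
  is_RInt (fun x => fst (f x)) a b (fst l).
Proof. apply (is_RInt_fct_extend_fst (U := R_NormedModule) (V := R_NormedModule)). Qed.

Lemma is_RInt_snd f a b l : is_RInt (V := C_R_NormedModule) f a b l ->
  is_RInt (fun x => snd (f x)) a b (snd l).
Proof. apply (is_RInt_fct_extend_snd (U := R_NormedModule) (V := R_NormedModule)). Qed.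

Lemma is_RInt_Cpair (f : R -> C) a b (l : C) :
  is_RInt (fun x => fst (f x)) a b (fst l) -> is_RInt (fun x => snd (f x)) a b (snd l) ->
  is_RInt (V := C_R_NormedModule) f a b l.
Proof.
intros H1 H2; rewrite (surjective_pairing l).
exact (is_RInt_fct_extend_pair (U := R_NormedModule) (V := R_NormedModule) f a b _ _ H1 H2).
Qed.

Lemma CInt_ext f g : (forall x, f x = g x) -> CInt f = CInt g.
Proof. intro H; apply (RInt_ext (V := C_R_CompleteNormedModule)); intros x _; apply H. Qed.

Lemma CInt_plus f g : ccont f -> ccont g -> CInt (fun x => (f x + g x)%C) = (CInt f + CInt g)%C.
Proof.
intros Hf Hg; apply CInt_unique.
exact (is_RInt_plus (V := C_R_NormedModule) f g 0 (2 * PI) _ _ (CInt_correct f Hf) (CInt_correct g Hg)).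
Qed.

Lemma CInt_mult c f : ccont f -> CInt (fun x => (c * f x)%C) = (c * CInt f)%C.
Proof.
intros Hf; apply CInt_unique; pose proof (CInt_correct f Hf) as H.
pose proof (is_RInt_fst _ _ _ _ H) as H1; pose proof (is_RInt_snd _ _ _ _ H) as H2.
apply is_RInt_Cpair; simpl.
- apply (is_RInt_minus (V := R_NormedModule)); apply (is_RInt_scal (V := R_NormedModule)); assumption.
- apply (is_RInt_plus (V := R_NormedModule)); apply (is_RInt_scal (V := R_NormedModule)); assumption.
Qed.

Lemma twoPI_pos : 0 < 2 * PI.
Proof. pose proof PI_RGT_0; lra. Qed.

Lemma CInt_le f (g : R -> R) lg : ccont f -> (forall x, Cmod (f x) <= g x) ->
  is_RInt g 0 (2 * PI) lg -> Cmod (CInt f) <= lg.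
Proof.
intros Hf Hle Hg; rewrite Cmod_norm.
apply (norm_RInt_le (V := C_R_NormedModule) f g 0 (2 * PI)).
- pose proof twoPI_pos; lra.
- intros x _; rewrite <- Cmod_norm; apply Hle.
- apply (CInt_correct f Hf).
- exact Hg.
Qed.

Lemma fourierE f k : fourier f k = (RtoC (/ (2 * PI)) * CInt (fun x => f x * expi (- k) x))%C.
Proof.
unfold fourier; f_equal; apply CInt_ext; intro x; unfold expi; do 2 f_equal; rewrite opp_IZR; ring.
Qed.

Lemma fourier_ext f g k : (forall x, f x = g x) -> fourier f k = fourier g k.
Proof. intro H; rewrite !fourierE; f_equal; apply CInt_ext; intro x; rewrite H; reflexivity. Qed.

Lemma fourier_plus f g k : ccont f -> ccont g ->
  fourier (fun x => (f x + g x)%C) k = (fourier f k + fourier g k)%C.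
Proof.
intros Hf Hg; rewrite !fourierE, <- Cmult_plus_distr_l, <- CInt_plus
  by (apply ccont_mult; [assumption|apply ccont_expi]).
f_equal; apply CInt_ext; intro x; ring.
Qed.

Lemma fourier_mult c f k : ccont f -> fourier (fun x => (c * f x)%C) k = (c * fourier f k)%C.
Proof.
intros Hf; rewrite !fourierE.
rewrite (CInt_ext _ (fun x => c * (f x * expi (- k) x))%C) by (intro x; ring).
rewrite CInt_mult by (apply ccont_mult; [assumption|apply ccont_expi]); ring.
Qed.

Lemma fourier_minus f g k : ccont f -> ccont g ->
  fourier (fun x => (f x - g x)%C) k = (fourier f k - fourier g k)%C.
Proof.
intros Hf Hg.
rewrite (fourier_ext _ (fun x => f x + (- (1)) * g x)%C) by (intro x; ring).
rewrite fourier_plus, fourier_mult; auto; [ring|].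
apply ccont_mult; [apply ccont_const|exact Hg].
Qed.

Lemma is_RInt_const_2PI (B : R) : is_RInt (fun _ => B) 0 (2 * PI) (2 * PI * B).
Proof.
pose proof (is_RInt_const (V := R_NormedModule) 0 (2 * PI) B) as H.
change (scal (2 * PI - 0) B) with ((2 * PI - 0) * B) in H.
rewrite Rminus_0_r in H; exact H.
Qed.

Lemma fourier_bound f k B : ccont f -> (forall x, Cmod (f x) <= B) -> Cmod (fourier f k) <= B.
Proof.
intros Hf HB; rewrite fourierE, Cmod_mult, Cmod_R.
pose proof twoPI_pos as H.
rewrite Rabs_pos_eq by (left; apply Rinv_0_lt_compat; exact H).
apply Rmult_le_reg_l with (2 * PI); [exact H|].
rewrite <- Rmult_assoc, Rinv_r, Rmult_1_l by lra.
apply (CInt_le _ (fun _ => B)).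
- apply ccont_mult; [exact Hf|apply ccont_expi].
- intro x; rewrite Cmod_mult, Cmod_expi, Rmult_1_r; apply HB.
- apply is_RInt_const_2PI.
Qed.

Lemma fourier_close f g k B : ccont f -> ccont g -> (forall x, Cmod (f x - g x) <= B) ->
  Cmod (fourier f k - fourier g k) <= B.
Proof.
intros Hf Hg H; rewrite <- fourier_minus by assumption.
apply fourier_bound; [apply ccont_minus; assumption|exact H].
Qed.

Lemma is_derive_C_pair (f : R -> C) (x : R) (l : C) :
  is_derive (fun y => fst (f y)) x (fst l) -> is_derive (fun y => snd (f y)) x (snd l) ->
  is_derive (V := C_R_NormedModule) f x l.
Proof.
intros H1 H2.
apply (is_derive_ext (V := C_R_NormedModule) (fun y => (fst (f y), snd (f y)))).
- intro y; symmetry; apply surjective_pairing.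
- destruct l as [l1 l2]; simpl in *.
  apply (filterdiff_ext_lin (U := R_NormedModule) (V := C_R_NormedModule) _
    (fun y : R => (scal y l1, scal y l2))); [|intro y; reflexivity].
  apply (filterdiff_comp_2 (T := R_NormedModule) (U := R_NormedModule) (V := R_NormedModule)
    (W := C_R_NormedModule)
    (fun y => fst (f y)) (fun y => snd (f y)) (fun a b => (a, b))
    (fun y => scal y l1) (fun y => scal y l2) (fun a b => (a, b))); auto.
  apply (filterdiff_ext_lin (V := C_R_NormedModule) _ (fun p : R * R => p)); [|intros [a b]; reflexivity].
  apply (filterdiff_ext (V := C_R_NormedModule) (fun p : R * R => p)); [intros [a b]; reflexivity|].
  apply (filterdiff_id (V := C_R_NormedModule)).
Qed.

Lemma is_derive_C_fst (f : R -> C) x l : is_derive (V := C_R_NormedModule) f x l ->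
  is_derive (fun y => fst (f y)) x (fst l).
Proof.
intro H; apply (filterdiff_ext_lin (U := R_NormedModule) (V := R_NormedModule) _ (fun y : R => fst (scal y l : C_R_NormedModule))); [|intro; reflexivity].
apply (filterdiff_comp (U := R_NormedModule) (V := C_R_NormedModule) (W := R_NormedModule) f fst (fun y : R => scal y l : C_R_NormedModule) fst H).
apply filterdiff_linear, is_linear_fst.
Qed.

Lemma is_derive_C_snd (f : R -> C) x l : is_derive (V := C_R_NormedModule) f x l ->
  is_derive (fun y => snd (f y)) x (snd l).
Proof.
intro H; apply (filterdiff_ext_lin (U := R_NormedModule) (V := R_NormedModule) _ (fun y : R => snd (scal y l : C_R_NormedModule))); [|intro; reflexivity].
apply (filterdiff_comp (U := R_NormedModule) (V := C_R_NormedModule) (W := R_NormedModule) f snd (fun y : R => scal y l : C_R_NormedModule) snd H).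
apply filterdiff_linear, is_linear_snd.
Qed.

Lemma is_derive_Rmult (f g : R -> R) x a b : is_derive f x a -> is_derive g x b ->
  is_derive (fun y => f y * g y) x (a * g x + f x * b).
Proof.
intros Hf Hg.
exact (is_derive_mult f g x a b Hf Hg Rmult_comm).
Qed.

Lemma is_derive_Cmult f g x df dg :
  is_derive (V := C_R_NormedModule) f x df -> is_derive (V := C_R_NormedModule) g x dg ->
  is_derive (V := C_R_NormedModule) (fun y => f y * g y)%C x (df * g x + f x * dg)%C.
Proof.
intros Hf Hg.
pose proof (is_derive_C_fst _ _ _ Hf); pose proof (is_derive_C_snd _ _ _ Hf).
pose proof (is_derive_C_fst _ _ _ Hg); pose proof (is_derive_C_snd _ _ _ Hg).
apply is_derive_C_pair; simpl.
- replace (_ - _ + _) with ((fst df * fst (g x) + fst (f x) * fst dg)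
    - (snd df * snd (g x) + snd (f x) * snd dg)) by ring.
  apply (is_derive_minus (V := R_NormedModule)); apply is_derive_Rmult; assumption.
- replace (_ + _ + _) with ((fst df * snd (g x) + fst (f x) * snd dg)
    + (snd df * fst (g x) + snd (f x) * fst dg)) by ring.
  apply (is_derive_plus (V := R_NormedModule)); apply is_derive_Rmult; assumption.
Qed.

Lemma is_derive_Cmult_l c f x l : is_derive (V := C_R_NormedModule) f x l ->
  is_derive (V := C_R_NormedModule) (fun y => c * f y)%C x (c * l)%C.
Proof.
intro H.
replace (c * l)%C with (RtoC 0 * f x + c * l)%C by ring.
apply is_derive_Cmult; [exact (is_derive_const (V := C_R_NormedModule) c x)|exact H].
Qed.

Lemma is_derive_cis a b x :
  is_derive (V := C_R_NormedModule) (fun y => cis (a * y + b)) x (RtoC a * Ci * cis (a * x + b))%C.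
Proof.
apply is_derive_C_pair; simpl; auto_derive; auto; ring.
Qed.

Lemma is_derive_expi k x :
  is_derive (V := C_R_NormedModule) (expi k) x (RtoC (IZR k) * Ci * expi k x)%C.
Proof.
apply (is_derive_ext (V := C_R_NormedModule) (fun y => cis (IZR k * y + 0))).
- intro y; unfold expi; f_equal; ring.
- unfold expi; rewrite <- (Rplus_0_r (IZR k * x)); apply is_derive_cis.
Qed.

Lemma periodic_Z f : periodic f -> forall x (n : Z), f (x + IZR n * (2 * PI)) = f x.
Proof.
intro Hf.
assert (P : forall y (m : nat), f (y + INR m * (2 * PI)) = f y).
{ intros y m; induction m as [|m IH].
  - simpl; rewrite Rmult_0_l, Rplus_0_r; reflexivity.
  - rewrite <- (Hf (y + INR m * (2 * PI))) in IH; rewrite S_INR, <- IH; f_equal; ring. }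
intros x n; destruct (Z_le_gt_dec 0 n) as [H|H].
- rewrite <- (Z2Nat.id n), <- INR_IZR_INZ by exact H; apply P.
- rewrite <- (P _ (Z.to_nat (- n))); f_equal.
  rewrite INR_IZR_INZ, Z2Nat.id, opp_IZR by lia; ring.
Qed.

(** Integration by parts: [f * expi (- k)] takes the same value at 0 and at 2 pi, so its derivative
    integrates to zero over the period. *)
Lemma fourier_deriv f df k : periodic f -> 
  (forall x, is_derive (V := C_R_NormedModule) f x (df x)) -> ccont df ->
  fourier df k = (RtoC (IZR k) * Ci * fourier f k)%C.
Proof.
intros Hp Hd Hc.
assert (Hcf : ccont f).
{ intro x; apply (ex_derive_continuous (V := C_R_NormedModule)); exists (df x); apply Hd. }
assert (H : CInt (fun x => df x * expi (- k) x + f x * (RtoC (IZR (- k)) * Ci * expi (- k) x))%C = 0).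
{ apply CInt_unique.
  replace (RtoC 0) with (minus (G := C_R_NormedModule) (f (2 * PI)%R * expi (- k) (2 * PI)%R)%C (f 0 * expi (- k) 0)%C).
  - apply (is_RInt_derive (V := C_R_CompleteNormedModule) (fun x => f x * expi (- k) x)%C).
    + intros x _; apply is_derive_Cmult; [apply Hd|apply is_derive_expi].
    + intros x _; revert x; apply ccont_plus; apply ccont_mult; auto using ccont_expi.
      apply ccont_mult; [apply ccont_const|apply ccont_expi].
  - replace (2 * PI) with (0 + 2 * PI) by ring; rewrite Hp.
    replace (0 + 2 * PI) with (0 + IZR 1 * (2 * PI)) by ring; rewrite expi_periodic.
    apply (minus_eq_zero (G := C_R_NormedModule)). }
rewrite CInt_plus in H.
- rewrite (CInt_ext (fun x => f x * _)%C (fun x => (RtoC (IZR (- k)) * Ci) * (f x * expi (- k) x))%C) in H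
    by (intro; ring).
  rewrite CInt_mult in H by (apply ccont_mult; auto using ccont_expi).
  rewrite !fourierE.
  replace (CInt (fun x => df x * expi (- k) x)%C)
    with (- (RtoC (IZR (- k)) * Ci * CInt (fun x => f x * expi (- k) x)%C))%C.
  + rewrite opp_IZR, RtoC_opp; ring.
  + symmetry; rewrite <- (Cplus_0_r (CInt _)), <- (Cplus_opp_r (RtoC (IZR (- k)) * Ci * CInt (fun x => f x * expi (- k) x)%C)%C).
    rewrite Cplus_assoc, H; ring.
- apply ccont_mult; auto using ccont_expi.
- apply ccont_mult; auto; apply ccont_mult; auto using ccont_expi, ccont_const.
Qed.

(** For [k <> 0] the derivative formula applied to a constant reads 0 = i k c_k, so no oscillatory
    integral has to be computed. *)
Lemma fourier_const k : fourier (fun _ => RtoC 1) k = if Z.eq_dec k 0 then RtoC 1 else RtoC 0.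
Proof.
pose proof twoPI_pos as HP; destruct (Z.eq_dec k 0) as [->|Hk].
- rewrite fourierE, (CInt_ext _ (fun _ => RtoC 1)).
  + rewrite (CInt_unique _ (RtoC (2 * PI))).
    * rewrite <- RtoC_mult; f_equal; field; lra.
    * apply is_RInt_Cpair; simpl; [rewrite <- (Rmult_1_r (2 * PI)) at 2|rewrite <- (Rmult_0_r (2 * PI)) at 2];
        apply is_RInt_const_2PI.
  + intro x; change (- 0)%Z with 0%Z; rewrite expi_0; ring.
- assert (H := fourier_deriv (fun _ => RtoC 1) (fun _ => RtoC 0) k).
  rewrite (fourier_ext (fun _ => RtoC 0) (fun _ => RtoC 0 * RtoC 1)%C), fourier_mult in H
    by (apply ccont_const || intro; ring).
  rewrite Cmult_0_l in H.
  destruct (Ceq_dec (fourier (fun _ => RtoC 1) k) 0) as [E|E]; [exact E|exfalso].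
  assert (HH : (RtoC (IZR k) * Ci * fourier (fun _ => RtoC 1) k)%C = 0).
  { symmetry; apply H.
    - intro; reflexivity.
    - intro; apply (is_derive_const (V := C_R_NormedModule)).
    - apply ccont_const. }
  revert HH; apply Cmult_neq_0; [apply Cmult_neq_0|exact E].
  + intro A; apply Hk, eq_IZR; injection A; auto.
  + intro A; injection A; lra.
Qed.

Lemma fourier_expiE n k : fourier (expi n) k = if Z.eq_dec n k then RtoC 1 else RtoC 0.
Proof.
transitivity (fourier (fun _ => RtoC 1) (k - n)).
- rewrite !fourierE; f_equal; apply CInt_ext; intro x; rewrite <- expi_plus, Cmult_1_l; f_equal; lia.
- rewrite fourier_const; destruct Z.eq_dec, Z.eq_dec; reflexivity || lia.
Qed.

(** * Trigonometric polynomials, Wiener norm and Fejer's theorem *)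

Definition Rsum {A} (g : A -> R) (l : list A) : R := fold_right (fun a s => g a + s) 0 l.
Definition Csum {A} (g : A -> C) (l : list A) : C := fold_right (fun a s => g a + s)%C (RtoC 0) l.

Lemma Rsum_app {A} (g : A -> R) l m : Rsum g (l ++ m) = Rsum g l + Rsum g m.
Proof. induction l as [|a l IH]; simpl; [|rewrite IH]; ring. Qed.

Lemma Rsum_le {A} (g h : A -> R) l : (forall a, In a l -> g a <= h a) -> Rsum g l <= Rsum h l.
Proof.
induction l as [|a l IH]; simpl; intro H; [lra|].
apply Rplus_le_compat; auto.
Qed.

Lemma Rsum_ext {A} (g h : A -> R) l : (forall a, In a l -> g a = h a) -> Rsum g l = Rsum h l.
Proof. intro H; apply Rle_antisym; apply Rsum_le; intros a Ha; rewrite H by exact Ha; lra. Qed.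

Lemma Rsum_plus {A} (g h : A -> R) l : Rsum (fun a => g a + h a) l = Rsum g l + Rsum h l.
Proof. induction l as [|a l IH]; simpl; [|rewrite IH]; ring. Qed.

Lemma Rsum_scal {A} c (g : A -> R) l : Rsum (fun a => c * g a) l = c * Rsum g l.
Proof. induction l as [|a l IH]; simpl; [|rewrite IH]; ring. Qed.

Lemma Rsum_const {A} c (l : list A) : Rsum (fun _ => c) l = INR (length l) * c.
Proof.
induction l as [|a l IH]; [simpl; ring|].
change (c + Rsum (fun _ => c) l = INR (S (length l)) * c); rewrite IH, S_INR; ring.
Qed.

Lemma Rsum_ge0 {A} (g : A -> R) l : (forall a, In a l -> 0 <= g a) -> 0 <= Rsum g l.
Proof.
intro H; rewrite <- (Rmult_0_r (INR (length l))), <- (Rsum_const 0 l); apply Rsum_le, H.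
Qed.

Lemma Rsum_map {A B} (f : A -> B) (g : B -> R) l : Rsum g (map f l) = Rsum (fun a => g (f a)) l.
Proof. induction l as [|a l IH]; simpl; [|rewrite IH]; reflexivity. Qed.

Lemma Rsum_flat_map {A B} (f : A -> list B) (g : B -> R) l :
  Rsum g (flat_map f l) = Rsum (fun a => Rsum g (f a)) l.
Proof. induction l as [|a l IH]; simpl; [|rewrite Rsum_app, IH]; reflexivity. Qed.

Lemma Csum_app {A} (g : A -> C) l m : Csum g (l ++ m) = (Csum g l + Csum g m)%C.
Proof. induction l as [|a l IH]; simpl; [|rewrite IH]; ring. Qed.

Lemma Csum_ext {A} (g h : A -> C) l : (forall a, In a l -> g a = h a) -> Csum g l = Csum h l.
Proof.
induction l as [|a l IH]; simpl; intro H; [reflexivity|].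
rewrite H, IH by auto; reflexivity.
Qed.

Lemma Csum_mult_l {A} c (g : A -> C) l : Csum (fun a => c * g a)%C l = (c * Csum g l)%C.
Proof. induction l as [|a l IH]; simpl; [|rewrite IH]; ring. Qed.

Lemma Csum_conj {A} (g : A -> C) l : Csum (fun a => Cconj (g a)) l = Cconj (Csum g l).
Proof.
induction l as [|a l IH]; simpl; [apply injective_projections; simpl; ring|].
rewrite IH; apply injective_projections; simpl; ring.
Qed.

Lemma Csum_map {A B} (f : A -> B) (g : B -> C) l : Csum g (map f l) = Csum (fun a => g (f a)) l.
Proof. induction l as [|a l IH]; simpl; [|rewrite IH]; reflexivity. Qed.

Lemma Csum_flat_map {A B} (f : A -> list B) (g : B -> C) l :
  Csum g (flat_map f l) = Csum (fun a => Csum g (f a)) l.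
Proof. induction l as [|a l IH]; simpl; [|rewrite Csum_app, IH]; reflexivity. Qed.

Lemma Csum_const {A} c (l : list A) : Csum (fun _ => c) l = (RtoC (INR (length l)) * c)%C.
Proof.
induction l as [|a l IH]; [simpl; ring|].
change ((c + Csum (fun _ => c) l)%C = (RtoC (INR (S (length l))) * c)%C); rewrite IH, S_INR, RtoC_plus; ring.
Qed.

Lemma Cmod_Csum {A} (g : A -> C) l : Cmod (Csum g l) <= Rsum (fun a => Cmod (g a)) l.
Proof.
induction l as [|a l IH]; simpl; [rewrite Cmod_0; lra|].
eapply Rle_trans; [apply Cmod_triangle|]; lra.
Qed.

Definition delta (n k : Z) : R := if Z.eq_dec n k then 1 else 0.

Lemma Rsum_delta (n : Z) l : NoDup l -> Rsum (delta n) l <= 1.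
Proof.
intro H; induction H as [|k l Hk H IH]; simpl; [lra|].
unfold delta at 1; destruct Z.eq_dec as [->|E]; [|lra].
rewrite (Rsum_ext _ (fun _ => 0)); [rewrite Rsum_const; lra|].
intros j Hj; unfold delta; destruct Z.eq_dec as [->|]; [contradiction|reflexivity].
Qed.

Lemma Csum_delta (n : Z) (l : list Z) : NoDup l -> In n l -> Csum (fun k => RtoC (delta n k)) l = RtoC 1.
Proof.
intro H; induction H as [|k l Hk H IH]; simpl; [contradiction|].
unfold delta at 1; destruct Z.eq_dec as [->|E].
- intros _; rewrite (Csum_ext _ (fun _ => RtoC 0)); [rewrite Csum_const; ring|].
  intros j Hj; unfold delta; destruct Z.eq_dec as [->|]; [contradiction|reflexivity].
- intros [F|F]; [congruence|]; rewrite IH by exact F; ring.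
Qed.

(** Frequencies may repeat in the list. Products are then plain list operations with exactly
    multiplicative weights; in return [trig_weight] only bounds the l^1 norm of the coefficients
    from above, since repeated terms may cancel. *)
Definition trig_eval (p : list (C * Z)) (x : R) : C := Csum (fun cn => fst cn * expi (snd cn) x)%C p.
Definition trig_weight (p : list (C * Z)) : R := Rsum (fun cn => Cmod (fst cn)) p.

Lemma trig_weight_ge0 p : 0 <= trig_weight p.
Proof. apply Rsum_ge0; intros; apply Cmod_ge_0. Qed.

Lemma ccont_trig_eval p : ccont (trig_eval p).
Proof.
induction p as [|a p IH]; [apply ccont_const|].
exact (ccont_plus _ _ (ccont_mult _ _ (ccont_const (fst a)) (ccont_expi (snd a))) IH).
Qed.

Lemma Cmod_trig_eval p x : Cmod (trig_eval p x) <= trig_weight p.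
Proof.
eapply Rle_trans; [apply Cmod_Csum|].
apply Rsum_le; intros a _; rewrite Cmod_mult, Cmod_expi, Rmult_1_r; lra.
Qed.

Lemma fourier_trig_eval p k : fourier (trig_eval p) k = Csum (fun cn => fst cn * RtoC (delta (snd cn) k))%C p.
Proof.
induction p as [|[c n] p IH].
- simpl; rewrite (fourier_ext _ (fun _ => RtoC 0 * RtoC 1)%C), fourier_mult.
  + ring.
  + apply ccont_const.
  + intro x; unfold trig_eval; simpl; ring.
- change (trig_eval ((c, n) :: p)) with (fun x => c * expi n x + trig_eval p x)%C.
  rewrite fourier_plus, fourier_mult, IH, fourier_expiE; simpl.
  + f_equal; f_equal; unfold delta; destruct Z.eq_dec; reflexivity.
  + apply ccont_expi.
  + apply (ccont_mult _ _ (ccont_const c)), ccont_expi.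
  + apply ccont_trig_eval.
Qed.

Lemma is_derive_trig_eval p x : is_derive (V := C_R_NormedModule) (trig_eval p) x
  (trig_eval (map (fun cn => (fst cn * (RtoC (IZR (snd cn)) * Ci), snd cn)%C) p) x).
Proof.
induction p as [|[c n] p IH].
- apply (is_derive_const (V := C_R_NormedModule)).
- apply (is_derive_plus (V := C_R_NormedModule) (fun x => c * expi n x)%C (trig_eval p)); [|exact IH].
  simpl; rewrite <- Cmult_assoc; apply is_derive_Cmult_l, is_derive_expi.
Qed.

Definition trig_mul (p q : list (C * Z)) : list (C * Z) :=
  flat_map (fun a => map (fun b => (fst a * fst b, (snd a + snd b)%Z)%C) q) p.
Definition trig_conj (p : list (C * Z)) : list (C * Z) :=
  map (fun a => (Cconj (fst a), (- snd a)%Z)) p.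

Lemma trig_eval_trig_mul p q x : trig_eval (trig_mul p q) x = (trig_eval p x * trig_eval q x)%C.
Proof.
unfold trig_eval, trig_mul; rewrite Csum_flat_map.
rewrite (Csum_ext _ (fun a => Csum (fun b => fst b * expi (snd b) x) q * (fst a * expi (snd a) x))%C).
- rewrite Csum_mult_l; ring.
- intros a _; rewrite Csum_map; simpl.
  rewrite (Csum_ext _ (fun b => (fst a * expi (snd a) x) * (fst b * expi (snd b) x))%C).
  + rewrite Csum_mult_l; ring.
  + intros b _; rewrite expi_plus; ring.
Qed.

Lemma trig_weight_trig_mul p q : trig_weight (trig_mul p q) = trig_weight p * trig_weight q.
Proof.
unfold trig_weight, trig_mul; rewrite Rsum_flat_map.
rewrite (Rsum_ext _ (fun a => Rsum (fun b => Cmod (fst b)) q * Cmod (fst a))).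
- rewrite Rsum_scal; ring.
- intros a _; rewrite Rsum_map; simpl.
  rewrite (Rsum_ext _ (fun b => Cmod (fst a) * Cmod (fst b))).
  + rewrite Rsum_scal; ring.
  + intros b _; apply Cmod_mult.
Qed.

Lemma trig_eval_trig_conj p x : trig_eval (trig_conj p) x = Cconj (trig_eval p x).
Proof.
unfold trig_eval, trig_conj; rewrite Csum_map, <- Csum_conj; apply Csum_ext; intros a _; simpl.
rewrite expi_opp; apply injective_projections; simpl; ring.
Qed.

Lemma trig_weight_trig_conj p : trig_weight (trig_conj p) = trig_weight p.
Proof. unfold trig_weight, trig_conj; rewrite Rsum_map; apply Rsum_ext; intros a _; apply Cmod_conj. Qed.

(** The Wiener norm of [f], i.e. the l^1 norm of its Fourier coefficients, is at most [B]. *)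
Definition wiener_le (f : R -> C) (B : R) : Prop :=
  forall l, NoDup l -> Rsum (fun k => Cmod (fourier f k)) l <= B.

(** In this form the Wiener norm is visibly submultiplicative; the Fejer means show that it is implied by
    the bound on the coefficients when [f] is periodic and C^1. *)
Definition wiener_approx (f : R -> C) (B : R) : Prop :=
  forall eta, 0 < eta -> exists p, trig_weight p <= B /\ forall x, Cmod (f x - trig_eval p x) <= eta.

Lemma wiener_le_trig_eval p : wiener_le (trig_eval p) (trig_weight p).
Proof.
intros l Hl.
rewrite (Rsum_ext _ (fun k => Cmod (Csum (fun cn => fst cn * RtoC (delta (snd cn) k))%C p)))
  by (intros; rewrite fourier_trig_eval; reflexivity).
induction p as [|[c n] p IH]; simpl.
- rewrite (Rsum_ext _ (fun _ => 0)) by (intros; apply Cmod_0).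
  rewrite Rsum_const; unfold trig_weight; simpl; lra.
- apply Rle_trans with (Rsum (fun k => Cmod c * delta n k +
    Cmod (Csum (fun cn => fst cn * RtoC (delta (snd cn) k))%C p)) l).
  + apply Rsum_le; intros k _; eapply Rle_trans; [apply Cmod_triangle|].
    apply Rplus_le_compat_r; rewrite Cmod_mult, Cmod_R, Rabs_pos_eq; [lra|].
    unfold delta; destruct Z.eq_dec; lra.
  + rewrite Rsum_plus, Rsum_scal; unfold trig_weight; simpl; fold (trig_weight p).
    pose proof (Rsum_delta n l Hl); pose proof (Cmod_ge_0 c); nra.
Qed.

(** Every coefficient of [f] differs from that of the approximant by at most the uniform error. The
    error is chosen after the finite list of frequencies, small compared with its length. *)
Lemma wiener_approx_wiener_le f B : ccont f -> wiener_approx f B -> wiener_le f B.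
Proof.
intros Hf H l Hl; apply le_epsilon; intros e He.
assert (Hn : 0 < INR (length l) + 1) by (pose proof (pos_INR (length l)); lra).
destruct (H (e / (INR (length l) + 1))) as [p [Hp Hpf]]; [apply Rdiv_lt_0_compat; lra|].
apply Rle_trans with (Rsum (fun k => Cmod (fourier (trig_eval p) k) + e / (INR (length l) + 1)) l).
- apply Rsum_le; intros k _.
  pose proof (fourier_close f (trig_eval p) k _ Hf (ccont_trig_eval p) Hpf) as H1.
  replace (fourier f k) with (fourier (trig_eval p) k + (fourier f k - fourier (trig_eval p) k))%C by ring.
  eapply Rle_trans; [apply Cmod_triangle|]; lra.
- rewrite Rsum_plus, Rsum_const.
  pose proof (wiener_le_trig_eval p l Hl) as HW.
  assert (INR (length l) * (e / (INR (length l) + 1)) <= e).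
  { apply Rmult_le_reg_r with (INR (length l) + 1); [lra|].
    replace (_ * _ * _) with (INR (length l) * e) by (field; lra); nra. }
  lra.
Qed.

Lemma wiener_approx_bound f B : wiener_approx f B -> forall x, Cmod (f x) <= B.
Proof.
intros H x; apply le_epsilon; intros e He.
destruct (H e He) as [p [Hp Hpf]].
replace (f x) with (trig_eval p x + (f x - trig_eval p x))%C by ring.
eapply Rle_trans; [apply Cmod_triangle|].
pose proof (Cmod_trig_eval p x); specialize (Hpf x); lra.
Qed.

Lemma wiener_approx_mult f g A B : wiener_approx f A -> wiener_approx g B -> wiener_approx (fun x => (f x * g x)%C) (A * B).
Proof.
intros Hf Hg e He.
assert (HA : 0 <= A) by (eapply Rle_trans; [apply Cmod_ge_0|apply (wiener_approx_bound f A Hf 0)]).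
assert (HB : 0 <= B) by (eapply Rle_trans; [apply Cmod_ge_0|apply (wiener_approx_bound g B Hg 0)]).
assert (He' : 0 < e / (A + B + 1)) by (apply Rdiv_lt_0_compat; lra).
destruct (Hf _ He') as [p [Hp Hpf]]; destruct (Hg _ He') as [q [Hq Hqg]].
exists (trig_mul p q); split.
- rewrite trig_weight_trig_mul; apply Rmult_le_compat; auto using trig_weight_ge0.
- intro x; rewrite trig_eval_trig_mul.
  replace (_ - _)%C with (f x * (g x - trig_eval q x) + trig_eval q x * (f x - trig_eval p x))%C by ring.
  eapply Rle_trans; [apply Cmod_triangle|]; rewrite !Cmod_mult.
  pose proof (wiener_approx_bound f A Hf x); pose proof (Cmod_trig_eval q x).
  specialize (Hpf x); specialize (Hqg x).
  set (d := e / (A + B + 1)) in *.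
  replace e with (A * d + B * d + d) by (unfold d; field; lra).
  assert (Cmod (f x) * Cmod (g x - trig_eval q x) <= A * d) by (apply Rmult_le_compat; auto using Cmod_ge_0).
  assert (Cmod (trig_eval q x) * Cmod (f x - trig_eval p x) <= B * d) by (apply Rmult_le_compat; auto using Cmod_ge_0; lra).
  lra.
Qed.

Lemma wiener_approx_conj f B : wiener_approx f B -> wiener_approx (fun x => Cconj (f x)) B.
Proof.
intros H e He; destruct (H e He) as [p [Hp Hpf]]; exists (trig_conj p); split.
- rewrite trig_weight_trig_conj; exact Hp.
- intro x; rewrite trig_eval_trig_conj.
  replace (_ - _)%C with (Cconj (f x - trig_eval p x)) by (apply injective_projections; simpl; ring).
  rewrite Cmod_conj; apply Hpf.
Qed.

(** The Fejer kernel as the K^2 terms of |1 + ... + e^(i(K-1)y)|^2 / K, instead of K - |n| over K at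
    each frequency n. Positivity is then immediate, and for fixed [i] the frequencies i - j are
    distinct, which is what bounds the weight of a Fejer mean. *)
Definition fejer (K : nat) : list (C * Z) :=
  flat_map (fun i => map (fun j => (RtoC (/ INR K), (Z.of_nat i - Z.of_nat j)%Z)) (seq 0 K)) (seq 0 K).

Definition geo (K : nat) (y : R) : C := Csum (fun j => expi (Z.of_nat j) y) (seq 0 K).

Lemma trig_eval_fejer K y : trig_eval (fejer K) y = RtoC (/ INR K * Cmod (geo K y) ^ 2).
Proof.
unfold trig_eval, fejer; rewrite Csum_flat_map, RtoC_mult, Cmod2_conj; unfold geo.
rewrite <- Csum_conj.
set (G := Csum (fun j => Cconj (expi (Z.of_nat j) y)) (seq 0 K)).
rewrite (Csum_ext _ (fun i => (RtoC (/ INR K) * G) * expi (Z.of_nat i) y)%C).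
- rewrite Csum_mult_l; ring.
- intros i _; rewrite Csum_map; simpl; unfold G.
  rewrite (Csum_ext _ (fun j => (RtoC (/ INR K) * expi (Z.of_nat i) y) * Cconj (expi (Z.of_nat j) y))%C).
  + rewrite Csum_mult_l; ring.
  + intros j _; unfold Z.sub; rewrite expi_plus, expi_opp; ring.
Qed.

(** Kept free of division, so that multiples of 2 pi are no exception. *)
Lemma geo_sum K y : (geo K y * (expi 1 y - 1) = expi (Z.of_nat K) y - 1)%C.
Proof.
induction K as [|K IH].
- unfold geo; simpl; rewrite expi_0; ring.
- unfold geo; rewrite seq_S, Csum_app; fold (geo K y).
  rewrite Nat2Z.inj_succ; unfold Z.succ; rewrite expi_plus; simpl.
  rewrite Cplus_0_r, Cmult_plus_distr_r, IH; ring.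
Qed.

(** The kernel equals |e^(iKy) - 1|^2 / (K |e^(iy) - 1|^2) off the zeros of the denominator, and the
    numerator is at most 2^2. *)
Lemma fejer_decay K y : (0 < K)%nat ->
  / INR K * Cmod (geo K y) ^ 2 * Cmod (expi 1 y - 1) ^ 2 <= 4 / INR K.
Proof.
intro HK; apply lt_0_INR in HK.
rewrite Rmult_assoc, <- Rpow_mult_distr, <- Cmod_mult, geo_sum.
rewrite Rmult_comm; apply Rmult_le_compat_r; [left; apply Rinv_0_lt_compat, HK|].
replace 4 with (2 ^ 2) by ring; apply pow_incr; split; [apply Cmod_ge_0|].
eapply Rle_trans; [apply Cmod_triangle|].
rewrite Cmod_opp, Cmod_expi, Cmod_1; lra.
Qed.

Definition convolve (f : R -> C) (p : list (C * Z)) : list (C * Z) :=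
  map (fun cn => (fst cn * fourier f (snd cn), snd cn)%C) p.

Lemma ccont_refl_trig_eval p x : ccont (fun z => trig_eval p (x - z)).
Proof.
induction p as [|a p IH]; [exact (ccont_const (RtoC 0))|].
refine (ccont_plus _ _ (ccont_mult _ _ (ccont_const (fst a)) _) IH).
apply (ccont_ext (fun z => cis (- IZR (snd a) * z + IZR (snd a) * x))); [|apply ccont_cis].
intro z; unfold expi; f_equal; ring.
Qed.

Lemma trig_eval_convolve f p x : ccont f ->
  trig_eval (convolve f p) x = (RtoC (/ (2 * PI)) * CInt (fun z => f z * trig_eval p (x - z)))%C.
Proof.
intro Hf; induction p as [|[c n] p IH].
- unfold trig_eval at 1; simpl.
  rewrite (CInt_ext _ (fun z => RtoC 0 * f z)%C) by (intro; unfold trig_eval; simpl; ring).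
  rewrite CInt_mult by exact Hf; ring.
- change (trig_eval (convolve f ((c, n) :: p)) x) with (c * fourier f n * expi n x + trig_eval (convolve f p) x)%C.
  rewrite IH.
  rewrite (CInt_ext (fun z => f z * trig_eval ((c, n) :: p) (x - z))%C
    (fun z => (c * expi n x) * (f z * expi (- n) z) + f z * trig_eval p (x - z))%C).
  + rewrite CInt_plus, CInt_mult, fourierE; [ring| | |].
    * apply ccont_mult; auto using ccont_expi.
    * apply (ccont_mult _ _ (ccont_const _)), ccont_mult; auto using ccont_expi.
    * apply ccont_mult; auto using ccont_refl_trig_eval.
  + intro z; unfold trig_eval; simpl; rewrite expi_sub, expi_opp; ring.
Qed.

(** The weight is the average over [i] of K sums, each over the K distinct frequencies i - j and
    hence at most [B]. *)
Lemma trig_weight_conv_fejer f B K : (0 < K)%nat -> wiener_le f B -> trig_weight (convolve f (fejer K)) <= B.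
Proof.
intros HK HB; apply lt_0_INR in HK.
unfold trig_weight, convolve; rewrite Rsum_map; unfold fejer; rewrite Rsum_flat_map.
apply Rle_trans with (Rsum (fun _ => / INR K * B) (seq 0 K)).
- apply Rsum_le; intros i _; rewrite Rsum_map; simpl.
  rewrite (Rsum_ext _ (fun j => / INR K * Cmod (fourier f (Z.of_nat i - Z.of_nat j)))).
  + rewrite Rsum_scal; apply Rmult_le_compat_l; [left; apply Rinv_0_lt_compat, HK|].
    rewrite <- (Rsum_map (fun j => (Z.of_nat i - Z.of_nat j)%Z) (fun k => Cmod (fourier f k))).
    apply HB; apply Injective_map_NoDup; [intros a b; lia|apply seq_NoDup].
  + intros j _; rewrite Cmod_mult, Cmod_R, Rabs_pos_eq; [reflexivity|].
    left; apply Rinv_0_lt_compat, HK.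
- rewrite Rsum_const, length_seq; right; field; lra.
Qed.

(** Only the K diagonal terms i = j have frequency 0, each with coefficient 1 / K. This encodes that
    the kernel has mean 1. *)
Lemma convolve_one_fejer K x : (0 < K)%nat -> trig_eval (convolve (fun _ => RtoC 1) (fejer K)) x = RtoC 1.
Proof.
intros HK; apply lt_0_INR in HK.
unfold trig_eval, convolve; rewrite Csum_map; unfold fejer; rewrite Csum_flat_map.
rewrite (Csum_ext _ (fun _ => RtoC (/ INR K))).
- rewrite Csum_const, length_seq, <- RtoC_mult; f_equal; field; lra.
- intros i Hi; rewrite Csum_map; simpl.
  rewrite (Csum_ext _ (fun j => RtoC (/ INR K) * RtoC (delta (Z.of_nat i) (Z.of_nat j)))%C).
  + rewrite Csum_mult_l, <- (Csum_map Z.of_nat (fun k => RtoC (delta (Z.of_nat i) k))).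
    rewrite Csum_delta; [ring| |apply in_map, Hi].
    apply Injective_map_NoDup; [intros a b; lia|apply seq_NoDup].
  + intros j _; rewrite fourier_const; unfold delta.
    destruct Z.eq_dec as [E|E], Z.eq_dec as [F|F]; try lia; [|ring].
    rewrite E, expi_0; ring.
Qed.

(** Fejer's theorem with an explicit rate. The kernel has mean 1, so [eta] averages to itself, and
    |e^(i(x-z)) - 1|^2 times the kernel is at most 4 / K pointwise by [fejer_decay]. With this form
    of the modulus the integral is never split into a near and a far part. *)
Lemma wiener_approx_of_modulus f B : ccont f ->
  (forall eta, 0 < eta -> exists B0, 0 <= B0 /\
    forall x z, Cmod (f z - f x) <= eta + B0 * Cmod (expi 1 (x - z) - 1) ^ 2) ->
  wiener_le f B -> wiener_approx f B.
Proof.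
intros Hf Hm HB e He.
destruct (Hm (e / 2)) as [B0 [HC0 Hm']]; [lra|].
(* K exceeds 8 B0 / e, which makes the far contribution 4 B0 / K at most e / 2. *)
destruct (nfloor_ex (8 * B0 / e)) as [k Hk].
{ apply Rmult_le_pos; [lra|left; apply Rinv_0_lt_compat, He]. }
set (K := S k).
assert (HK : (0 < K)%nat) by (unfold K; lia).
assert (HKr := lt_0_INR _ HK).
assert (HK2 : 4 * B0 / INR K <= e / 2).
{ apply Rmult_le_reg_r with (INR K); [exact HKr|].
  replace (4 * B0 / INR K * INR K) with (e / 2 * (8 * B0 / e)) by (field; lra).
  apply Rmult_le_compat_l; [lra|]; unfold K; rewrite S_INR; lra. }
exists (convolve f (fejer K)); split; [apply trig_weight_conv_fejer; assumption|intro x].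
set (g := fun z => / INR K * Cmod (geo K (x - z)) ^ 2).
(* The integral of the kernel is read off from its convolution with the constant 1. *)
assert (Hg : is_RInt g 0 (2 * PI) (2 * PI)).
{ assert (H1 : CInt (fun z => RtoC 1 * trig_eval (fejer K) (x - z))%C = RtoC (2 * PI)).
  { pose proof (trig_eval_convolve (fun _ => RtoC 1) (fejer K) x (ccont_const 1)) as H.
    rewrite convolve_one_fejer in H by exact HK.
    set (c := CInt _) in *; pose proof twoPI_pos.
    transitivity (RtoC (2 * PI) * (RtoC (/ (2 * PI)) * c))%C; [|rewrite <- H; ring].
    rewrite Cmult_assoc, <- RtoC_mult, Rinv_r; [ring|lra]. }
  assert (H2 : ccont (fun z => RtoC 1 * trig_eval (fejer K) (x - z))%C)
    by (apply (ccont_mult _ _ (ccont_const 1)), ccont_refl_trig_eval).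
  pose proof (is_RInt_fst _ _ _ _ (CInt_correct _ H2)) as H3.
  rewrite H1 in H3; simpl in H3.
  apply (is_RInt_ext (V := R_NormedModule)) with (2 := H3).
  intros z _; pose proof (trig_eval_fejer K (x - z)) as E; unfold g.
  change (fst (RtoC 1 * trig_eval (fejer K) (x - z))%C = / INR K * Cmod (geo K (x - z)) ^ 2).
  rewrite E; simpl; ring. }
assert (Hc : ccont (fun z => (f z - f x) * trig_eval (fejer K) (x - z))%C).
{ apply ccont_mult; [apply ccont_minus; auto using ccont_const|apply ccont_refl_trig_eval]. }
(* Mean 1 lets [f x] be pulled under the integral, so that the error becomes an average of
   [f z - f x]. *)
assert (HE : (f x - trig_eval (convolve f (fejer K)) x
  = - (RtoC (/ (2 * PI)) * CInt (fun z => (f z - f x) * trig_eval (fejer K) (x - z))))%C).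
{ rewrite (CInt_ext (fun z => (f z - f x) * _)%C
    (fun z => f z * trig_eval (fejer K) (x - z) + (- f x) * (RtoC 1 * trig_eval (fejer K) (x - z)))%C)
    by (intro; ring).
  rewrite CInt_plus, (CInt_mult (- f x)%C).
  - transitivity (f x * trig_eval (convolve (fun _ => RtoC 1) (fejer K)) x - trig_eval (convolve f (fejer K)) x)%C.
    + rewrite convolve_one_fejer by exact HK; ring.
    + rewrite !trig_eval_convolve by (exact Hf || apply ccont_const); ring.
  - apply (ccont_mult _ _ (ccont_const 1)), ccont_refl_trig_eval.
  - apply ccont_mult; [exact Hf|apply ccont_refl_trig_eval].
  - apply (ccont_mult _ _ (ccont_const _)), (ccont_mult _ _ (ccont_const 1)), ccont_refl_trig_eval. }
rewrite HE, Cmod_opp, Cmod_mult, Cmod_R.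
pose proof twoPI_pos as HP.
rewrite Rabs_pos_eq by (left; apply Rinv_0_lt_compat; exact HP).
apply Rmult_le_reg_l with (2 * PI); [exact HP|].
rewrite <- Rmult_assoc, Rinv_r, Rmult_1_l by lra.
apply Rle_trans with (e / 2 * (2 * PI) + 2 * PI * (B0 * (4 / INR K))).
2:{ replace (B0 * (4 / INR K)) with (4 * B0 / INR K) by (field; lra); nra. }
apply (CInt_le _ (fun z => e / 2 * g z + B0 * (4 / INR K))).
- exact Hc.
- intro z; rewrite Cmod_mult, trig_eval_fejer, Cmod_R; fold (g z).
  assert (Hg0 : 0 <= g z).
  { unfold g; apply Rmult_le_pos; [left; apply Rinv_0_lt_compat, HKr|apply pow2_ge_0]. }
  rewrite Rabs_pos_eq by exact Hg0.
  pose proof (fejer_decay K (x - z) HK) as HD; fold (g z) in HD.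
  specialize (Hm' x z).
  apply Rle_trans with ((e / 2 + B0 * Cmod (expi 1 (x - z) - 1) ^ 2) * g z).
  + apply Rmult_le_compat_r; assumption.
  + rewrite Rmult_plus_distr_r; apply Rplus_le_compat_l.
    rewrite Rmult_assoc; apply Rmult_le_compat_l; [exact HC0|lra].
- apply (is_RInt_plus (V := R_NormedModule)).
  + apply (is_RInt_scal (V := R_NormedModule)), Hg.
  + apply is_RInt_const_2PI.
Qed.

(** * From a Lipschitz bound to a modulus in |e^(iy) - 1| *)

Lemma periodic_dist y : exists n : Z, Rabs (y + IZR n * (2 * PI)) <= PI.
Proof.
pose proof PI_RGT_0 as HP.
destruct (archimed ((y - PI) / (2 * PI))) as [H1 H2].
set (m := up ((y - PI) / (2 * PI))) in *.
exists (- m)%Z; rewrite opp_IZR.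
assert (E : y - PI = (y - PI) / (2 * PI) * (2 * PI)) by (field; lra).
apply Rabs_le; set (q := (y - PI) / (2 * PI)) in *; split; nra.
Qed.

(** Here |e^(iy) - 1| = 2 |sin(y/2)|, and sin b >= b / 3 on [0,2] follows from the Taylor lower
    bound of degree 7; b = |y| / 2 is below 2 because pi <= 4. *)
Lemma expi1_dist y : Rabs y <= PI -> y ^ 2 / 9 <= Cmod (expi 1 y - 1) ^ 2.
Proof.
intro Hy.
assert (E : Cmod (expi 1 y - 1) ^ 2 = 4 * sin (Rabs y / 2) ^ 2).
{ unfold Cmod; rewrite pow2_sqrt; simpl.
  - rewrite Rmult_1_l.
    pose proof (sin2_cos2 y) as H; unfold Rsqr in H.
    assert (H2 : cos y = cos (Rabs y)) by (unfold Rabs; destruct Rcase_abs; rewrite ?cos_neg; reflexivity).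
    assert (H3 : cos (Rabs y) = 1 - 2 * sin (Rabs y / 2) * sin (Rabs y / 2)).
    { rewrite <- cos_2a_sin; f_equal; field. }
    rewrite H3 in H2.
    replace ((cos y + - (1)) * ((cos y + - (1)) * 1) + (sin y + - 0) * ((sin y + - 0) * 1))
      with ((sin y * sin y + cos y * cos y) + 1 - 2 * cos y) by ring.
    rewrite H, H2; ring.
  - pose proof (pow2_ge_0 (cos (1 * y) + - (1))); pose proof (pow2_ge_0 (sin (1 * y) + - 0)); simpl in *; lra. }
rewrite E, <- pow2_abs; set (a := Rabs y) in *.
assert (Ha : 0 <= a) by apply Rabs_pos.
pose proof PI_RGT_0; pose proof PI_4.
assert (Hs : a / 6 <= sin (a / 2)).
{ assert (H1 : sin_lb (a / 2) <= sin (a / 2)) by (apply SIN; lra).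
  eapply Rle_trans; [|exact H1].
  unfold sin_lb, sin_approx, sin_term; simpl; set (b := a / 2).
  assert (Hb : 0 <= b <= 2) by (unfold b; lra).
  replace (a / 6) with (b / 3) by (unfold b; field).
  apply Rminus_le_0.
  match goal with |- 0 <= ?e => replace e with
    (b * ((4 - b ^ 2) / 6 + b ^ 4 * (42 - b ^ 2) / 5040)) by field end.
  apply Rmult_le_pos; [lra|].
  assert (0 <= b ^ 4 * (42 - b ^ 2)) by (apply Rmult_le_pos; nra).
  nra. }
nra.
Qed.

Lemma Rabs_le_Cmod_parts (c : C) (B : R) : Rabs (fst c) <= B -> Rabs (snd c) <= B -> Cmod c <= 2 * B.
Proof.
intros H1 H2; pose proof (Rabs_pos (fst c)).
unfold Cmod; rewrite <- (sqrt_pow2 (2 * B)) by lra; apply sqrt_le_1_alt.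
rewrite <- (pow2_abs (fst c)), <- (pow2_abs (snd c)).
pose proof (Rabs_pos (snd c)); nra.
Qed.

Lemma Rabs_fst_le (c : C) : Rabs (fst c) <= Cmod c.
Proof. eapply Rle_trans; [apply Rmax_l|apply Rmax_Cmod]. Qed.

Lemma Rabs_snd_le (c : C) : Rabs (snd c) <= Cmod c.
Proof. eapply Rle_trans; [apply Rmax_r|apply Rmax_Cmod]. Qed.

(** The mean value theorem is applied to the real and imaginary parts separately, which costs a
    factor 2 over the maximum of |df|. *)
Lemma lipschitz_on_interval f df a b : a <= b ->
  (forall x, is_derive (V := C_R_NormedModule) f x (df x)) -> ccont df ->
  exists L, 0 <= L /\ forall x z, a <= x <= b -> a <= z <= b -> Cmod (f z - f x) <= L * Rabs (z - x).
Proof.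
intros Hab Hd Hc.
destruct (continuity_ab_maj (fun x => Cmod (df x)) a b Hab) as [m [Hm _]].
{ intros x _; apply continuity_pt_filterlim, continuous_Cmod, Hc. }
set (L := Cmod (df m)) in *.
exists (2 * L); split; [pose proof (Cmod_ge_0 (df m)); unfold L; lra|].
intros x z Hx Hz.
assert (Hr : forall c, Rmin x z <= c <= Rmax x z -> Cmod (df c) <= L).
{ intros c [H1 H2]; apply Hm; split.
  - eapply Rle_trans; [|exact H1]; apply Rmin_glb; lra.
  - eapply Rle_trans; [exact H2|]; apply Rmax_lub; lra. }
rewrite Rmult_assoc; apply Rabs_le_Cmod_parts; simpl.
- destruct (MVT_gen (fun y => fst (f y)) x z (fun y => fst (df y))) as [c [Hcc E]].
  + intros y _; apply is_derive_C_fst, Hd.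
  + intros y _; apply continuity_pt_filterlim.
    apply (ex_derive_continuous (V := R_NormedModule)); exists (fst (df y)); apply is_derive_C_fst, Hd.
  + change (Rabs (fst (f z) - fst (f x)) <= L * Rabs (z - x)).
    rewrite E, Rabs_mult; apply Rmult_le_compat_r; [apply Rabs_pos|].
    eapply Rle_trans; [apply Rabs_fst_le|apply Hr, Hcc].
- destruct (MVT_gen (fun y => snd (f y)) x z (fun y => snd (df y))) as [c [Hcc E]].
  + intros y _; apply is_derive_C_snd, Hd.
  + intros y _; apply continuity_pt_filterlim.
    apply (ex_derive_continuous (V := R_NormedModule)); exists (snd (df y)); apply is_derive_C_snd, Hd.
  + change (Rabs (snd (f z) - snd (f x)) <= L * Rabs (z - x)).
    rewrite E, Rabs_mult; apply Rmult_le_compat_r; [apply Rabs_pos|].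
    eapply Rle_trans; [apply Rabs_snd_le|apply Hr, Hcc].
Qed.

Lemma wiener_le_wiener_approx f df B : periodic f ->
  (forall x, is_derive (V := C_R_NormedModule) f x (df x)) -> ccont df -> wiener_le f B -> wiener_approx f B.
Proof.
intros Hp Hd Hc HB.
assert (Hcf : ccont f).
{ intro x; apply (ex_derive_continuous (V := C_R_NormedModule)); exists (df x); apply Hd. }
apply wiener_approx_of_modulus; [exact Hcf| |exact HB].
pose proof PI_RGT_0 as HP.
destruct (lipschitz_on_interval f df (- (2 * PI)) (2 * PI)) as [L [HL HLip]]; [lra|exact Hd|exact Hc|].
(* From L |y| <= eta + L^2 y^2 / eta, by completing the square, and y^2 <= 9 |e^(iy) - 1|^2. *)
intros eta He; exists (L ^ 2 * 9 / eta); split.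
{ apply Rmult_le_pos; [nra|left; apply Rinv_0_lt_compat, He]. }
intros x z.
(* Both the point and the displacement are reduced to [-pi, pi], so the two points compared lie in
   [-2 pi, 2 pi], where the Lipschitz constant was taken. *)
destruct (periodic_dist x) as [n Hn]; destruct (periodic_dist (x - z)) as [m Hm].
set (x' := x + IZR n * (2 * PI)) in *; set (y := x - z + IZR m * (2 * PI)) in *.
replace (f x) with (f x') by (apply periodic_Z, Hp).
replace (f z) with (f (x' - y)).
2:{ replace (x' - y) with (z + IZR (n - m) * (2 * PI)) by (unfold x', y; rewrite minus_IZR; ring).
    apply periodic_Z, Hp. }
replace (expi 1 (x - z)) with (expi 1 y) by apply expi_periodic.
apply Rabs_le_between in Hn.
pose proof (expi1_dist y Hm) as HD.
assert (Hm' := Hm); apply Rabs_le_between in Hm'.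
eapply Rle_trans; [apply HLip; lra|].
replace (x' - y - x') with (- y) by ring; rewrite Rabs_Ropp.
apply Rle_trans with (eta + L ^ 2 * 9 / eta * (y ^ 2 / 9)).
- rewrite <- (pow2_abs y); set (a := Rabs y).
  assert (0 <= / eta * (eta - L * a) ^ 2).
  { apply Rmult_le_pos; [left; apply Rinv_0_lt_compat, He|apply pow2_ge_0]. }
  replace (/ eta * (eta - L * a) ^ 2) with (eta - 2 * (L * a) + L ^ 2 * 9 / eta * (a ^ 2 / 9)) in H
    by (field; lra).
  assert (0 <= L * a) by (apply Rmult_le_pos; [exact HL|apply Rabs_pos]).
  lra.
- apply Rplus_le_compat_l, Rmult_le_compat_l; [|exact HD].
  apply Rmult_le_pos; [nra|left; apply Rinv_0_lt_compat, He].
Qed.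

(** * Fourier coefficients of a smooth solution *)

Lemma continuity_2d_pt_section (f : R -> R -> R) t x : continuity_2d_pt f t x -> continuous (f t) x.
Proof.
intros H; apply (continuity_pt_filterlim (f t) x).
intros e He; destruct (H (mkposreal e He)) as [d Hd]; exists d; split; [apply cond_pos|].
intros y [_ Hy]; apply Hd; [|exact Hy].
rewrite Rminus_diag, Rabs_R0; apply cond_pos.
Qed.

Lemma RInt_continuous_param (f : R -> R -> R) a b : a < b ->
  (forall t x, continuity_2d_pt f t x) ->
  forall t, continuous (fun s => RInt (f s) a b) t.
Proof.
intros Hab Hf t; apply continuity_pt_filterlim.
assert (Hex : forall s, ex_RInt (f s) a b).
{ intro s; apply (ex_RInt_continuous (V := R_CompleteNormedModule)).
  intros x _; apply continuity_2d_pt_section, Hf. }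
intros e He.
assert (He' : 0 < e / (2 * (b - a))) by (apply Rdiv_lt_0_compat; lra).
destruct (uniform_continuity_2d_1d' f a b t (fun x _ => Hf t x) (mkposreal _ He')) as [d Hd].
exists d; split; [apply cond_pos|].
intros s [_ Hs].
simpl in Hd, Hs; unfold Rdist in *.
change (Rabs (RInt (f s) a b - RInt (f t) a b) < e).
change (Rabs (minus (RInt (f s) a b) (RInt (f t) a b)) < e).
rewrite <- (RInt_minus (V := R_CompleteNormedModule)) by apply Hex.
apply Rle_lt_trans with ((b - a) * (e / (2 * (b - a)))).
- apply (norm_RInt_le_const (V := R_NormedModule) (fun x => minus (f s x) (f t x)) a b); [lra| |].
  + intros x Hx; left.
    apply Hd; auto; [| |rewrite Rminus_diag, Rabs_R0; apply cond_pos];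
      pose proof (cond_pos d); apply Rabs_def2 in Hs; lra.
  + apply (RInt_correct (V := R_CompleteNormedModule)), (ex_RInt_minus (V := R_NormedModule)); apply Hex.
- replace ((b - a) * (e / (2 * (b - a)))) with (e / 2) by (field; lra); lra.
Qed.

Definition cont2 (F : R -> R -> C) : Prop := forall t x,
  continuity_2d_pt (fun s y => fst (F s y)) t x /\ continuity_2d_pt (fun s y => snd (F s y)) t x.

Lemma cont2_ccont F t : cont2 F -> ccont (F t).
Proof.
intros HF x; destruct (HF t x).
apply continuous_C_pair.
- apply (continuity_2d_pt_section (fun s y => fst (F s y))); assumption.
- apply (continuity_2d_pt_section (fun s y => snd (F s y))); assumption.
Qed.

Lemma cont2_mult_expi F k : cont2 F -> cont2 (fun t x => (F t x * expi k x)%C).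
Proof.
intros HF t x; destruct (HF t x) as [H1 H2].
assert (Hc : forall f, (forall y, continuous f y) -> continuity_2d_pt (fun _ y => f y) t x).
{ intros f Hf; apply (continuity_1d_2d_pt_comp f (fun _ y => y)).
  - apply continuity_pt_filterlim, Hf.
  - apply continuity_2d_pt_id2. }
assert (K1 := Hc _ (ccont_fst _ (ccont_expi k))); assert (K2 := Hc _ (ccont_snd _ (ccont_expi k))).
split; simpl.
- apply continuity_2d_pt_minus; apply continuity_2d_pt_mult; assumption.
- apply continuity_2d_pt_plus; apply continuity_2d_pt_mult; assumption.
Qed.

Lemma fst_CInt f : ccont f -> fst (CInt f) = RInt (fun x => fst (f x)) 0 (2 * PI).
Proof. intro Hf; symmetry; apply is_RInt_unique, (is_RInt_fst _ _ _ _ (CInt_correct f Hf)). Qed.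

Lemma snd_CInt f : ccont f -> snd (CInt f) = RInt (fun x => snd (f x)) 0 (2 * PI).
Proof. intro Hf; symmetry; apply is_RInt_unique, (is_RInt_snd _ _ _ _ (CInt_correct f Hf)). Qed.

Lemma fst_fourier f k : ccont f ->
  fst (fourier f k) = / (2 * PI) * RInt (fun x => fst (f x * expi (- k) x)%C) 0 (2 * PI).
Proof.
intro Hf; rewrite fourierE, <- fst_CInt by (apply ccont_mult; auto using ccont_expi).
set (z := CInt _); simpl; ring.
Qed.

Lemma snd_fourier f k : ccont f ->
  snd (fourier f k) = / (2 * PI) * RInt (fun x => snd (f x * expi (- k) x)%C) 0 (2 * PI).
Proof.
intro Hf; rewrite fourierE, <- snd_CInt by (apply ccont_mult; auto using ccont_expi).
set (z := CInt _); simpl; ring.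
Qed.

Lemma fourier_continuous_param F k : cont2 F -> ccont (fun t => fourier (F t) k).
Proof.
intros HF t; apply continuous_C_pair.
- apply (continuous_ext (fun s => / (2 * PI) * RInt (fun x => fst (F s x * expi (- k) x)%C) 0 (2 * PI))).
  { intro s; symmetry; apply fst_fourier, cont2_ccont, HF. }
  apply (continuous_scal_r (V := R_NormedModule)).
  apply (RInt_continuous_param (fun s x => fst (F s x * expi (- k) x)%C)); [apply twoPI_pos|].
  intros s x; apply (cont2_mult_expi F (- k) HF).
- apply (continuous_ext (fun s => / (2 * PI) * RInt (fun x => snd (F s x * expi (- k) x)%C) 0 (2 * PI))).
  { intro s; symmetry; apply snd_fourier, cont2_ccont, HF. }
  apply (continuous_scal_r (V := R_NormedModule)).
  apply (RInt_continuous_param (fun s x => snd (F s x * expi (- k) x)%C)); [apply twoPI_pos|].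
  intros s x; apply (cont2_mult_expi F (- k) HF).
Qed.

Lemma locally_interval a b t : a < t < b -> locally t (fun s => a < s < b).
Proof. intro H; apply (open_and (fun s => a < s) (fun s => s < b)); auto using open_gt, open_lt. Qed.

Lemma RInt_derive_param (f df : R -> R -> R) a b c d t : c < t < d ->
  (forall s x, c < s < d -> is_derive (fun r => f r x) s (df s x)) ->
  (forall s x, continuity_2d_pt df s x) ->
  (forall s x, continuous (f s) x) ->
  is_derive (fun s => RInt (f s) a b) t (RInt (df t) a b).
Proof.
intros Ht Hd Hdf Hf.
assert (HL := locally_interval c d t Ht).
replace (RInt (df t) a b) with (RInt (fun x => Derive (fun r => f r x) t) a b).
2:{ apply RInt_ext; intros x _; apply is_derive_unique, Hd, Ht. }
apply (is_derive_RInt_param f).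
- generalize HL; apply filter_imp; intros s Hs x _; exists (df s x); apply Hd, Hs.
- intros x _; apply continuity_2d_pt_ext_loc with df; [|apply Hdf].
  destruct HL as [e He]; exists e; intros s y Hs _.
  symmetry; apply is_derive_unique, Hd, He, Hs.
- apply filter_forall; intro s; apply (ex_RInt_continuous (V := R_CompleteNormedModule)).
  intros x _; apply Hf.
Qed.

Lemma fourier_derive_param (F DF : R -> R -> C) k c d t : c < t < d ->
  (forall s x, c < s < d -> is_derive (V := C_R_NormedModule) (fun r => F r x) s (DF s x)) ->
  cont2 F -> cont2 DF ->
  is_derive (V := C_R_NormedModule) (fun s => fourier (F s) k) t (fourier (DF t) k).
Proof.
intros Ht Hd HF HDF.
assert (Hm : forall s x, c < s < d ->
  is_derive (V := C_R_NormedModule) (fun r => F r x * expi (- k) x)%C s (DF s x * expi (- k) x)%C).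
{ intros s x Hs; rewrite (Cmult_comm (DF s x)).
  apply (is_derive_ext (V := C_R_NormedModule) (fun r => expi (- k) x * F r x)%C); [intro; apply Cmult_comm|].
  apply is_derive_Cmult_l, Hd, Hs. }
apply is_derive_C_pair.
- rewrite fst_fourier by (apply cont2_ccont, HDF).
  apply (is_derive_ext (fun s => / (2 * PI) * RInt (fun x => fst (F s x * expi (- k) x)%C) 0 (2 * PI))).
  { intro s; symmetry; apply fst_fourier, cont2_ccont, HF. }
  apply is_derive_scal.
  apply (RInt_derive_param (fun s x => fst (F s x * expi (- k) x)%C) (fun s x => fst (DF s x * expi (- k) x)%C) _ _ c d);
    [exact Ht| | |].
  + intros s x Hs; apply (is_derive_C_fst _ _ _ (Hm s x Hs)).
  + intros s x; apply (cont2_mult_expi DF (- k) HDF).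
  + intros s x; apply (continuity_2d_pt_section (fun s x => fst (F s x * expi (- k) x)%C)).
    apply (cont2_mult_expi F (- k) HF).
- rewrite snd_fourier by (apply cont2_ccont, HDF).
  apply (is_derive_ext (fun s => / (2 * PI) * RInt (fun x => snd (F s x * expi (- k) x)%C) 0 (2 * PI))).
  { intro s; symmetry; apply snd_fourier, cont2_ccont, HF. }
  apply is_derive_scal.
  apply (RInt_derive_param (fun s x => snd (F s x * expi (- k) x)%C) (fun s x => snd (DF s x * expi (- k) x)%C) _ _ c d);
    [exact Ht| | |].
  + intros s x Hs; apply (is_derive_C_snd _ _ _ (Hm s x Hs)).
  + intros s x; apply (cont2_mult_expi DF (- k) HDF).
  + intros s x; apply (continuity_2d_pt_section (fun s x => snd (F s x * expi (- k) x)%C)).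
    apply (cont2_mult_expi F (- k) HF).
Qed.

(** A bound uniform in [k]: all coefficients at time [t] are dominated by one integral that depends
    continuously on [t] and so attains a maximum. *)
Lemma fourier_bounded_param F a b : a <= b -> cont2 F ->
  exists Q, forall t k, a <= t <= b -> Cmod (fourier (F t) k) <= Q.
Proof.
intros Hab HF.
(* |F|^2 + 1 dominates |F| and is a polynomial in the two parts, so its joint continuity is
   immediate. *)
set (q := fun t x => fst (F t x) * fst (F t x) + snd (F t x) * snd (F t x) + 1).
assert (Hq : forall t x, continuity_2d_pt q t x).
{ intros t x; destruct (HF t x) as [H1 H2].
  apply continuity_2d_pt_plus; [apply continuity_2d_pt_plus; apply continuity_2d_pt_mult; assumption|].
  apply continuity_2d_pt_const. }
assert (Hc := RInt_continuous_param q 0 (2 * PI) twoPI_pos Hq).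
destruct (continuity_ab_maj (fun t => RInt (q t) 0 (2 * PI)) a b Hab) as [m [Hm _]].
{ intros t _; apply continuity_pt_filterlim, Hc. }
exists (/ (2 * PI) * RInt (q m) 0 (2 * PI)); intros t k Ht.
pose proof twoPI_pos as HP.
assert (Hft := cont2_ccont F t HF).
rewrite fourierE, Cmod_mult, Cmod_R, Rabs_pos_eq by (left; apply Rinv_0_lt_compat; exact HP).
apply Rmult_le_compat_l; [left; apply Rinv_0_lt_compat; exact HP|].
eapply Rle_trans; [|apply (Hm t Ht)].
apply (CInt_le _ (q t)).
- apply ccont_mult; [exact Hft|apply ccont_expi].
- intro x; rewrite Cmod_mult, Cmod_expi, Rmult_1_r; unfold q.
  assert (E : Cmod (F t x) ^ 2 = fst (F t x) * fst (F t x) + snd (F t x) * snd (F t x)).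
  { unfold Cmod; rewrite pow2_sqrt; [ring|]; nra. }
  rewrite <- E; nra.
- apply (RInt_correct (V := R_CompleteNormedModule)), (ex_RInt_continuous (V := R_CompleteNormedModule)).
  intros x _; apply continuity_2d_pt_section, Hq.
Qed.

(** * Absolute summability of the coefficients *)

Lemma Rsum_incl (g : Z -> R) l m : (forall k, 0 <= g k) -> NoDup l -> incl l m -> Rsum g l <= Rsum g m.
Proof.
intros Hg Hl; revert m; induction Hl as [|k l Hk Hl IH]; intros m Hm; simpl.
- apply Rsum_ge0; intros; apply Hg.
- assert (Hkm : In k m) by (apply Hm; left; reflexivity).
  destruct (in_split k m Hkm) as [m1 [m2 ->]].
  rewrite Rsum_app; simpl.
  assert (H : Rsum g l <= Rsum g (m1 ++ m2)).
  { apply IH; intros j Hj.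
    assert (Hj' : In j (m1 ++ k :: m2)) by (apply Hm; right; exact Hj).
    apply in_app_iff in Hj'; apply in_app_iff; simpl in Hj'.
    destruct Hj' as [?|[->|?]]; auto; contradiction. }
  rewrite Rsum_app in H; lra.
Qed.

(** 1 / (1 + n^2) <= 6 / (n + 1) - 6 / (n + 2) telescopes to at most 6; the bound 12 counts the two
    half-lines, with frequency 0 in both. *)
Lemma Rsum_inv_sq l : NoDup l -> Rsum (fun k => / (1 + IZR k ^ 2)) l <= 12.
Proof.
intro Hl.
assert (Hg : forall k : Z, 0 <= / (1 + IZR k ^ 2)).
{ intro k; left; apply Rinv_0_lt_compat; pose proof (pow2_ge_0 (IZR k)); lra. }
assert (Hb : exists n : nat, forall k, In k l -> (Z.abs k < Z.of_nat n)%Z).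
{ clear; induction l as [|a l [n Hn]]; [exists 0%nat; intros k []|].
  exists (n + S (Z.to_nat (Z.abs a)))%nat; intros k [->|Hk]; [lia|specialize (Hn k Hk); lia]. }
destruct Hb as [n Hn].
set (m := map Z.of_nat (seq 0 n) ++ map (fun i => (- Z.of_nat i)%Z) (seq 0 n)).
eapply Rle_trans; [apply (Rsum_incl _ l m Hg Hl)|].
- intros k Hk; specialize (Hn k Hk); unfold m; apply in_app_iff.
  destruct (Z_le_gt_dec 0 k); [left|right]; apply in_map_iff; exists (Z.to_nat (Z.abs k));
    (split; [lia|apply in_seq; lia]).
- assert (HS : Rsum (fun i => / (1 + INR i ^ 2)) (seq 0 n) <= 6 - 6 / (INR n + 1)).
  { clear; induction n as [|n IH]; [simpl; lra|].
    rewrite seq_S, Rsum_app; cbn [Rsum fold_right plus].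
    rewrite S_INR.
    assert (Hn := pos_INR n).
    assert (/ (1 + INR n ^ 2) <= 6 / (INR n + 1) - 6 / (INR n + 1 + 1)).
    { replace (6 / (INR n + 1) - 6 / (INR n + 1 + 1)) with (/ ((INR n + 1) * (INR n + 2) / 6)) by (field; lra).
      apply Rinv_le_contravar; nra. }
    simpl Nat.add; lra. }
  assert (0 <= 6 / (INR n + 1)).
  { pose proof (pos_INR n); apply Rmult_le_pos; [lra|left; apply Rinv_0_lt_compat; lra]. }
  unfold m; rewrite Rsum_app, !Rsum_map.
  rewrite (Rsum_ext (fun a => / (1 + IZR (- Z.of_nat a) ^ 2)) (fun i => / (1 + INR i ^ 2))),
    (Rsum_ext (fun a => / (1 + IZR (Z.of_nat a) ^ 2)) (fun i => / (1 + INR i ^ 2))).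
  + lra.
  + intros i _; rewrite <- INR_IZR_INZ; reflexivity.
  + intros i _; rewrite opp_IZR, <- INR_IZR_INZ; f_equal; ring.
Qed.

Lemma wiener_le_of_decay f Q : (forall k, (1 + IZR k ^ 2) * Cmod (fourier f k) <= Q) -> wiener_le f (Q * 12).
Proof.
intros H l Hl.
assert (HQ : 0 <= Q).
{ eapply Rle_trans; [|apply (H 0%Z)]; apply Rmult_le_pos; [simpl; lra|apply Cmod_ge_0]. }
apply Rle_trans with (Q * Rsum (fun k => / (1 + IZR k ^ 2)) l).
- rewrite <- Rsum_scal; apply Rsum_le; intros k _.
  assert (Hk : 0 < 1 + IZR k ^ 2) by (pose proof (pow2_ge_0 (IZR k)); lra).
  apply Rmult_le_reg_l with (1 + IZR k ^ 2); [exact Hk|].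
  replace ((1 + IZR k ^ 2) * (Q * / (1 + IZR k ^ 2))) with Q by (field; lra); apply H.
- apply Rmult_le_compat_l; [exact HQ|apply Rsum_inv_sq, Hl].
Qed.

Definition cubic (f : R -> C) (x : R) : C := (RtoC (Cmod (f x) ^ 2) * f x)%C.

(** The Fourier-side content of [smooth_solution]; [U] is the solution, frozen outside [[0,T]]. *)
Record flow (m : Z -> R) (T : R) (u0 : R -> C) (U : R -> R -> C) : Prop := Flow {
  flow_periodic : forall t, periodic (U t);
  flow_C1 : forall t, exists df, (forall x, is_derive (V := C_R_NormedModule) (U t) x (df x)) /\ ccont df;
  flow_cont : forall k, ccont (fun t => fourier (U t) k);
  flow_init : forall x, U 0 x = u0 x;
  flow_rough : exists B, forall t, wiener_le (U t) B;
  flow_ode : forall k t, 0 < t < T -> is_derive (V := C_R_NormedModule) (fun t => fourier (U t) k) t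
    (Ci * (RtoC (m k) * fourier (U t) k + fourier (cubic (U t)) k))%C
}.

(** Composing with the projection of time onto [0,T] makes all partial derivatives jointly
    continuous on the whole plane, so that integrals with a parameter need no boundary cases. The
    evolution equation is still asserted only for 0 < t < T. *)
Lemma flow_of_solution alpha (T : posreal) u0 u : smooth_solution alpha T u0 u ->
  exists U, flow (frac_symbol alpha) T u0 U /\ forall t x, 0 <= t <= T -> U t x = u t x.
Proof.
intros [[w [Hw0 [Hwc [Hwt Hwx]]]] [Hper [Hinit [ut [Lu Heq]]]]].
pose proof (cond_pos T) as HT.
set (cl := fun t => Rmax 0 (Rmin T t)).
assert (Hcl : forall t, 0 <= cl t <= T) by (intro t; apply clamp_bounds).
assert (Hcl2 : forall t, 0 <= t <= T -> cl t = t).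
{ intros t Ht; unfold cl; rewrite Rmin_right, Rmax_right; tauto. }
assert (Hclc : forall t s, Rabs (cl s - cl t) <= Rabs (s - t)).
{ intros t s; unfold cl, Rmax, Rmin, Rabs; repeat destruct Rle_dec; repeat destruct Rcase_abs; lra. }
set (V := fun i j t x => w i j (cl t) x).
assert (HV : forall i j, cont2 (V i j)).
{ intros i j t x.
  assert (HL : filterlim (fun p : R * R => V i j (fst p) (snd p)) (locally (t, x))
    (locally (V i j t x : C_UniformSpace))).
  { apply (filterlim_comp _ _ _ (fun p : R * R => (cl (fst p), snd p))
      (fun p : R * R => w i j (fst p) (snd p)) _
      (within (fun p : R * R => 0 <= fst p <= T) (locally (cl t, x)))).
    - intros P [e He]; exists e; intros [s y] [H1 H2]; apply He; [|apply Hcl].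
      split; [|exact H2].
      eapply Rle_lt_trans; [apply Hclc|exact H1].
    - apply (Hwc i j (cl t, x)); apply Hcl. }
  split; apply continuity_2d_pt_filterlim.
  - apply (filterlim_comp _ _ _ _ fst _ _ _ HL), continuous_fst.
  - apply (filterlim_comp _ _ _ _ snd _ _ _ HL), continuous_snd. }
assert (HVx : forall i j t x, is_derive (V := C_R_NormedModule) (V i j t) x (V i (S j) t x)).
{ intros i j t x; apply (Hwx i j (cl t) x (Hcl t)). }
assert (HVt : forall i j t x, 0 < t < T ->
  is_derive (V := C_R_NormedModule) (fun s => V i j s x) t (V (S i) j t x)).
{ intros i j t x Ht; unfold V; rewrite (Hcl2 t) by lra.
  apply (is_derive_ext_loc (V := C_R_NormedModule) (fun s => w i j s x)); [|apply Hwt, Ht].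
  generalize (locally_interval _ _ t Ht); apply filter_imp; intros s Hs; rewrite Hcl2 by lra; reflexivity. }
assert (HVu : forall t x, 0 <= t <= T -> V 0%nat 0%nat t x = u t x).
{ intros t x Ht; unfold V; rewrite (Hcl2 t Ht); apply Hw0, Ht. }
assert (HVper : forall t, periodic (V 0%nat 0%nat t)).
{ intros t x; unfold V; rewrite !Hw0 by apply Hcl; apply Hper, Hcl. }
(* Periodicity of the first derivative is what allows the second integration by parts below. *)
assert (HVxper : forall j t, periodic (V 0%nat j t)).
{ intros j; induction j as [|j IH]; [exact HVper|].
  intros t x.
  assert (H1 := HVx 0%nat j t (x + 2 * PI)).
  assert (H2 : is_derive (V := C_R_NormedModule) (V 0%nat j t) x (V 0%nat (S j) t (x + 2 * PI))).
  { apply (is_derive_ext (V := C_R_NormedModule) (fun y => V 0%nat j t (y + 2 * PI))); [intro y; apply IH|].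
    evar_last.
    - apply (is_derive_comp (V := C_R_NormedModule) (V 0%nat j t) (fun y => y + 2 * PI)); [exact H1|].
      auto_derive; [exact I|reflexivity].
    - apply (scal_one (V := C_R_NormedModule)). }
  pose proof (HVx 0%nat j t x) as H3.
  apply injective_projections.
  - apply is_derive_C_fst in H2; apply is_derive_C_fst in H3.
    apply is_derive_unique in H2; apply is_derive_unique in H3; congruence.
  - apply is_derive_C_snd in H2; apply is_derive_C_snd in H3.
    apply is_derive_unique in H2; apply is_derive_unique in H3; congruence. }
exists (V 0%nat 0%nat); split; [|exact HVu].
split.
- exact HVper.
- intro t; exists (V 0%nat 1%nat t); split; [apply HVx|apply cont2_ccont, HV].
- intro k; apply fourier_continuous_param, HV.
- intro x; rewrite HVu by lra; apply Hinit.
(* The coefficients of u_xx are -k^2 times those of u, so bounds for both give (1 + k^2) |c_k| <= Q0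
   + Q2 uniformly in time. *)
- destruct (fourier_bounded_param (V 0%nat 0%nat) 0 T (Rlt_le _ _ HT) (HV _ _)) as [Q0 HQ0].
  destruct (fourier_bounded_param (V 0%nat 2%nat) 0 T (Rlt_le _ _ HT) (HV _ _)) as [Q2 HQ2].
  exists ((Q0 + Q2) * 12); intro t; apply wiener_le_of_decay; intro k.
  specialize (HQ0 (cl t) k (Hcl t)); specialize (HQ2 (cl t) k (Hcl t)).
  assert (E : forall i j, V i j (cl t) = V i j t) by (intros; unfold V; rewrite (Hcl2 (cl t)) by apply Hcl; reflexivity).
  rewrite E in HQ0, HQ2.
  rewrite (fourier_deriv (V 0%nat 1%nat t)), (fourier_deriv (V 0%nat 0%nat t)) in HQ2
    by (apply HVxper || apply HVx || apply cont2_ccont, HV).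
  rewrite !Cmod_mult, Cmod_R in HQ2.
  assert (HCi : Cmod Ci = 1) by (unfold Cmod, Ci; simpl; replace (_ + _) with 1 by ring; apply sqrt_1).
  rewrite HCi, !Rmult_1_r in HQ2.
  replace ((1 + IZR k ^ 2) * Cmod (fourier (V 0%nat 0%nat t) k)) with (Cmod (fourier (V 0%nat 0%nat t) k) +
    Rabs (IZR k) * (Rabs (IZR k) * Cmod (fourier (V 0%nat 0%nat t) k))); [lra|].
  rewrite <- (pow2_abs (IZR k)); ring.
- intros k t Ht.
  destruct (Heq t Ht) as [[_ [HLc HLf]] Hpt].
  (* By uniqueness of derivatives, [ut] is the jointly continuous derivative of the slab; only for
     the latter can one differentiate under the integral. *)
  assert (Hut : forall x, ut t x = V 1%nat 0%nat t x).
  { intro x; destruct (Hpt x) as [H1 _].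
    assert (H2 : is_derive (V := C_R_NormedModule) (fun s => u s x) t (V 1%nat 0%nat t x)).
    { apply (is_derive_ext_loc (V := C_R_NormedModule) (fun s => V 0%nat 0%nat s x)); [|apply HVt, Ht].
      generalize (locally_interval _ _ t Ht); apply filter_imp; intros s Hs; apply HVu; lra. }
    apply injective_projections.
    - apply is_derive_C_fst in H1; apply is_derive_C_fst in H2.
      apply is_derive_unique in H1; apply is_derive_unique in H2; congruence.
    - apply is_derive_C_snd in H1; apply is_derive_C_snd in H2.
      apply is_derive_unique in H1; apply is_derive_unique in H2; congruence. }
  assert (Hcu : ccont (V 0%nat 0%nat t)) by apply cont2_ccont, HV.
  assert (Hcub : ccont (cubic (V 0%nat 0%nat t))).
  { apply ccont_mult; [apply ccont_RtoC|exact Hcu].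
    intro x; simpl; apply (continuous_mult (K := R_AbsRing)); [|apply (continuous_mult (K := R_AbsRing))];
      try apply continuous_Cmod, Hcu; apply continuous_const. }
  evar_last.
  { apply (fourier_derive_param (V 0%nat 0%nat) (V 1%nat 0%nat) k 0 T t Ht).
    - intros s x Hs; apply HVt, Hs.
    - apply HV.
    - apply HV. }
  specialize (HLf k).
  rewrite (fourier_ext (u t) (V 0%nat 0%nat t)) in HLf by (intro x; rewrite HVu; [reflexivity|lra]).
  rewrite <- HLf.
  assert (HcL : ccont (Lu t)) by exact HLc.
  rewrite <- fourier_plus, <- fourier_mult by (assumption || apply ccont_plus; assumption).
  apply fourier_ext; intro x.
  destruct (Hpt x) as [_ H2]; rewrite Hut in H2.
  unfold cubic; rewrite HVu by lra.
  transitivity (- Ci * (Ci * V 1%nat 0%nat t x))%C.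
  { transitivity (- (Ci * Ci) * V 1%nat 0%nat t x)%C; [|ring].
    replace (Ci * Ci)%C with (RtoC (- 1)); [apply injective_projections; simpl; ring|].
    apply injective_projections; simpl; ring. }
  replace (Ci * V 1%nat 0%nat t x)%C with (- (RtoC (Cmod (u t x) ^ 2) * u t x) - Lu t x)%C; [ring|].
  rewrite <- H2; ring.
Qed.

(** * A priori bounds and the third-order expansion of the flow *)

Lemma cubicE f x : cubic f x = (f x * Cconj (f x) * f x)%C.
Proof. unfold cubic; rewrite Cmod2_conj; reflexivity. Qed.

Lemma ccont_cubic f : ccont f -> ccont (cubic f).
Proof.
intro Hf; apply (ccont_ext (fun x => f x * Cconj (f x) * f x)%C); [intro; symmetry; apply cubicE|].
apply ccont_mult; [apply ccont_mult; [|apply ccont_conj]|]; exact Hf.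
Qed.

Lemma wiener_approx_ext f g B : (forall x, f x = g x) -> wiener_approx f B -> wiener_approx g B.
Proof.
intros H Hf e He; destruct (Hf e He) as [p [Hp Hpf]]; exists p; split; [exact Hp|].
intro x; rewrite <- H; apply Hpf.
Qed.

Lemma wiener_approx_cubic f A : wiener_approx f A -> wiener_approx (cubic f) (A ^ 3).
Proof.
intro H; apply (wiener_approx_ext (fun x => f x * Cconj (f x) * f x)%C); [intro; symmetry; apply cubicE|].
replace (A ^ 3) with (A * A * A) by ring.
apply wiener_approx_mult; [apply wiener_approx_mult; [|apply wiener_approx_conj]|]; exact H.
Qed.

(** The asymmetric bounds fit the use: [f] is the solution, known up to 2 A, and [g] the free
    evolution, known up to A. The three terms of the difference give 7 = 4 + 2 + 1. *)
Lemma Cmod_cubic_diff f g A d x : Cmod (f x) <= 2 * A -> Cmod (g x) <= A -> Cmod (f x - g x) <= d ->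
  Cmod (cubic f x - cubic g x) <= 7 * A ^ 2 * d.
Proof.
rewrite !cubicE; generalize (f x) (g x); intros z w Hz Hw Hd.
replace (z * Cconj z * z - w * Cconj w * w)%C
  with ((z - w) * (Cconj z * z) + (Cconj (z - w) * z * w) + (z - w) * (Cconj w * w))%C
  by (apply injective_projections; simpl; ring).
pose proof (Cmod_ge_0 z); pose proof (Cmod_ge_0 w); pose proof (Cmod_ge_0 (z - w)).
eapply Rle_trans; [apply Cmod_triangle|].
eapply Rle_trans; [apply Rplus_le_compat_r, Cmod_triangle|].
rewrite !Cmod_mult, !Cmod_conj.
replace (7 * A ^ 2 * d) with (d * ((2 * A) * (2 * A)) + d * (2 * A) * A + d * (A * A)) by ring.
repeat apply Rplus_le_compat; repeat apply Rmult_le_compat; auto; repeat apply Rmult_le_pos; auto.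
Qed.

(** Rotations of this kind turn a sum of moduli into the real part of a fixed linear combination,
    which can be differentiated. *)
Lemma unit_phase (z : C) : exists th, Cmod th = 1 /\ fst (th * z)%C = Cmod z.
Proof.
destruct (Ceq_dec z 0) as [->|Hz].
- exists (RtoC 1); rewrite Cmod_1, Cmod_0; split; [reflexivity|simpl; ring].
- assert (H := proj1 (Cmod_gt_0 z) Hz).
  exists (RtoC (/ Cmod z) * Cconj z)%C; split.
  + rewrite Cmod_mult, Cmod_conj, Cmod_R, Rabs_pos_eq by (left; apply Rinv_0_lt_compat, H); field; lra.
  + replace (RtoC (/ Cmod z) * Cconj z * z)%C with (RtoC (/ Cmod z) * (z * Cconj z))%C by ring.
    rewrite <- Cmod2_conj, <- RtoC_mult; simpl; field; lra.
Qed.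

Section Flow.
Context (m : Z -> R) (T : posreal) (u0 : R -> C) (U : R -> R -> C) (HU : flow m T u0 U).

(** The interaction picture: the free rotation exp(i m_k t) is undone, so only the nonlinear term
    drives this quantity. The summand 0 matches the affine phase of [is_derive_cis]. *)
Definition interaction (k : Z) (t : R) : C := (cis (- m k * t + 0) * fourier (U t) k)%C.

Lemma flow_ccont t : ccont (U t).
Proof.
destruct (flow_C1 _ _ _ _ HU t) as [df [Hd _]]; intro x.
apply (ex_derive_continuous (V := C_R_NormedModule)); exists (df x); apply Hd.
Qed.

Lemma Cmod_interaction k t : Cmod (interaction k t) = Cmod (fourier (U t) k).
Proof. unfold interaction; rewrite Cmod_mult, Cmod_cis, Rmult_1_l; reflexivity. Qed.

Lemma interaction_0 k : interaction k 0 = fourier u0 k.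
Proof.
unfold interaction; rewrite Rmult_0_r, Rplus_0_r, cis_0, Cmult_1_l.
apply fourier_ext, (flow_init _ _ _ _ HU).
Qed.

Lemma interaction_ccont k : ccont (interaction k).
Proof. apply ccont_mult; [apply ccont_cis|apply (flow_cont _ _ _ _ HU)]. Qed.

Lemma interaction_derive k t : 0 < t < T -> is_derive (V := C_R_NormedModule) (interaction k) t
  (Ci * cis (- m k * t + 0) * fourier (cubic (U t)) k)%C.
Proof.
intro Ht; evar_last.
- apply is_derive_Cmult; [apply is_derive_cis|apply (flow_ode _ _ _ _ HU k t Ht)].
- rewrite RtoC_opp; simpl.
  match goal with |- ?a = ?b => change (@eq C a b) end; ring.
Qed.

(** A mean value inequality in l^1, standing for Duhamel's formula. Phases fixed at the two
    endpoints make the sum of moduli an increment of the real function [h], whose derivative is at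
    most the l^1 norm of the cubic term. *)
Lemma interaction_variation G t0 t1 l : 0 <= t0 <= t1 -> t1 <= T -> NoDup l ->
  (forall t, t0 <= t <= t1 -> wiener_le (cubic (U t)) G) ->
  Rsum (fun k => Cmod (interaction k t1 - interaction k t0)) l <= G * (t1 - t0).
Proof.
intros Ht0 Ht1 Hl HG.
assert (Hth : forall l' : list Z, exists th : Z -> C, forall k,
  Cmod (th k) = 1 /\ (In k l' -> fst (th k * (interaction k t1 - interaction k t0))%C
    = Cmod (interaction k t1 - interaction k t0))).
{ induction l' as [|a l' [th IH]].
  - exists (fun _ => RtoC 1); intro k; split; [apply Cmod_1|intros []].
  - destruct (unit_phase (interaction a t1 - interaction a t0)%C) as [z [Hz1 Hz2]].
    exists (fun k => if Z.eq_dec k a then z else th k); intro k; destruct (IH k) as [IH1 IH2].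
    destruct Z.eq_dec as [->|E]; [auto|split; [exact IH1|]].
    intros [F|F]; [congruence|auto]. }
destruct (Hth l) as [th Hth']; clear Hth.
set (h := fun t => Rsum (fun k => fst (th k * interaction k t)%C) l).
set (dh := fun t => Rsum (fun k => fst (th k * (Ci * cis (- m k * t + 0) * fourier (cubic (U t)) k))%C) l).
assert (Hh : Rsum (fun k => Cmod (interaction k t1 - interaction k t0)) l = h t1 - h t0).
{ unfold h; replace (Rsum _ l - Rsum _ l) with
    (Rsum (fun k => fst (th k * interaction k t1)%C) l + -1 * Rsum (fun k => fst (th k * interaction k t0)%C) l) by ring.
  rewrite <- Rsum_scal, <- Rsum_plus; apply Rsum_ext; intros k Hk.
  rewrite <- (proj2 (Hth' k) Hk); simpl; ring. }
destruct (MVT_gen h t0 t1 dh) as [c [Hc E]].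
- intros t; rewrite Rmin_left, Rmax_right by lra; intro Ht; unfold h, dh; clear -Ht Ht0 Ht1 HU.
  induction l as [|k l IH]; [exact (is_derive_const (V := R_NormedModule) 0 t)|].
  apply (is_derive_plus (V := R_NormedModule) (fun t => fst (th k * interaction k t)%C)); [|exact IH].
  apply is_derive_C_fst, is_derive_Cmult_l, interaction_derive; lra.
- intros t _; apply continuity_pt_filterlim; unfold h; clear -HU.
  change (continuous (fun t => Rsum (fun k => fst (th k * interaction k t)%C) l) t).
  induction l as [|k l IH]; [exact (continuous_const 0 t)|].
  apply (continuous_plus (V := R_NormedModule) (fun t => fst (th k * interaction k t)%C)); [|exact IH].
  apply ccont_fst, ccont_mult; [apply ccont_const|apply interaction_ccont].
- rewrite Rmin_left, Rmax_right in Hc by lra.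
  rewrite Hh, E; apply Rmult_le_compat_r; [lra|].
  eapply Rle_trans; [|apply (HG c Hc l Hl)].
  unfold dh; apply Rsum_le; intros k _.
  eapply Rle_trans; [eapply Rle_trans; [apply Rle_abs|apply Rabs_fst_le]|].
  rewrite !Cmod_mult, (proj1 (Hth' k)), Cmod_cis.
  replace (Cmod Ci) with 1; [lra|].
  unfold Cmod, Ci; simpl; replace (_ + _) with 1 by ring; symmetry; apply sqrt_1.
Qed.

Lemma wiener_le_cubic_flow t A : wiener_le (U t) A -> wiener_le (cubic (U t)) (A ^ 3).
Proof.
intro H; apply wiener_approx_wiener_le; [apply ccont_cubic, flow_ccont|apply wiener_approx_cubic].
destruct (flow_C1 _ _ _ _ HU t) as [df [Hd Hc]].
apply (wiener_le_wiener_approx _ df); auto; apply (flow_periodic _ _ _ _ HU).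
Qed.

Lemma wiener_le_propagate A G t0 t1 : 0 <= t0 <= t1 -> t1 <= T -> wiener_le (U t0) A ->
  (forall t, t0 <= t <= t1 -> wiener_le (U t) G) -> wiener_le (U t1) (A + G ^ 3 * (t1 - t0)).
Proof.
intros H0 H1 HA HG l Hl.
pose proof (interaction_variation (G ^ 3) t0 t1 l H0 H1 Hl) as HV.
apply Rle_trans with (Rsum (fun k => Cmod (fourier (U t0) k) + Cmod (interaction k t1 - interaction k t0)) l).
- apply Rsum_le; intros k _; rewrite <- !Cmod_interaction.
  replace (interaction k t1) with (interaction k t0 + (interaction k t1 - interaction k t0))%C at 1 by ring.
  apply Cmod_triangle.
- rewrite Rsum_plus; apply Rplus_le_compat; [apply HA, Hl|apply HV].
  intros t Ht; apply wiener_le_cubic_flow, HG, Ht.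
Qed.

Lemma wiener_le_mono f A B : A <= B -> wiener_le f A -> wiener_le f B.
Proof. intros H HA l Hl; eapply Rle_trans; [apply HA, Hl|exact H]. Qed.

Context (A : R) (HA : 0 < A) (HAT : 27 * A ^ 2 * T <= 1) (Hu0 : wiener_le u0 A).

(** A bootstrap in time steps of length [d]. The rough bound [B] lets the norm grow by at most A in
    one step, so 2 A up to a grid point gives 3 A during the next step. Starting again from time 0
    with this bound yields A + (3 A)^3 s <= 2 A, which is where 27 A^2 T <= 1 comes from. *)
Lemma flow_small t : 0 <= t <= T -> wiener_le (U t) (2 * A).
Proof.
destruct (flow_rough _ _ _ _ HU) as [B HB].
assert (HB0 : 0 <= B) by (apply (HB 0 []), NoDup_nil).
assert (HB3 : 0 < B ^ 3 + 1) by (pose proof (pow_le B 3 HB0); lra).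
(* [B] depends on the solution, so the number of steps does too, but the resulting bound does
   not. *)
set (d := A / (B ^ 3 + 1)).
assert (Hd : 0 < d) by (apply Rdiv_lt_0_compat; assumption).
assert (HdA : B ^ 3 * d <= A).
{ replace A with ((B ^ 3 + 1) * d) by (unfold d; field; lra); lra. }
assert (HW0 : wiener_le (U 0) A).
{ intros l Hl; rewrite (Rsum_ext _ (fun k => Cmod (fourier u0 k))); [apply Hu0, Hl|].
  intros k _; rewrite (fourier_ext _ u0); [reflexivity|apply (flow_init _ _ _ _ HU)]. }
assert (HI : forall n : nat, forall t, 0 <= t <= T -> t <= INR n * d -> wiener_le (U t) (2 * A)).
{ induction n as [|n IH]; intros s Hs Hsn.
  - simpl in Hsn; replace s with 0 by lra; apply (wiener_le_mono _ A); [lra|exact HW0].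
  - rewrite S_INR in Hsn.
    assert (H3 : forall r, 0 <= r <= s -> wiener_le (U r) (3 * A)).
    { intros r Hr; destruct (Rle_dec r (INR n * d)) as [H|H].
      - apply (wiener_le_mono _ (2 * A)); [lra|apply IH; lra].
      - assert (Hn0 : 0 <= INR n * d) by (apply Rmult_le_pos; [apply pos_INR|lra]).
        apply (wiener_le_mono _ (2 * A + B ^ 3 * (r - INR n * d))).
        + assert (B ^ 3 * (r - INR n * d) <= B ^ 3 * d); [|lra].
          apply Rmult_le_compat_l; [apply pow_le, HB0|lra].
        + apply wiener_le_propagate; try lra; [apply IH; lra|intros; apply HB]. }
    apply (wiener_le_mono _ (A + (3 * A) ^ 3 * (s - 0))).
    + replace ((3 * A) ^ 3 * (s - 0)) with (A * (27 * A ^ 2 * s)) by ring.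
      assert (27 * A ^ 2 * s <= 27 * A ^ 2 * T).
      { apply Rmult_le_compat_l; [|lra]; pose proof (pow2_ge_0 A); lra. }
      assert (A * (27 * A ^ 2 * s) <= A * 1) by (apply Rmult_le_compat_l; lra); lra.
    + apply wiener_le_propagate; try lra; [exact HW0|exact H3]. }
intro Ht; destruct (nfloor_ex (t / d)) as [n Hn].
{ apply Rmult_le_pos; [lra|left; apply Rinv_0_lt_compat, Hd]. }
apply (HI (S n)); [exact Ht|].
rewrite S_INR; replace t with (t / d * d) by (field; lra).
apply Rmult_le_compat_r; lra.
Qed.

Lemma interaction_small t l : 0 <= t <= T -> NoDup l ->
  Rsum (fun k => Cmod (interaction k t - fourier u0 k)) l <= 8 * A ^ 3 * T.
Proof.
intros Ht Hl; apply Rle_trans with ((2 * A) ^ 3 * (t - 0)).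
- rewrite (Rsum_ext _ (fun k => Cmod (interaction k t - interaction k 0)))
    by (intros; rewrite interaction_0; reflexivity).
  apply interaction_variation; try lra; [exact Hl|].
  intros s Hs; apply wiener_le_cubic_flow, flow_small; lra.
- replace ((2 * A) ^ 3 * (t - 0)) with (8 * A ^ 3 * t) by ring.
  apply Rmult_le_compat_l; [|lra]; pose proof (pow_lt A 3 HA); lra.
Qed.
End Flow.

(** * Comparison with the free evolution *)

Definition free (m : Z -> R) (p : list (C * Z)) (t : R) : list (C * Z) :=
  map (fun cn => (cis (m (snd cn) * t) * fst cn, snd cn)%C) p.

Lemma trig_weight_free m p t : trig_weight (free m p t) = trig_weight p.
Proof.
unfold trig_weight, free; rewrite Rsum_map; apply Rsum_ext; intros a _; simpl.
rewrite Cmod_mult, Cmod_cis; ring.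
Qed.

Lemma fourier_free m p t k : fourier (trig_eval (free m p t)) k = (cis (m k * t) * fourier (trig_eval p) k)%C.
Proof.
rewrite !fourier_trig_eval; unfold free; rewrite Csum_map, <- Csum_mult_l; apply Csum_ext; intros [c n] _; simpl.
unfold delta; destruct Z.eq_dec as [->|]; ring.
Qed.

Lemma wiener_le_ext f g B : (forall x, f x = g x) -> wiener_le f B -> wiener_le g B.
Proof.
intros H Hf l Hl; rewrite (Rsum_ext _ (fun k => Cmod (fourier f k))); [apply Hf, Hl|].
intros k _; rewrite (fourier_ext f g k H); reflexivity.
Qed.

Lemma trig_eval_periodic p : periodic (trig_eval p).
Proof.
intro x; unfold trig_eval; apply Csum_ext; intros a _; f_equal.
replace (2 * PI) with (IZR 1 * (2 * PI)) by ring; apply expi_periodic.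
Qed.

Section Picard.
Context (m : Z -> R) (T : posreal) (u0 : R -> C) (U : R -> R -> C) (HU : flow m T u0 U).
Context (p : list (C * Z)) (Hp : 0 < trig_weight p) (HpT : 27 * trig_weight p ^ 2 * T <= 1) (Hu0 : forall x, u0 x = trig_eval p x).

Let Hwb : wiener_le u0 (trig_weight p).
Proof. apply (wiener_le_ext (trig_eval p)); [intro; symmetry; apply Hu0|apply wiener_le_trig_eval]. Qed.

(** The coefficients of the difference have the moduli bounded in l^1 by [interaction_small].
    Passing to [wiener_approx] turns this into a uniform bound, in place of summing a Fourier
    series. *)
Lemma flow_near_free t x : 0 <= t <= T -> Cmod (U t x - trig_eval (free m p t) x) <= 8 * trig_weight p ^ 3 * T.
Proof.
intro Ht; apply (wiener_approx_bound (fun x => U t x - trig_eval (free m p t) x)%C).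
destruct (flow_C1 _ _ _ _ HU t) as [df [Hd Hc]].
set (dv := fun x => trig_eval (map (fun cn => (fst cn * (RtoC (IZR (snd cn)) * Ci), snd cn)%C) (free m p t)) x).
apply (wiener_le_wiener_approx _ (fun x => df x - dv x)%C).
- intro y; rewrite (flow_periodic _ _ _ _ HU), trig_eval_periodic; reflexivity.
- intro y; apply (is_derive_minus (V := C_R_NormedModule) (U t)); [apply Hd|apply is_derive_trig_eval].
- apply ccont_minus; [exact Hc|apply ccont_trig_eval].
- intros l Hl.
  eapply Rle_trans; [|apply (interaction_small m T u0 U HU (trig_weight p) Hp HpT Hwb t l Ht Hl)].
  right; apply Rsum_ext; intros k _.
  rewrite fourier_minus by (apply (flow_ccont m T u0 U HU) || apply ccont_trig_eval).
  rewrite fourier_free, <- (fourier_ext u0 _ k Hu0); unfold interaction.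
  replace (cis (- m k * t + 0)) with (Cconj (cis (m k * t))) by (rewrite <- cis_opp; f_equal; ring).
  set (z := cis (m k * t)).
  assert (Hz : (z * Cconj z = 1)%C) by (rewrite <- Cmod2_conj; unfold z; rewrite Cmod_cis; f_equal; ring).
  rewrite <- (Rmult_1_l (Cmod (_ * _ - _))), <- (Cmod_cis (m k * t)), <- Cmod_mult; fold z; f_equal.
  transitivity (z * Cconj z * fourier (U t) k - z * fourier u0 k)%C; [|ring].
  rewrite Hz; ring.
Qed.

Lemma cubic_near_free t k : 0 <= t <= T ->
  Cmod (fourier (cubic (U t)) k - fourier (cubic (trig_eval (free m p t))) k) <= 56 * trig_weight p ^ 5 * T.
Proof.
intro Ht; apply fourier_close.
- apply ccont_cubic, (flow_ccont m T u0 U HU).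
- apply ccont_cubic, ccont_trig_eval.
- intro x; replace (56 * trig_weight p ^ 5 * T) with (7 * trig_weight p ^ 2 * (8 * trig_weight p ^ 3 * T)) by ring.
  apply Cmod_cubic_diff.
  + apply (wiener_approx_bound (U t)).
    destruct (flow_C1 _ _ _ _ HU t) as [df [Hd Hc]].
    apply (wiener_le_wiener_approx _ df); auto; [apply (flow_periodic _ _ _ _ HU)|].
    apply (flow_small m T u0 U HU (trig_weight p) Hp HpT Hwb t Ht).
  + rewrite <- (trig_weight_free m p t); apply Cmod_trig_eval.
  + apply flow_near_free, Ht.
Qed.

(** The derivative of [interaction] carries a factor i, so a lower bound on the real part of the
    rotated cubic coefficient pushes up the imaginary part. Evaluating the cubic term on the free
    evolution costs the quintic error of [cubic_near_free]. *)
Lemma interaction_growth k b :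
  (forall t, 0 <= t <= T -> b <= fst (cis (- m k * t + 0) * fourier (cubic (trig_eval (free m p t))) k)%C) ->
  T * (b - 56 * trig_weight p ^ 5 * T) <= snd (interaction m U k T - fourier u0 k)%C.
Proof.
intro Hb; pose proof (cond_pos T) as HT.
destruct (MVT_gen (fun t => snd (interaction m U k t)) 0 T
  (fun t => snd (Ci * cis (- m k * t + 0) * fourier (cubic (U t)) k)%C)) as [c [Hc E]].
- intros t; rewrite Rmin_left, Rmax_right by lra; intro Ht.
  apply is_derive_C_snd, (interaction_derive m T u0 U HU k t Ht).
- intros t _; apply continuity_pt_filterlim, ccont_snd, (interaction_ccont m T u0 U HU).
- rewrite Rmin_left, Rmax_right in Hc by lra.
  rewrite <- (interaction_0 m T u0 U HU k).
  change (snd (interaction m U k T - interaction m U k 0)%C)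
    with (snd (interaction m U k T) - snd (interaction m U k 0)).
  rewrite E, Rminus_0_r, (Rmult_comm T); apply Rmult_le_compat_r; [lra|].
  set (n := fourier (cubic (U c)) k).
  set (n' := fourier (cubic (trig_eval (free m p c))) k).
  assert (H1 : Rabs (fst (cis (- m k * c + 0) * (n - n'))%C) <= 56 * trig_weight p ^ 5 * T).
  { eapply Rle_trans; [apply Rabs_fst_le|]; rewrite Cmod_mult, Cmod_cis, Rmult_1_l.
    apply cubic_near_free, Hc. }
  specialize (Hb c Hc); fold n' in Hb.
  apply Rabs_le_between in H1.
  replace (snd (Ci * cis (- m k * c + 0) * n)%C)
    with (fst (cis (- m k * c + 0) * n')%C + fst (cis (- m k * c + 0) * (n - n'))%C) by (simpl; ring).
  lra.
Qed.

Lemma interaction_remainder k : Cmod (interaction m U k T - fourier u0 k) <= 8 * trig_weight p ^ 3 * T.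
Proof.
pose proof (cond_pos T) as HT.
eapply Rle_trans; [|apply (interaction_small m T u0 U HU (trig_weight p) Hp HpT Hwb T [k])].
- simpl; lra.
- lra.
- repeat constructor; intros [].
Qed.
End Picard.

(** * Third derivative along a line *)

Lemma norm_lin_app {V W : NormedModule R_AbsRing} (L : Lin V W) x :
  norm (lin_app L x) <= norm L * norm x.
Proof.
assert (HL : is_linear (lin_app L)) by exact (proj2_sig L).
destruct (sup_norm_spec (fun y : V => norm y <= 1) (unit_ball_nonempty V)
  (lin_app L) (linear_bounded_on V W _ HL)) as [H _].
change (norm L) with (sup_norm (fun y : V => norm y <= 1) (lin_app L)).
destruct (norm_ge_0 x) as [Hx|Hx].
- set (y := scal (/ norm x : R) x).
  assert (Hy : norm y <= 1).
  { eapply Rle_trans; [apply (norm_scal (V := V))|].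
    change (Rabs (/ norm x) * norm x <= 1).
    rewrite Rabs_pos_eq by (left; apply Rinv_0_lt_compat, Hx); right; field; lra. }
  specialize (H y Hy); cbv beta in H.
  replace x with (scal (norm x : R) y) at 1.
  + rewrite (linear_scal _ HL).
    eapply Rle_trans; [apply (norm_scal (V := W))|].
    change (Rabs (norm x) * norm (lin_app L y) <= sup_norm (fun z : V => norm z <= 1) (lin_app L) * norm x).
    rewrite Rabs_pos_eq by lra; rewrite Rmult_comm; apply Rmult_le_compat_r; [lra|exact H].
  + unfold y; rewrite scal_assoc; change (scal (norm x * / norm x : R) x = x).
    rewrite Rinv_r by lra; apply (scal_one (V := V)).
- symmetry in Hx; rewrite Hx, Rmult_0_r; apply norm_eq_zero in Hx; subst x.
  rewrite linear_zero by exact HL; rewrite norm_zero; lra.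
Qed.

(** Moves a bounded functional on [W] to one on [Lin V W], at the price of a factor norm f. Three
    uses in succession reach the third derivative without any multilinear maps. *)
Lemma is_linear_eval {V W : NormedModule R_AbsRing} (l : W -> R) c f :
  is_linear (V := R_NormedModule) l -> 0 <= c -> (forall w, Rabs (l w) <= c * norm w) ->
  is_linear (V := R_NormedModule) (fun L : Lin V W => l (lin_app L f)) /\
  forall L : Lin V W, Rabs (l (lin_app L f)) <= c * norm f * norm L.
Proof.
intros Hl Hc Hb.
assert (HB : forall L : Lin V W, Rabs (l (lin_app L f)) <= c * norm f * norm L).
{ intro L; eapply Rle_trans; [apply Hb|].
  rewrite Rmult_assoc; apply Rmult_le_compat_l; [exact Hc|].
  rewrite Rmult_comm; apply norm_lin_app. }
split; [split|exact HB].
- intros x y; rewrite <- (linear_plus _ Hl); reflexivity.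
- intros k x; rewrite <- (linear_scal _ Hl); reflexivity.
- exists (c * norm f + 1); split.
  + pose proof (norm_ge_0 f); nra.
  + intro L; change (Rabs (l (lin_app L f)) <= (c * norm f + 1) * norm L).
    pose proof (norm_ge_0 L); specialize (HB L); lra.
Qed.

Lemma is_derive_along {V W : NormedModule R_AbsRing} (Phi : V -> W) (D : Lin V W) (l : W -> R) (f : V) (e : R) :
  is_linear (V := R_NormedModule) l -> filterdiff Phi (locally (scal e f)) (lin_app D) ->
  is_derive (fun x : R => l (Phi (scal x f))) e (l (lin_app D f)).
Proof.
intros Hl HD.
assert (HDl : is_linear (lin_app D)) by exact (proj2_sig D).
apply (filterdiff_ext_lin (U := R_NormedModule) (V := R_NormedModule) _ (fun y : R => l (lin_app D (scal y f)))).
2:{ intro y; rewrite (linear_scal _ HDl), (linear_scal _ Hl); reflexivity. }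
apply (filterdiff_comp' (U := R_NormedModule) (V := V) (W := R_NormedModule)
  (fun x : R => scal x f) (fun v => l (Phi v)) e (fun y : R => scal y f) (fun v => l (lin_app D v))).
- exact (filterdiff_linear (U := R_NormedModule) _ (is_linear_scal_l (K := R_AbsRing) (V := V) f)).
- apply (filterdiff_comp' (U := V) (V := W) (W := R_NormedModule) Phi l (scal e f) (lin_app D) l); [exact HD|].
  apply filterdiff_linear, Hl.
Qed.

Lemma locally_along {V : NormedModule R_AbsRing} (P : V -> Prop) (f : V) :
  locally (zero : V) P -> locally 0 (fun e : R => P (scal e f)).
Proof.
intro H.
assert (HC : continuous (fun e : R => scal e f) 0).
{ apply (continuous_scal_l (V := V) (fun e : R => e)); apply continuous_id. }
unfold continuous, filterlim, filter_le, filtermap in HC.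
apply HC.
replace (scal (0 : R) f) with (zero : V); [exact H|].
symmetry; apply (scal_zero_l (V := V) f).
Qed.

(** [K] is the norm of the third derivative at zero and is fixed before the functional and the
    direction; these will vary with [N]. *)
Lemma C3_third_derivative {V W : NormedModule R_AbsRing} (Phi : V -> W) : Ck_at 3 Phi zero ->
  exists K, 0 <= K /\ forall (l : W -> R) c (f : V),
    is_linear (V := R_NormedModule) l -> 0 <= c -> (forall w, Rabs (l w) <= c * norm w) ->
    exists (h1 h2 : R -> R) L,
      locally 0 (fun e => is_derive (fun x : R => l (Phi (scal x f))) e (h1 e)) /\
      locally 0 (fun e => is_derive h1 e (h2 e)) /\
      is_derive h2 0 L /\ Rabs L <= K * c * norm f ^ 3.
Proof.
intros [D1 [H1 [D2 [H2 [D3 [H3 _]]]]]].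
exists (norm (D3 zero)); split; [apply norm_ge_0|].
intros l c f Hl Hc Hb.
destruct (is_linear_eval (V := V) l c f Hl Hc Hb) as [Hl1 Hb1].
assert (Hf := norm_ge_0 f).
destruct (is_linear_eval (V := V) _ (c * norm f) f Hl1) as [Hl2 Hb2]; [apply Rmult_le_pos; assumption|exact Hb1|].
destruct (is_linear_eval (V := V) _ (c * norm f * norm f) f Hl2) as [_ Hb3];
  [repeat apply Rmult_le_pos; assumption|exact Hb2|].
exists (fun e => l (lin_app (D1 (scal e f)) f)),
  (fun e => l (lin_app (lin_app (D2 (scal e f)) f) f)),
  (l (lin_app (lin_app (lin_app (D3 zero) f) f) f)).
split; [|split; [|split]].
- apply (locally_along _ f) in H1; generalize H1; apply filter_imp; intros e He.
  exact (is_derive_along Phi _ l f e Hl He).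
- apply (locally_along _ f) in H2; generalize H2; apply filter_imp; intros e He.
  exact (is_derive_along D1 _ _ f e Hl1 He).
- assert (H4 := locally_singleton _ _ H3).
  assert (E : scal (0 : R) f = zero) by apply (scal_zero_l (V := V) f).
  refine (is_derive_along D2 (D3 zero) _ f 0 Hl2 _).
  exact (eq_ind _ (fun z : V => filterdiff D2 (locally z) (lin_app (D3 zero))) H4 _ (eq_sym E)).
- eapply Rle_trans; [apply Hb3|]; right; ring.
Qed.

(** A one-sided expansion with error o(x^n) integrates term by term: the mean value theorem is
    applied to [g] minus the antiderivative of its leading term. *)
Lemma peano_integrate (g dg : R -> R) a n : g 0 = 0 ->
  locally 0 (fun e => is_derive g e (dg e)) ->
  (forall eta, 0 < eta -> exists d, 0 < d /\ forall x, 0 < x < d -> Rabs (dg x - a * x ^ n) <= eta * x ^ n) ->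
  forall eta, 0 < eta -> exists d, 0 < d /\ forall x, 0 < x < d ->
    Rabs (g x - a / INR (S n) * x ^ S n) <= eta * x ^ S n.
Proof.
intros Hg0 [d0 Hd0] H eta He.
destruct (H eta He) as [d [Hd Hdg]].
exists (Rmin d d0); split; [apply Rmin_glb_lt; [exact Hd|apply cond_pos]|].
intros x [Hx1 Hx2].
assert (Hxd := Rlt_le_trans _ _ _ Hx2 (Rmin_l _ _)); assert (Hxd0 := Rlt_le_trans _ _ _ Hx2 (Rmin_r _ _)).
assert (HSn : INR (S n) <> 0) by (apply not_0_INR; discriminate).
assert (Hder : forall y, 0 <= y <= x ->
  is_derive (fun y => g y - a / INR (S n) * y ^ S n) y (dg y - a * y ^ n)).
{ intros y Hy.
  apply (is_derive_minus (V := R_NormedModule)).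
  - apply Hd0; change (Rabs (y - 0) < d0); rewrite Rminus_0_r, Rabs_pos_eq; lra.
  - auto_derive; [exact I|]; change (match n with 0%nat => 1 | S _ => INR n + 1 end) with (INR (S n)).
    field; exact HSn. }
destruct (MVT_cor2 (fun y => g y - a / INR (S n) * y ^ S n) (fun y => dg y - a * y ^ n) 0 x Hx1) as [c [E Hc]].
{ intros y Hy; apply is_derive_Reals, Hder, Hy. }
rewrite Hg0 in E; simpl pow in E at 2; rewrite Rmult_0_l, Rmult_0_r, !Rminus_0_r in E.
rewrite E, Rabs_mult, (Rabs_pos_eq x) by lra.
simpl pow; rewrite (Rmult_comm x), <- Rmult_assoc; apply Rmult_le_compat_r; [lra|].
eapply Rle_trans; [apply Hdg; lra|].
apply Rmult_le_compat_l; [lra|]; apply pow_incr; lra.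
Qed.

Lemma small_zero a M d : 0 < d -> (forall x, 0 < x < d -> Rabs a <= M * x) -> a = 0.
Proof.
intros Hd H; destruct (Req_dec a 0) as [E|E]; [exact E|exfalso].
assert (Ha := Rabs_pos_lt a E).
assert (HM : 0 < M) by (specialize (H (d / 2)); nra).
set (x := Rmin (d / 2) (Rabs a / (2 * M))).
assert (Hx : 0 < x) by (apply Rmin_glb_lt; [lra|apply Rdiv_lt_0_compat; lra]).
assert (H1 : x <= d / 2) by apply Rmin_l.
assert (H2 : x <= Rabs a / (2 * M)) by apply Rmin_r.
specialize (H x ltac:(lra)).
assert (M * x <= M * (Rabs a / (2 * M))) by (apply Rmult_le_compat_l; lra).
replace (M * (Rabs a / (2 * M))) with (Rabs a / 2) in H0 by (field; lra); lra.
Qed.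

(** The hypotheses on [h] force [h(0) = h'(0) = h''(0) = 0]; the third Taylor coefficient is then
    the limit of [h e / e^3]. *)
Lemma third_derivative_lower_bound (h h1 h2 : R -> R) L b B0 B1 d :
  locally 0 (fun e => is_derive h e (h1 e)) -> locally 0 (fun e => is_derive h1 e (h2 e)) ->
  is_derive h2 0 L -> 0 < d ->
  (forall e, 0 < e < d -> Rabs (h e) <= B0 * e ^ 3) ->
  (forall e, 0 < e < d -> b * e ^ 3 - B1 * e ^ 5 <= h e) ->
  6 * b <= L.
Proof.
intros H0 H1 H2 Hd HC HL.
set (g2 := fun x => h2 x - h2 0).
set (g1 := fun x => h1 x - h1 0 - h2 0 * x).
set (g0 := fun x => h x - h 0 - h1 0 * x - h2 0 / 2 * x ^ 2).
(* Differentiability of [h2] at the single point 0 gives the first-order expansion; two integrations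
   bring it to order 3 with coefficient L / 6. *)
assert (P2 : forall eta, 0 < eta -> exists d, 0 < d /\ forall x, 0 < x < d ->
  Rabs (g2 x - L * x ^ 1) <= eta * x ^ 1).
{ intros eta He; apply is_derive_Reals in H2; destruct (H2 eta He) as [d' Hd'].
  exists d'; split; [apply cond_pos|]; intros x Hx.
  specialize (Hd' x ltac:(lra)); rewrite Rplus_0_l in Hd'.
  unfold g2; simpl; rewrite Rmult_1_r.
  replace (h2 x - h2 0 - L * x) with (((h2 x - h2 0) / x - L) * x) by (field; lra).
  rewrite Rabs_mult, (Rabs_pos_eq x) by lra; apply Rmult_le_compat_r; [lra|].
  left; apply Hd'; rewrite Rabs_pos_eq; lra. }
assert (P1 := peano_integrate g1 g2 L 1 ltac:(unfold g1; ring)).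
assert (P1' : locally 0 (fun e => is_derive g1 e (g2 e))).
{ generalize H1; apply filter_imp; intros e He; unfold g1, g2.
  apply (is_derive_minus (V := R_NormedModule) (fun x => h1 x - h1 0) (fun x => h2 0 * x)).
  - replace (h2 e) with (h2 e - 0) by ring.
    apply (is_derive_minus (V := R_NormedModule) h1 (fun _ => h1 0)); [exact He|].
    apply (is_derive_const (V := R_NormedModule)).
  - auto_derive; [exact I|ring]. }
specialize (P1 P1' P2).
assert (P0 := peano_integrate g0 g1 (L / INR 2) 2 ltac:(unfold g0; ring)).
assert (P0' : locally 0 (fun e => is_derive g0 e (g1 e))).
{ generalize H0; apply filter_imp; intros e He; unfold g0, g1.
  apply (is_derive_minus (V := R_NormedModule) (fun x => h x - h 0 - h1 0 * x) (fun x => h2 0 / 2 * x ^ 2)).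
  - apply (is_derive_minus (V := R_NormedModule) (fun x => h x - h 0) (fun x => h1 0 * x)).
    + replace (h1 e) with (h1 e - 0) by ring.
      apply (is_derive_minus (V := R_NormedModule) h (fun _ => h 0)); [exact He|].
      apply (is_derive_const (V := R_NormedModule)).
    + auto_derive; [exact I|ring].
  - auto_derive; [exact I|field]. }
specialize (P0 P0' P1).
assert (E6 : L / INR 2 / INR 3 = L / 6) by (simpl; field).
rewrite E6 in P0; clear P1 P2 P1' P0' E6.
set (a0 := h 0) in *; set (a1 := h1 0) in *; set (a2 := h2 0 / 2) in *.
(* The quadratic Taylor polynomial is itself O(x^3) on the right of 0; its coefficients are then
   shown to vanish one after the other. *)
assert (HP : exists d' M, 0 < d' <= 1 /\ forall x, 0 < x < d' -> Rabs (a0 + a1 * x + a2 * x ^ 2) <= M * x ^ 3).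
{ destruct (P0 1 Rlt_0_1) as [d' [Hd' HP]].
  exists (Rmin 1 (Rmin d d')), (B0 + Rabs (L / 6) + 1); split.
  { split; [repeat apply Rmin_glb_lt; lra|apply Rmin_l]. }
  intros x [Hx1 Hx2].
  assert (Hx3 := Rlt_le_trans _ _ _ Hx2 (Rmin_r _ _)).
  assert (Hxd := Rlt_le_trans _ _ _ Hx3 (Rmin_l _ _)); assert (Hxd' := Rlt_le_trans _ _ _ Hx3 (Rmin_r _ _)).
  specialize (HP x ltac:(lra)); specialize (HC x ltac:(lra)).
  assert (Hx0 : 0 < x ^ 3) by (apply pow_lt, Hx1).
  replace (a0 + a1 * x + a2 * x ^ 2) with (h x + - (L / 6 * x ^ 3) + - (g0 x - L / 6 * x ^ 3)) by (unfold g0; ring).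
  eapply Rle_trans; [apply Rabs_triang|].
  eapply Rle_trans; [apply Rplus_le_compat_r, Rabs_triang|].
  rewrite !Rabs_Ropp, (Rabs_mult (L / 6)), (Rabs_pos_eq (x ^ 3)) by lra; lra. }
destruct HP as [d' [M [Hd' HP]]].
assert (HM : 0 <= M).
{ specialize (HP (d' / 2) ltac:(lra)).
  assert (0 < (d' / 2) ^ 3) by (apply pow_lt; lra); pose proof (Rabs_pos (a0 + a1 * (d' / 2) + a2 * (d' / 2) ^ 2)); nra. }
assert (E0 : a0 = 0).
{ apply (small_zero _ (M + Rabs a1 + Rabs a2) d'); [lra|]; intros x Hx; specialize (HP x Hx).
  replace a0 with ((a0 + a1 * x + a2 * x ^ 2) + - (a1 * x) + - (a2 * x ^ 2)) by ring.
  eapply Rle_trans; [apply Rabs_triang|].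
  eapply Rle_trans; [apply Rplus_le_compat_r, Rabs_triang|].
  rewrite !Rabs_Ropp, !Rabs_mult, (Rabs_pos_eq x), (Rabs_pos_eq (x ^ 2)) by (try apply pow_le; lra).
  assert (x ^ 2 <= x) by nra; assert (x ^ 3 <= x) by nra.
  pose proof (Rabs_pos a1); pose proof (Rabs_pos a2); nra. }
assert (E1 : a1 = 0).
{ apply (small_zero _ (M + Rabs a2) d'); [lra|]; intros x Hx; specialize (HP x Hx).
  rewrite E0, Rplus_0_l in HP.
  replace (a1 * x + a2 * x ^ 2) with ((a1 + a2 * x) * x) in HP by ring.
  replace (M * x ^ 3) with (M * x ^ 2 * x) in HP by ring.
  rewrite Rabs_mult, (Rabs_pos_eq x) in HP by lra; apply Rmult_le_reg_r in HP; [|lra].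
  replace a1 with ((a1 + a2 * x) + - (a2 * x)) by ring.
  eapply Rle_trans; [apply Rabs_triang|].
  rewrite !Rabs_Ropp, Rabs_mult, (Rabs_pos_eq x) by lra.
  assert (x ^ 2 <= x) by nra; pose proof (Rabs_pos a2); nra. }
assert (E2 : a2 = 0).
{ apply (small_zero _ M d'); [lra|]; intros x Hx; specialize (HP x Hx).
  rewrite E0, E1 in HP.
  replace (0 + 0 * x + a2 * x ^ 2) with (a2 * x ^ 2) in HP by ring.
  replace (M * x ^ 3) with (M * x * x ^ 2) in HP by ring.
  assert (0 < x ^ 2) by (apply pow_lt; lra).
  rewrite Rabs_mult, (Rabs_pos_eq (x ^ 2)) in HP by lra; apply Rmult_le_reg_r in HP; lra. }
apply Rmult_le_reg_l with (/ 6); [lra|]; rewrite <- Rmult_assoc, Rinv_l, Rmult_1_l by lra.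
apply le_epsilon; intros eta He.
destruct (P0 (eta / 2) ltac:(lra)) as [e' [He' HPe]].
(* Small enough for both hypotheses to apply and for B1 x^2 to be at most eta / 2. *)
set (x0 := Rmin (Rmin d e') (Rmin 1 (eta / (2 * (Rabs B1 + 1))))).
assert (HC1 := Rabs_pos B1).
assert (Hx0 : 0 < x0).
{ repeat apply Rmin_glb_lt; try lra; apply Rdiv_lt_0_compat; lra. }
set (x := x0 / 2).
assert (Hxd : x < d) by (unfold x; pose proof (Rmin_l (Rmin d e') (Rmin 1 (eta / (2 * (Rabs B1 + 1)))));
  pose proof (Rmin_l d e'); fold x0 in H; lra).
assert (Hxe : x < e') by (unfold x; pose proof (Rmin_l (Rmin d e') (Rmin 1 (eta / (2 * (Rabs B1 + 1)))));
  pose proof (Rmin_r d e'); fold x0 in H; lra).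
assert (Hx1 : x < 1) by (unfold x; pose proof (Rmin_r (Rmin d e') (Rmin 1 (eta / (2 * (Rabs B1 + 1)))));
  pose proof (Rmin_l 1 (eta / (2 * (Rabs B1 + 1)))); fold x0 in H; lra).
assert (Hxc : x < eta / (2 * (Rabs B1 + 1))) by (unfold x; pose proof (Rmin_r (Rmin d e') (Rmin 1 (eta / (2 * (Rabs B1 + 1)))));
  pose proof (Rmin_r 1 (eta / (2 * (Rabs B1 + 1)))); fold x0 in H; lra).
assert (Hx : 0 < x) by (unfold x; lra).
specialize (HPe x ltac:(lra)); specialize (HL x ltac:(lra)).
assert (Hx3 : 0 < x ^ 3) by (apply pow_lt, Hx).
assert (Eg : g0 x = h x) by (unfold g0; fold a0 a1 a2; rewrite E0, E1, E2; ring).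
rewrite Eg in HPe; apply Rabs_le_between in HPe.
assert (HCx : B1 * x ^ 2 <= eta / 2).
{ apply Rle_trans with ((Rabs B1 + 1) * x).
  - apply Rle_trans with (Rabs B1 * x ^ 2); [apply Rmult_le_compat_r; [apply pow2_ge_0|apply Rle_abs]|].
    assert (x ^ 2 <= x) by nra; nra.
  - apply Rle_trans with ((Rabs B1 + 1) * (eta / (2 * (Rabs B1 + 1)))); [apply Rmult_le_compat_l; lra|].
    right; field; lra. }
apply Rmult_le_reg_r with (x ^ 3); [exact Hx3|].
replace (B1 * x ^ 5) with (B1 * x ^ 2 * x ^ 3) in HL by ring.
assert (B1 * x ^ 2 * x ^ 3 <= eta / 2 * x ^ 3) by (apply Rmult_le_compat_r; lra).
lra.
Qed.

(** * Test vectors, test functionals and coherent interactions *)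

Lemma is_series_single (m : nat) (c : R) : is_series (fun n => if Nat.eq_dec n m then c else 0) c.
Proof.
apply (filterlim_ext_loc (fun _ => c)); [|apply filterlim_const].
assert (H : forall n, sum_n (fun i => if Nat.eq_dec i m then c else 0) n = if le_dec m n then c else 0).
{ induction n as [|n IH].
  - rewrite sum_O; destruct Nat.eq_dec, le_dec; reflexivity || lia.
  - rewrite sum_Sn, IH.
    destruct (le_dec m n), (le_dec m (S n)), (Nat.eq_dec (S n) m); unfold plus; simpl; lra || lia. }
exists m; intros n Hn; rewrite H; destruct le_dec; [reflexivity|contradiction].
Qed.

Lemma is_series_0 : is_series (fun _ : nat => 0) 0.
Proof.
apply (filterlim_ext (fun _ => 0)); [|apply filterlim_const].
intro n; rewrite sum_n_const; ring.
Qed.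

Lemma Zsum_single (k : Z) (c : R) :
  Zsummable (fun j => if Z.eq_dec j k then c else 0) /\
  Zsum (fun j => if Z.eq_dec j k then c else 0) = c.
Proof.
assert (H : exists c1 c2, is_series (fun n => if Z.eq_dec (Z.of_nat n) k then c else 0) c1 /\
  is_series (fun n => if Z.eq_dec (- Z.of_nat (S n)) k then c else 0) c2 /\ c1 + c2 = c).
{ destruct (Z_le_gt_dec 0 k) as [Hk|Hk].
  - exists c, 0; split; [|split; [|ring]].
    + apply is_series_ext with (2 := is_series_single (Z.to_nat k) c); intro n.
      destruct Nat.eq_dec, Z.eq_dec; reflexivity || lia.
    + apply is_series_ext with (2 := is_series_0); intro n; destruct Z.eq_dec; reflexivity || lia.
  - exists 0, c; split; [|split; [|ring]].
    + apply is_series_ext with (2 := is_series_0); intro n; destruct Z.eq_dec; reflexivity || lia.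
    + apply is_series_ext with (2 := is_series_single (pred (Z.to_nat (- k))) c); intro n.
      destruct Nat.eq_dec, Z.eq_dec; reflexivity || lia. }
destruct H as [c1 [c2 [H1 [H2 E]]]]; split.
- split; [exists c1|exists c2]; assumption.
- transitivity (c1 + c2); [|exact E]; unfold Zsum; f_equal; apply is_series_unique; assumption.
Qed.

Lemma Zsum_finite (g : Z -> R) l : NoDup l ->
  Zsummable (fun k => if in_dec Z.eq_dec k l then g k else 0) /\
  Zsum (fun k => if in_dec Z.eq_dec k l then g k else 0) = Rsum g l.
Proof.
intro Hl; induction Hl as [|a l Ha Hl [IH1 IH2]]; [apply Zsum_zero|].
destruct (Zsum_single a (g a)) as [S1 S2].
replace (fun k => if in_dec Z.eq_dec k (a :: l) then g k else 0) with
  (fun k => 1 * (if Z.eq_dec k a then g a else 0) + 1 * (if in_dec Z.eq_dec k l then g k else 0)).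
- split; [apply Zsummable_lin; assumption|].
  rewrite Zsum_lin, S2, IH2 by assumption; simpl; ring.
- apply functional_extensionality; intro k.
  destruct (Z.eq_dec k a) as [E|E].
  + subst k; destruct (in_dec Z.eq_dec a (a :: l)) as [_|H]; [|destruct H; left; reflexivity].
    destruct (in_dec Z.eq_dec a l); [contradiction|ring].
  + destruct (in_dec Z.eq_dec k l) as [H|H], (in_dec Z.eq_dec k (a :: l)) as [H'|H']; simpl in H';
      try ring; [destruct H'; right; exact H|destruct H' as [H'|H']; [destruct E; auto|contradiction]].
Qed.

Lemma Rsum_le_Zsum (g : Z -> R) l : (forall k, 0 <= g k) -> NoDup l -> Zsummable g -> Rsum g l <= Zsum g.
Proof.
intros Hg Hl Hs; rewrite <- (proj2 (Zsum_finite g l Hl)).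
apply Zsum_le; [|exact Hs]; intro k; destruct in_dec; split; try apply Hg; lra.
Qed.

Lemma Rsum_sq_le {A} (x : A -> R) l : Rsum x l ^ 2 <= INR (length l) * Rsum (fun a => x a ^ 2) l.
Proof.
induction l as [|a l IH]; [simpl; lra|].
change (length (a :: l)) with (S (length l)); rewrite S_INR.
change (Rsum x (a :: l)) with (x a + Rsum x l).
change (Rsum (fun a => x a ^ 2) (a :: l)) with (x a ^ 2 + Rsum (fun a => x a ^ 2) l).
set (S := Rsum x l) in *; set (Q := Rsum (fun a => x a ^ 2) l) in *.
assert (Hn := pos_INR (length l)); set (n := INR (length l)) in *.
assert (HQ : 0 <= Q) by (apply Rsum_ge0; intros; apply pow2_ge_0).
destruct Hn as [Hn|Hn].
- assert (H : 0 <= / n * (n * x a - S) ^ 2).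
  { apply Rmult_le_pos; [left; apply Rinv_0_lt_compat, Hn|apply pow2_ge_0]. }
  replace (/ n * (n * x a - S) ^ 2) with (n * x a ^ 2 - 2 * x a * S + / n * S ^ 2) in H by (field; lra).
  assert (/ n * S ^ 2 <= Q).
  { apply Rmult_le_reg_l with n; [exact Hn|]; rewrite <- Rmult_assoc, Rinv_r, Rmult_1_l by lra; exact IH. }
  nra.
- rewrite <- Hn in *; assert (S = 0) by nra; rewrite H; nra.
Qed.

Section Sobolev.
Context (s : R).

Definition indicator (l : list Z) (k : Z) : C := if in_dec Z.eq_dec k l then RtoC 1 else RtoC 0.

Lemma indicator_term l k : Hs_term s (indicator l) k
  = if in_dec Z.eq_dec k l then Rpower (jap k) s ^ 2 else 0.
Proof.
unfold Hs_term, indicator; destruct in_dec; rewrite ?Cmod_1, ?Cmod_0; ring.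
Qed.

Lemma indicator_mem l : NoDup l -> Hs_subspace s (indicator l).
Proof.
intro Hl; change (Zsummable (Hs_term s (indicator l))).
replace (Hs_term s (indicator l)) with (fun k => if in_dec Z.eq_dec k l then Rpower (jap k) s ^ 2 else 0).
- apply (Zsum_finite (fun k => Rpower (jap k) s ^ 2) l Hl).
- apply functional_extensionality; intro k; symmetry; apply indicator_term.
Qed.

Definition indicator_Hs (l : list Z) (Hl : NoDup l) : Hs s := exist _ _ (indicator_mem l Hl).

Lemma norm_sq_Hs (v : Hs s) : norm v ^ 2 = Zsum (Hs_term s (coef v)).
Proof.
change (sqrt (Zsum (Hs_term s (proj1_sig v))) ^ 2 = Zsum (Hs_term s (proj1_sig v))).
apply pow2_sqrt, Zsum_Hs_ge0.
Qed.

Lemma norm_indicator_le l Hl W : 0 <= W -> (forall k, In k l -> Rpower (jap k) s <= W) ->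
  norm (indicator_Hs l Hl) <= sqrt (INR (length l)) * W.
Proof.
intros HW H.
assert (Hq : 0 <= sqrt (INR (length l)) * W) by (apply Rmult_le_pos; [apply sqrt_pos|exact HW]).
apply Rsqr_incr_0_var; [|exact Hq]; unfold Rsqr.
replace (norm (indicator_Hs l Hl) * norm (indicator_Hs l Hl)) with (norm (indicator_Hs l Hl) ^ 2) by ring.
replace (sqrt (INR (length l)) * W * (sqrt (INR (length l)) * W))
  with (sqrt (INR (length l)) ^ 2 * W ^ 2) by ring.
rewrite norm_sq_Hs, pow2_sqrt by apply pos_INR.
change (coef (indicator_Hs l Hl)) with (indicator l).
replace (Hs_term s (indicator l)) with (fun k => if in_dec Z.eq_dec k l then Rpower (jap k) s ^ 2 else 0)
  by (apply functional_extensionality; intro k; symmetry; apply indicator_term).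
rewrite (proj2 (Zsum_finite (fun k => Rpower (jap k) s ^ 2) l Hl)), <- Rsum_const.
apply Rsum_le; intros k Hk; apply pow_incr; split; [left; apply exp_pos|apply H, Hk].
Qed.

(** Cauchy-Schwarz on the finite list, with [w] a lower bound for the Sobolev weight there. *)
Lemma Rsum_coef_le (v : Hs s) l w : NoDup l -> 0 < w -> (forall k, In k l -> w <= Rpower (jap k) s) ->
  Rsum (fun k => Cmod (coef v k)) l <= / w * sqrt (INR (length l)) * norm v.
Proof.
intros Hl Hw H.
apply Rmult_le_reg_l with w; [exact Hw|].
rewrite <- !Rmult_assoc, Rinv_r, Rmult_1_l, <- Rsum_scal by lra.
apply Rsqr_incr_0_var; [|apply Rmult_le_pos; [apply sqrt_pos|apply norm_ge_0]]; unfold Rsqr.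
set (X := Rsum _ l).
replace (X * X) with (X ^ 2) by ring.
replace (sqrt (INR (length l)) * norm v * (sqrt (INR (length l)) * norm v))
  with (sqrt (INR (length l)) ^ 2 * norm v ^ 2) by ring.
rewrite norm_sq_Hs, pow2_sqrt by apply pos_INR.
eapply Rle_trans; [apply Rsum_sq_le|].
apply Rmult_le_compat_l; [apply pos_INR|].
apply Rle_trans with (Rsum (Hs_term s (coef v)) l).
- apply Rsum_le; intros k Hk; apply pow_incr; split.
  + apply Rmult_le_pos; [lra|apply Cmod_ge_0].
  + apply Rmult_le_compat_r; [apply Cmod_ge_0|apply H, Hk].
- apply Rsum_le_Zsum; [apply Hs_term_ge0|exact Hl|exact (proj2_sig v)].
Qed.

Lemma coef_scal (a : R) (v : Hs s) k : coef (scal a v) k = (RtoC a * coef v k)%C.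
Proof.
change (coef (scal a v) k) with (scal a (coef v k : C_R_ModuleSpace)).
apply scal_R_Cmult.
Qed.

Lemma norm_C0_app (T : posreal) (u : C0 T (Hs s)) t : norm (C0_app u t) <= norm u.
Proof.
apply (sup_norm_spec (fun _ : Icc T => True) (Icc_nonempty T) (C0_app u)); [|exact I].
apply C0_bounded_on; exact (proj2_sig u).
Qed.

(** Imaginary parts are taken because the cubic correction is i times a quantity with positive real
    part; real linearity suffices, as the scalars of [Hs] are real. *)
Definition test_functional (T : posreal) (t : Icc T) (th : Z -> C) (l : list Z) (u : C0 T (Hs s)) : R :=
  Rsum (fun k => snd (th k * coef (C0_app u t) k)%C) l.

Lemma test_functional_spec (T : posreal) (t : Icc T) th l w : NoDup l -> (forall k, Cmod (th k) = 1) ->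
  0 < w -> (forall k, In k l -> w <= Rpower (jap k) s) ->
  is_linear (V := R_NormedModule) (test_functional T t th l) /\
  forall u, Rabs (test_functional T t th l u) <= / w * sqrt (INR (length l)) * norm u.
Proof.
intros Hl Hth Hw H.
assert (Hb : forall u, Rabs (test_functional T t th l u) <= / w * sqrt (INR (length l)) * norm u).
{ intro u; apply Rle_trans with (Rsum (fun k => Cmod (coef (C0_app u t) k)) l).
  - unfold test_functional; clear -Hth; induction l as [|k l IH]; cbn [Rsum fold_right].
    + rewrite Rabs_R0; lra.
    + eapply Rle_trans; [apply Rabs_triang|apply Rplus_le_compat; [|exact IH]].
      eapply Rle_trans; [apply Rabs_snd_le|]; rewrite Cmod_mult, Hth; lra.
  - eapply Rle_trans; [apply (Rsum_coef_le _ l w Hl Hw H)|].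
    apply Rmult_le_compat_l; [|apply norm_C0_app].
    apply Rmult_le_pos; [left; apply Rinv_0_lt_compat, Hw|apply sqrt_pos]. }
split; [split|exact Hb].
- intros u v; change (test_functional T t th l (plus u v) = test_functional T t th l u + test_functional T t th l v).
  unfold test_functional; rewrite <- Rsum_plus; apply Rsum_ext; intros k _.
  change (coef (C0_app (plus u v) t) k) with (coef (C0_app u t) k + coef (C0_app v t) k)%C; simpl; ring.
- intros a u; change (test_functional T t th l (scal a u) = a * test_functional T t th l u).
  unfold test_functional; rewrite <- Rsum_scal; apply Rsum_ext; intros k _.
  change (C0_app (scal a u) t) with (scal a (C0_app u t)); rewrite coef_scal.
  set (z := coef (C0_app u t) k); simpl; ring.
- exists (/ w * sqrt (INR (length l)) + 1); split.
  + assert (0 <= / w * sqrt (INR (length l))); [|lra].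
    apply Rmult_le_pos; [left; apply Rinv_0_lt_compat, Hw|apply sqrt_pos].
  + intro u; change (Rabs (test_functional T t th l u) <= (/ w * sqrt (INR (length l)) + 1) * norm u).
    pose proof (norm_ge_0 u); specialize (Hb u); lra.
Qed.
End Sobolev.

(** * Wave packets and their cubic interactions *)

Definition wave (e : R) (l : list Z) : list (C * Z) := map (fun a => (RtoC e, a)) l.

Lemma trig_weight_wave e l : 0 <= e -> trig_weight (wave e l) = INR (length l) * e.
Proof.
intro He; unfold trig_weight, wave; rewrite Rsum_map; simpl; rewrite Rsum_const, Cmod_R, Rabs_pos_eq; auto.
Qed.

Lemma fourier_wave e l k : NoDup l -> fourier (trig_eval (wave e l)) k = (RtoC e * indicator l k)%C.
Proof.
intro Hl; rewrite fourier_trig_eval; unfold wave; rewrite Csum_map; simpl; rewrite Csum_mult_l; f_equal.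
unfold indicator; destruct in_dec as [H|H].
- rewrite <- (Csum_delta k l Hl H); apply Csum_ext; intros a _.
  unfold delta; destruct Z.eq_dec, Z.eq_dec; congruence.
- rewrite (Csum_ext _ (fun _ => RtoC 0)); [rewrite Csum_const; ring|].
  intros a Ha; unfold delta; destruct Z.eq_dec as [->|]; [contradiction|reflexivity].
Qed.

Lemma fourier_cubic_trig_eval p k : fourier (cubic (trig_eval p)) k =
  Csum (fun a => Csum (fun b => Csum (fun c =>
    fst a * Cconj (fst b) * fst c * RtoC (delta (snd a - snd b + snd c) k))%C p) p) p.
Proof.
rewrite (fourier_ext _ (trig_eval (trig_mul (trig_mul p (trig_conj p)) p))).
- rewrite fourier_trig_eval; unfold trig_mul, trig_conj.
  rewrite !Csum_flat_map; apply Csum_ext; intros a _.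
  rewrite !Csum_map; apply Csum_ext; intros b _.
  rewrite Csum_map; apply Csum_ext; intros c _; simpl.
  unfold Z.sub; reflexivity.
- intro x; rewrite cubicE, !trig_eval_trig_mul, trig_eval_trig_conj; reflexivity.
Qed.

Lemma fst_Csum {A} th (g : A -> C) l : fst (th * Csum g l)%C = Rsum (fun a => fst (th * g a)%C) l.
Proof. 
induction l as [|a l IH]; [simpl; ring|].
change (fst (th * (g a + Csum g l))%C = fst (th * g a)%C + Rsum (fun a => fst (th * g a)%C) l).
rewrite Cmult_plus_distr_l, <- IH; reflexivity.
 Qed.

Lemma Rsum_ge_term {A} (g : A -> R) l a : (forall b, In b l -> 0 <= g b) -> In a l -> g a <= Rsum g l.
Proof.
induction l as [|b l IH]; simpl; [tauto|]; intros Hg [->|H].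
- assert (0 <= Rsum g l) by (apply Rsum_ge0; auto); lra.
- specialize (IH (fun c Hc => Hg c (or_intror Hc)) H); pose proof (Hg b (or_introl eq_refl)); lra.
Qed.

Lemma cos_ge_half x : Rabs x <= 1 -> 1 / 2 <= cos x.
Proof.
intro H; pose proof PI2_3_2.
replace (cos x) with (cos (Rabs x)) by (unfold Rabs; destruct Rcase_abs; rewrite ?cos_neg; reflexivity).
rewrite <- cos_PI3; pose proof (Rabs_pos x); apply cos_decr_1; lra.
Qed.

(** The [length J ^ 2] interactions [a - b + c = k] with [a] and [b] in [J] are in phase. *)
Lemma coherent_interactions m (T : R) e I J k t : 0 <= e -> 0 <= t <= T -> NoDup J -> incl J I ->
  (forall a b, In a J -> In b J -> In (k - a + b)%Z I) ->
  (forall a b c, In a I -> In b I -> In c I -> (a - b + c)%Z = k -> Rabs (m a - m b + m c - m k) * T <= 1) ->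
  e ^ 3 / 2 * INR (length J) ^ 2 <=
    fst (cis (- m k * t + 0) * fourier (cubic (trig_eval (free m (wave e I) t))) k)%C.
Proof.
intros He Ht HJ HJI Hfill Hphase.
rewrite fourier_cubic_trig_eval; unfold free, wave; rewrite map_map, Csum_map, fst_Csum; simpl snd.
(* [F a b c] is the real contribution of one triple; its phase is the resonance function times [t],
   bounded by 1 on the triples that reach [k], hence with cosine at least 1/2. *)
set (F := fun a b c => e ^ 3 * cos ((m a - m b + m c - m k) * t) * delta (a - b + c) k).
rewrite (Rsum_ext _ (fun a => Rsum (fun b => Rsum (F a b) I) I)).
2:{ intros a _; rewrite Csum_map, fst_Csum; apply Rsum_ext; intros b _.
    rewrite Csum_map, fst_Csum; apply Rsum_ext; intros c _; unfold F.
    transitivity (fst (cis (- m k * t + 0) * ((cis (m a * t) * RtoC e) * Cconj (cis (m b * t) * RtoC e)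
      * (cis (m c * t) * RtoC e) * RtoC (delta (a - b + c) k)))%C); [reflexivity|].
    replace ((m a - m b + m c - m k) * t) with ((- m k * t + 0) + m a * t + - (m b * t) + m c * t) by ring.
    transitivity (fst (RtoC (e ^ 3 * delta (a - b + c) k) *
      cis (- m k * t + 0 + m a * t + - (m b * t) + m c * t))%C).
    - apply (f_equal fst); rewrite !cis_plus, cis_opp, RtoC_mult; simpl pow.
      apply injective_projections; simpl; ring.
    - simpl; ring. }
assert (HF : forall a b c, In a I -> In b I -> In c I -> e ^ 3 / 2 * delta (a - b + c) k <= F a b c).
{ intros a b c Ha Hb Hc; unfold F, delta; destruct Z.eq_dec as [E|E]; [|lra].
  rewrite !Rmult_1_r; unfold Rdiv; apply Rmult_le_compat_l; [apply pow_le, He|].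
  rewrite <- (Rmult_1_l (/ 2)); apply cos_ge_half; rewrite Rabs_mult, (Rabs_pos_eq t) by lra.
  eapply Rle_trans; [|apply (Hphase a b c Ha Hb Hc E)].
  apply Rmult_le_compat_l; [apply Rabs_pos|lra]. }
assert (He3 : 0 <= e ^ 3 / 2) by (pose proof (pow_le e 3 He); lra).
assert (HF0 : forall a b c, In a I -> In b I -> In c I -> 0 <= F a b c).
{ intros a b c Ha Hb Hc; eapply Rle_trans; [|apply HF; assumption].
  apply Rmult_le_pos; [exact He3|unfold delta; destruct Z.eq_dec; lra]. }
apply Rle_trans with (Rsum (fun a => Rsum (fun b => e ^ 3 / 2) J) J).
{ rewrite !Rsum_const; right; ring. }
(* [Rsum_incl] asks for nonnegativity at every integer, so [g] is first cut off outside [I]. *)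
assert (Hmono : forall (g : Z -> R), (forall a, In a I -> 0 <= g a) -> Rsum g J <= Rsum g I).
{ intros g Hg.
  rewrite (Rsum_ext g (fun a => if in_dec Z.eq_dec a I then g a else 0) J)
    by (intros a Ha; destruct in_dec as [|N]; [reflexivity|destruct N; apply HJI, Ha]).
  rewrite (Rsum_ext g (fun a => if in_dec Z.eq_dec a I then g a else 0) I)
    by (intros a Ha; destruct in_dec as [|N]; [reflexivity|destruct N; exact Ha]).
  apply Rsum_incl; auto; intro a; destruct in_dec; [apply Hg; assumption|lra]. }
eapply Rle_trans; [|apply Hmono; intros a Ha; apply Rsum_ge0; intros b Hb; apply Rsum_ge0; auto].
apply Rsum_le; intros a Ha.
eapply Rle_trans; [|apply Hmono; intros b Hb; apply Rsum_ge0; auto].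
apply Rsum_le; intros b Hb.
(* For given [a] and [b], the single value c = k - a + b is retained. *)
eapply Rle_trans; [|apply (Rsum_ge_term _ _ (k - a + b)%Z); auto].
eapply Rle_trans; [|apply HF; auto].
unfold delta; destruct Z.eq_dec; [lra|lia].
Qed.

(** * Phases, parameters and conclusion *)

Lemma smooth_trig_eval p : smooth (trig_eval p).
Proof.
assert (H : forall n, exists q, forall x,
  Derive_n (fun y => Re (trig_eval p y)) n x = fst (trig_eval q x) /\ Derive_n (fun y => Im (trig_eval p y)) n x = snd (trig_eval q x)).
{ induction n as [|n [q Hq]]; [exists p; intro x; split; reflexivity|].
  exists (map (fun cn => (fst cn * (RtoC (IZR (snd cn)) * Ci), snd cn)%C) q); intro x; simpl.
  rewrite (Derive_ext _ (fun y => fst (trig_eval q y))) by (intro; apply Hq).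
  rewrite (Derive_ext (fun y => Derive_n (fun y => Im (trig_eval p y)) n y) (fun y => snd (trig_eval q y))) by (intro; apply Hq).
  split; apply is_derive_unique; [apply is_derive_C_fst|apply is_derive_C_snd]; apply is_derive_trig_eval. }
intros [|n] x; [split; exact I|].
destruct (H n) as [q Hq]; simpl; split.
- apply (ex_derive_ext (fun y => fst (trig_eval q y))); [intro; symmetry; apply Hq|].
  eexists; apply is_derive_C_fst, is_derive_trig_eval.
- apply (ex_derive_ext (fun y => snd (trig_eval q y))); [intro; symmetry; apply Hq|].
  eexists; apply is_derive_C_snd, is_derive_trig_eval.
Qed.

(** * Second differences of the symbol *)

Lemma is_derive_Rpower y x : 0 < x -> is_derive (fun z => Rpower z y) x (y * Rpower x (y - 1)).
Proof. intro Hx; apply is_derive_Reals, derivable_pt_lim_power, Hx. Qed.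

Lemma Rpower_neg_decr y a b : y <= 0 -> 0 < a <= b -> Rpower b y <= Rpower a y.
Proof.
intros Hy Hab; unfold Rpower.
assert (H : ln a <= ln b) by (destruct (Rle_lt_or_eq_dec a b) as [H| ->]; [tauto|left; apply ln_increasing; lra|lra]).
destruct (Rle_lt_or_eq_dec (y * ln b) (y * ln a)) as [E|E]; [nra|left; apply exp_increasing, E|rewrite E; lra].
Qed.

(** Two mean value theorems, in the base point and then in the increment, leave y (y - 1) z^(y-2)
    with y = 2 alpha and z >= n. Since 1 < y < 2, the factor is at most 2 and the power decreases in
    z. *)
Lemma Rpower_second_difference alpha n b c h : 1 / 2 < alpha < 1 -> 0 < n ->
  n <= b -> n <= c -> n <= b + h -> n <= c + h ->
  Rabs ((Rpower (b + h) (2 * alpha) - Rpower b (2 * alpha)) - (Rpower (c + h) (2 * alpha) - Rpower c (2 * alpha)))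
  <= 2 * Rpower n (2 * alpha - 2) * Rabs h * Rabs (b - c).
Proof.
intros Ha Hn Hb Hc Hbh Hch.
set (y := 2 * alpha).
assert (Hmin : forall x, Rmin c b <= x -> n <= x /\ n <= x + h).
{ intros x Hx; unfold Rmin in Hx; destruct Rle_dec; lra. }
assert (HD : forall x, Rmin c b <= x -> is_derive (fun x => Rpower (x + h) y - Rpower x y) x
  (y * Rpower (x + h) (y - 1) - y * Rpower x (y - 1))).
{ intros x Hx; destruct (Hmin x Hx) as [H1 H2].
  apply (is_derive_minus (V := R_NormedModule)); [|apply is_derive_Rpower; lra].
  rewrite <- (Rmult_1_l (y * Rpower (x + h) (y - 1))).
  apply (is_derive_comp (V := R_NormedModule) (fun z => Rpower z y) (fun x => x + h)).
  - apply is_derive_Rpower; lra.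
  - auto_derive; [exact I|ring]. }
destruct (MVT_gen (fun x => Rpower (x + h) y - Rpower x y) c b _ (fun x H => HD x (Rlt_le _ _ (proj1 H)))) as [x [Hx E]].
{ intros x Hx; apply continuity_pt_filterlim.
  apply (ex_derive_continuous (V := R_NormedModule) (fun x => Rpower (x + h) y - Rpower x y)).
  eexists; apply HD, Hx. }
rewrite E, Rabs_mult; apply Rmult_le_compat_r; [apply Rabs_pos|].
destruct (Hmin x (proj1 Hx)) as [Hx1 Hx2].
assert (HD2 : forall z, Rmin x (x + h) <= z -> is_derive (fun z => y * Rpower z (y - 1)) z (y * ((y - 1) * Rpower z (y - 1 - 1)))).
{ intros z Hz; apply is_derive_scal, is_derive_Rpower.
  unfold Rmin in Hz; destruct Rle_dec; lra. }
destruct (MVT_gen (fun z => y * Rpower z (y - 1)) x (x + h) _ (fun z H => HD2 z (Rlt_le _ _ (proj1 H)))) as [z [Hz E2]].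
{ intros z Hz; apply continuity_pt_filterlim.
  apply (ex_derive_continuous (V := R_NormedModule) (fun z => y * Rpower z (y - 1))).
  eexists; apply HD2, Hz. }
rewrite E2, Rabs_mult; replace (x + h - x) with h by ring.
apply Rmult_le_compat_r; [apply Rabs_pos|].
assert (Hzn : n <= z) by (destruct Hz as [Hz _]; unfold Rmin in Hz; destruct Rle_dec; lra).
replace (y - 1 - 1) with (y - 2) by ring.
assert (Hp : 0 < Rpower z (y - 2)) by apply exp_pos.
assert (Hd : Rpower z (y - 2) <= Rpower n (y - 2)) by (apply Rpower_neg_decr; unfold y; lra).
assert (Hy : 1 < y < 2) by (unfold y; lra).
rewrite Rabs_pos_eq by (apply Rmult_le_pos; [lra|apply Rmult_le_pos; lra]).
rewrite <- Rmult_assoc; apply Rmult_le_compat; nra.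
Qed.

Definition block (a n : nat) : list Z := map Z.of_nat (seq a n).

Lemma block_NoDup a n : NoDup (block a n).
Proof. apply Injective_map_NoDup; [intros x y; lia|apply seq_NoDup]. Qed.

Lemma length_block a n : length (block a n) = n.
Proof. unfold block; rewrite length_map, length_seq; reflexivity. Qed.

Lemma in_block a n k : In k (block a n) <-> (Z.of_nat a <= k < Z.of_nat (a + n))%Z.
Proof.
unfold block; rewrite in_map_iff; split.
- intros [i [<- Hi]]; apply in_seq in Hi; lia.
- intro H; exists (Z.to_nat k); split; [lia|apply in_seq; lia].
Qed.

(** With h = a - b one has k = c + h, so the resonance function is a second difference with
    increments h and b - c. Both are at most 3 M in absolute value, whence 18 = 2 * 3 * 3. *)
Lemma block_phase alpha (T : R) (N M : nat) a b c k : 1 / 2 < alpha < 1 -> 0 < T -> (0 < N)%nat ->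
  18 * INR M ^ 2 * Rpower (INR N) (2 * alpha - 2) * T <= 1 ->
  In a (block N (3 * M)) -> In b (block N (3 * M)) -> In c (block N (3 * M)) -> In k (block N (3 * M)) ->
  (a - b + c)%Z = k ->
  Rabs (frac_symbol alpha a - frac_symbol alpha b + frac_symbol alpha c - frac_symbol alpha k) * T <= 1.
Proof.
intros Halpha HT HN HM Ha Hb Hc Hk E.
assert (HNr := lt_0_INR _ HN).
assert (Hin : forall j, In j (block N (3 * M)) -> INR N <= IZR j <= INR N + 3 * INR M /\
  frac_symbol alpha j = Rpower (IZR j) (2 * alpha)).
{ intros j Hj; apply in_block in Hj.
  assert (Hj1 : INR N <= IZR j) by (rewrite INR_IZR_INZ; apply IZR_le; lia).
  split; [split; [exact Hj1|]|].
  - replace (INR N + 3 * INR M) with (INR (N + 3 * M)) by (rewrite plus_INR, mult_INR; simpl; ring).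
    rewrite INR_IZR_INZ; apply IZR_le; lia.
  - unfold frac_symbol; destruct Z.eq_dec; [lia|]; rewrite Rabs_pos_eq by lra; reflexivity. }
destruct (Hin a Ha) as [Ha1 ->]; destruct (Hin b Hb) as [Hb1 ->].
destruct (Hin c Hc) as [Hc1 ->]; destruct (Hin k Hk) as [Hk1 ->].
set (h := IZR a - IZR b).
assert (Ek : IZR k = IZR c + h) by (rewrite <- E, plus_IZR, minus_IZR; unfold h; ring).
rewrite Ek in *.
pose proof (Rpower_second_difference alpha (INR N) (IZR b) (IZR c) h Halpha HNr) as HS.
replace (IZR b + h) with (IZR a) in HS by (unfold h; ring).
specialize (HS (proj1 Hb1) (proj1 Hc1) (proj1 Ha1) (proj1 Hk1)).
set (P := Rpower (INR N) (2 * alpha - 2)) in *.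
assert (HP : 0 < P) by apply exp_pos.
eapply Rle_trans; [|exact HM]; apply Rmult_le_compat_r; [lra|].
replace (Rpower (IZR a) (2 * alpha) - Rpower (IZR b) (2 * alpha) + Rpower (IZR c) (2 * alpha) - Rpower (IZR c + h) (2 * alpha))
  with (Rpower (IZR a) (2 * alpha) - Rpower (IZR b) (2 * alpha) - (Rpower (IZR c + h) (2 * alpha) - Rpower (IZR c) (2 * alpha))) by ring.
eapply Rle_trans; [exact HS|].
assert (H1 : Rabs h <= 3 * INR M) by (apply Rabs_le; unfold h; lra).
assert (H2 : Rabs (IZR b - IZR c) <= 3 * INR M) by (apply Rabs_le; lra).
replace (18 * INR M ^ 2 * P) with (2 * P * (3 * INR M) * (3 * INR M)) by ring.
pose proof (Rabs_pos h); pose proof (Rabs_pos (IZR b - IZR c)).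
apply Rmult_le_compat; auto; [apply Rmult_le_pos; lra|apply Rmult_le_compat_l; lra].
Qed.

Lemma jap_bounds (N : nat) k : (0 < N)%nat -> (Z.of_nat N <= k <= 2 * Z.of_nat N)%Z ->
  INR N <= jap k <= 3 * INR N.
Proof.
intros HN Hk; assert (H1 : 1 <= INR N) by (apply (le_INR 1); lia).
destruct Hk as [Hk1 Hk2]; apply IZR_le in Hk1; apply IZR_le in Hk2.
rewrite mult_IZR in Hk2; rewrite <- INR_IZR_INZ in *.
unfold jap; split.
- rewrite <- (sqrt_pow2 (INR N)) by lra; apply sqrt_le_1_alt; nra.
- rewrite <- (sqrt_pow2 (3 * INR N)) by lra; apply sqrt_le_1_alt; nra.
Qed.

(** The absolute value of [s] in the constant covers both signs of the exponent, so one [q] serves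
    for the data and for the functional. *)
Lemma Rpower_comparable s x y : 0 < x -> x <= y <= 3 * x ->
  / Rpower 3 (Rabs s) * Rpower x s <= Rpower y s <= Rpower 3 (Rabs s) * Rpower x s.
Proof.
intros Hx Hy.
assert (Hln : 0 <= ln y - ln x <= ln 3).
{ assert (ln (3 * x) = ln 3 + ln x) by (apply ln_mult; lra).
  assert (ln x <= ln y) by (destruct (Req_dec x y) as [->|]; [lra|left; apply ln_increasing; lra]).
  assert (ln y <= ln (3 * x)) by (destruct (Req_dec y (3 * x)) as [->|]; [lra|left; apply ln_increasing; lra]).
  lra. }
assert (Hs : Rabs (s * (ln y - ln x)) <= Rabs s * ln 3).
{ rewrite Rabs_mult, (Rabs_pos_eq (ln y - ln x)) by lra.
  apply Rmult_le_compat_l; [apply Rabs_pos|lra]. }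
apply Rabs_le_between in Hs.
assert (Hexp : forall u v, u <= v -> exp u <= exp v).
{ intros u v [H| ->]; [left; apply exp_increasing, H|lra]. }
unfold Rpower; rewrite <- exp_Ropp, <- !exp_plus.
replace (s * ln y) with (s * (ln y - ln x) + s * ln x) by ring.
split; apply Hexp; lra.
Qed.

(** * Choice of the frequencies and the contradiction *)

Lemma Rpower_large x B : 0 < x -> exists n0 : nat, forall n : nat, (n0 <= n)%nat -> B <= Rpower (INR n) x.
Proof.
intro Hx; set (y := Rabs B / x).
destruct (nfloor_ex (exp y)) as [n0 Hn0]; [left; apply exp_pos|].
exists (S n0); intros n Hn; apply le_INR in Hn; rewrite S_INR in Hn.
assert (He := exp_pos y).
assert (Hy : y < ln (INR n)) by (rewrite <- (ln_exp y); apply ln_increasing; lra).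
unfold Rpower; eapply Rle_trans; [|apply exp_ineq1_le].
assert (x * y <= x * ln (INR n)) by (apply Rmult_le_compat_l; lra).
replace (x * y) with (Rabs B) in H by (unfold y; field; lra).
pose proof (Rle_abs B); lra.
Qed.

(** M is the integer part of kap N^(1-alpha), and kap = 1 / (1 + 18 T) gives 18 kap^2 T <= 1. The
    gap 1 - alpha - 2 s > 0 lets M outgrow N^(2 s). *)
Lemma parameters alpha s T C : 1 / 2 < alpha < 1 -> s < (1 - alpha) / 2 -> 0 < T -> 0 <= C ->
  exists N M : nat, (0 < M)%nat /\ (3 * M <= N)%nat /\
    18 * INR M ^ 2 * Rpower (INR N) (2 * alpha - 2) * T <= 1 /\
    C * Rpower (INR N) (2 * s) < INR M.
Proof.
intros Ha Hs HT HC.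
set (kap := / (1 + 18 * T)).
assert (Hk : 0 < kap) by (apply Rinv_0_lt_compat; lra).
assert (Hk1 : kap * (1 + 18 * T) = 1) by (unfold kap; field; lra).
assert (Hk2 : kap <= 1) by nra.
(* The three thresholds secure, in turn, 3 M <= N, the value kap P >= 3 that absorbs the loss of the
   integer part, and C N^(2 s) <= kap P / 2. *)
destruct (Rpower_large alpha 3 ltac:(lra)) as [n1 H1].
destruct (Rpower_large (1 - alpha) (3 / kap) ltac:(lra)) as [n2 H2].
destruct (Rpower_large (1 - alpha - 2 * s) (2 * C / kap) ltac:(lra)) as [n3 H3].
set (N := (S (n1 + n2 + n3))%nat).
specialize (H1 N ltac:(unfold N; lia)); specialize (H2 N ltac:(unfold N; lia)); specialize (H3 N ltac:(unfold N; lia)).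
assert (HN : 0 < INR N) by (apply lt_0_INR; unfold N; lia).
set (P := Rpower (INR N) (1 - alpha)) in *.
assert (HP : 0 < P) by apply exp_pos.
assert (HkP : 3 <= kap * P).
{ replace 3 with (kap * (3 / kap)) by (field; lra); apply Rmult_le_compat_l; lra. }
destruct (nfloor_ex (kap * P)) as [M [HM1 HM2]]; [lra|].
assert (HM0 : 0 < INR M) by lra.
exists N, M; split; [|split; [|split]].
- apply INR_lt; simpl; exact HM0.
- apply INR_le; rewrite mult_INR; simpl (INR 3).
  assert (E : INR N = P * Rpower (INR N) alpha).
  { unfold P; rewrite <- Rpower_plus; replace (1 - alpha + alpha) with 1 by ring; rewrite Rpower_1; auto. }
  rewrite E; set (Q := Rpower (INR N) alpha) in *.
  assert (INR M <= P) by nra; nra.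
- assert (E : Rpower (INR N) (2 * alpha - 2) * (P * P) = 1).
  { unfold P; rewrite <- !Rpower_plus; replace (2 * alpha - 2 + (1 - alpha + (1 - alpha))) with 0 by ring.
    apply Rpower_O, HN. }
  set (Q := Rpower (INR N) (2 * alpha - 2)) in *.
  assert (HQ : 0 < Q) by apply exp_pos.
  apply Rle_trans with (18 * (kap * P) ^ 2 * Q * T).
  + apply Rmult_le_compat_r; [lra|]; apply Rmult_le_compat_r; [lra|]; apply Rmult_le_compat_l; [lra|].
    apply pow_incr; lra.
  + replace (18 * (kap * P) ^ 2 * Q * T) with (kap * (kap * (18 * T)) * (Q * (P * P))) by ring.
    rewrite E; nra.
- assert (E : P = Rpower (INR N) (1 - alpha - 2 * s) * Rpower (INR N) (2 * s)).
  { unfold P; rewrite <- Rpower_plus; f_equal; ring. }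
  set (Q := Rpower (INR N) (2 * s)) in *; set (D := Rpower (INR N) (1 - alpha - 2 * s)) in *.
  assert (HQ : 0 < Q) by apply exp_pos.
  assert (HD : 2 * C <= kap * D).
  { replace (2 * C) with (kap * (2 * C / kap)) by (field; lra); apply Rmult_le_compat_l; lra. }
  assert (2 * (C * Q) <= kap * P) by (rewrite E; nra).
  lra.
Qed.

(** [J] is the middle third of [I] so that k - a + b stays in [I] for all k, a, b in [J]; the
    condition 3 M <= N keeps [I] inside [N, 2 N], where all Sobolev weights are comparable to
    N^s. *)
Lemma wave_bound alpha s (r T : posreal) (Phi : Hs s -> C0 T (Hs s)) K (N M : nat) :
  1 / 2 < alpha < 1 -> extends_data_to_solution alpha s r T Phi -> 0 <= K ->
  (forall (l : C0 T (Hs s) -> R) c (f : Hs s),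
    is_linear (V := R_NormedModule) l -> 0 <= c -> (forall w, Rabs (l w) <= c * norm w) ->
    exists (h1 h2 : R -> R) L,
      locally 0 (fun e => is_derive (fun x : R => l (Phi (scal x f))) e (h1 e)) /\
      locally 0 (fun e => is_derive h1 e (h2 e)) /\
      is_derive h2 0 L /\ Rabs L <= K * c * norm f ^ 3) ->
  (0 < M)%nat -> (3 * M <= N)%nat -> 18 * INR M ^ 2 * Rpower (INR N) (2 * alpha - 2) * T <= 1 ->
  T * INR M <= 2 * K * Rpower 3 (Rabs s) ^ 4 * Rpower (INR N) (2 * s).
Proof.
intros Ha Hext HK HC3 HM HMN Hphase.
pose proof (cond_pos T) as HT; pose proof (cond_pos r) as Hr.
assert (HMr := lt_0_INR _ HM).
assert (HN : (0 < N)%nat) by lia.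
assert (HNr := lt_0_INR _ HN).
set (I := block N (3 * M)); set (J := block (N + M) M).
assert (HI : NoDup I) by apply block_NoDup; assert (HJ : NoDup J) by apply block_NoDup.
assert (HJI : incl J I) by (intros k Hk; apply in_block in Hk; apply in_block; lia).
set (q := Rpower 3 (Rabs s)); set (P := Rpower (INR N) s).
assert (Hq : 0 < q) by apply exp_pos; assert (HP : 0 < P) by apply exp_pos.
assert (Hw : forall k, In k I -> / q * P <= Rpower (jap k) s <= q * P).
{ intros k Hk; apply in_block in Hk; apply Rpower_comparable; [exact HNr|apply jap_bounds; lia]. }
set (m := frac_symbol alpha).
set (f := indicator_Hs s I HI).
set (tT := exist _ (T : R) (conj (Rlt_le _ _ HT) (Rle_refl T)) : Icc T).
(* These phases undo the free rotation at time [T], so that the functional reads off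
   [interaction]. *)
set (th := fun k => cis (- m k * T + 0)).
assert (HqP : 0 < / q * P) by (apply Rmult_lt_0_compat; [apply Rinv_0_lt_compat, Hq|exact HP]).
destruct (test_functional_spec s T tT th J (/ q * P) HJ) as [Hlin Hbd];
  [intro; apply Cmod_cis|exact HqP|intros k Hk; apply Hw, HJI, Hk|].
set (c := / (/ q * P) * sqrt (INR (length J))) in *.
assert (Hc : 0 <= c) by (apply Rmult_le_pos; [left; apply Rinv_0_lt_compat, HqP|apply sqrt_pos]).
destruct (HC3 (test_functional s T tT th J) c f Hlin Hc Hbd) as [h1 [h2 [L [D0 [D1 [D2 HL]]]]]].
assert (Hf : norm f <= sqrt (INR (length I)) * (q * P)).
{ apply norm_indicator_le; [left; apply Rmult_lt_0_compat; assumption|intros k Hk; apply Hw, Hk]. }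
assert (HlI : INR (length I) = 3 * INR M) by (unfold I; rewrite length_block, mult_INR; simpl; ring).
assert (HlJ : INR (length J) = INR M) by (unfold J; rewrite length_block; reflexivity).
set (A := 3 * INR M) in *.
(* The datum must lie in the ball of radius [r], and its l^1 size A e must satisfy the bootstrap
   condition. *)
assert (Hsmall : exists d, 0 < d /\ forall e, 0 < e < d ->
  e * norm f <= r /\ 27 * (A * e) ^ 2 * T <= 1).
{ assert (Hnf := norm_ge_0 f).
  assert (HAT : 0 < 27 * A ^ 2 * T) by (apply Rmult_lt_0_compat; [assert (0 < A ^ 2) by (apply pow_lt; unfold A; lra); lra|exact HT]).
  exists (Rmin (r / (norm f + 1)) (/ (1 + 27 * A ^ 2 * T))); split.
  { apply Rmin_glb_lt; [apply Rdiv_lt_0_compat; lra|apply Rinv_0_lt_compat; lra]. }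
  intros e [He1 He2].
  assert (He3 := Rlt_le_trans _ _ _ He2 (Rmin_l _ _)); assert (He4 := Rlt_le_trans _ _ _ He2 (Rmin_r _ _)).
  split.
  - apply Rle_trans with (r / (norm f + 1) * (norm f + 1)); [nra|right; field; lra].
  - set (B := 27 * A ^ 2 * T) in *.
    replace (27 * (A * e) ^ 2 * T) with (B * e * e) by (unfold B; ring).
    assert (e * (1 + B) <= 1).
    { apply Rle_trans with (/ (1 + B) * (1 + B)); [nra|right; field; lra]. }
    assert (B * e <= 1) by nra; assert (e <= 1) by nra; nra. }
destruct Hsmall as [d [Hd Hsmall]].
assert (Hsol : forall e, 0 < e < d -> exists U,
  flow m T (trig_eval (wave e I)) U /\ trig_weight (wave e I) = A * e /\ 27 * trig_weight (wave e I) ^ 2 * T <= 1 /\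
  test_functional s T tT th J (Phi (scal e f)) = Rsum (fun k => snd (interaction m U k T - fourier (trig_eval (wave e I)) k)%C) J).
{ intros e He; destruct (Hsmall e He) as [Hs1 Hs2].
  assert (Hwt : trig_weight (wave e I) = A * e) by (rewrite trig_weight_wave, HlI by lra; reflexivity).
  assert (Hrep : represents (scal e f) (trig_eval (wave e I))).
  { intro k; rewrite fourier_wave by exact HI; apply coef_scal. }
  assert (Hnorm : norm (scal e f) <= r).
  { eapply Rle_trans; [apply (norm_scal (V := Hs s))|].
    change (Rabs e * norm f <= r); rewrite Rabs_pos_eq by lra; exact Hs1. }
  destruct (Hext _ _ (smooth_trig_eval (wave e I)) (trig_eval_periodic (wave e I)) Hrep Hnorm) as [u [Hu Hur]].
  destruct (flow_of_solution alpha T _ u Hu) as [U [HU HUu]].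
  exists U; split; [exact HU|split; [exact Hwt|split; [rewrite Hwt; exact Hs2|]]].
  unfold test_functional; apply Rsum_ext; intros k _.
  rewrite (Hur tT k); simpl proj1_sig.
  rewrite fourier_wave by exact HI.
  rewrite (fourier_ext (u T) (U T)) by (intro x; symmetry; apply HUu; lra).
  (* The coefficients of the datum are real, so subtracting them leaves the imaginary parts
     unchanged. *)
  unfold interaction; fold (th k); unfold indicator; destruct in_dec; simpl; ring. }
(* Each of the M frequencies of [J] contributes at least T e^3 M^2 / 2, up to the quintic error. *)
assert (HLb : 6 * (T * INR M ^ 3 / 2) <= L).
{ apply (third_derivative_lower_bound _ h1 h2 L _ (INR M * (8 * A ^ 3 * T)) (INR M * (T * (56 * A ^ 5 * T))) d D0 D1 D2 Hd).
  - intros e He; destruct (Hsol e He) as [U [HU [Hwt [Hsm E]]]]; rewrite E.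
    apply Rle_trans with (Rsum (fun _ => 8 * (A * e) ^ 3 * T) J).
    + assert (Hb : forall k, Rabs (snd (interaction m U k T - fourier (trig_eval (wave e I)) k)%C) <= 8 * (A * e) ^ 3 * T).
      { intro k; eapply Rle_trans; [apply Rabs_snd_le|].
        rewrite <- Hwt; apply (interaction_remainder m T _ U HU (wave e I)); [|exact Hsm|reflexivity].
        rewrite Hwt; apply Rmult_lt_0_compat; unfold A; lra. }
      clear -Hb; induction J as [|k l IH]; cbn [Rsum fold_right]; [rewrite Rabs_R0; lra|].
      eapply Rle_trans; [apply Rabs_triang|apply Rplus_le_compat; [apply Hb|exact IH]].
    + rewrite Rsum_const, HlJ; right; ring.
  - intros e He; destruct (Hsol e He) as [U [HU [Hwt [Hsm E]]]]; rewrite E.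
    apply Rle_trans with (Rsum (fun _ => T * (e ^ 3 / 2 * INR (length J) ^ 2 - 56 * (A * e) ^ 5 * T)) J).
    + rewrite Rsum_const, HlJ; right; field.
    + apply Rsum_le; intros k Hk; rewrite <- Hwt.
      apply (interaction_growth m T _ U HU (wave e I)); [|exact Hsm|reflexivity|].
      * rewrite Hwt; apply Rmult_lt_0_compat; unfold A; lra.
      * intros t Ht; apply (coherent_interactions m T); auto; [lra| |].
        -- intros a b Ha' Hb'; apply in_block in Ha', Hb', Hk; apply in_block; lia.
        -- intros a b c' Ha' Hb' Hc' Ek; apply (block_phase alpha T N M); auto. }
(* The functional contributes P^(-1) M^(1/2) and the cube of the datum P^3 (3 M)^(3/2); together
   they leave P^2 M^2. *)
assert (HLu : Rabs L <= K * (q * / P * sqrt (INR M)) * (sqrt A * (q * P)) ^ 3).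
{ eapply Rle_trans; [exact HL|].
  rewrite HlI in Hf.
  apply Rmult_le_compat; [apply Rmult_le_pos; assumption|apply pow_le, norm_ge_0| |].
  - right; unfold c; rewrite HlJ; field; lra.
  - apply pow_incr; split; [apply norm_ge_0|exact Hf]. }
assert (HsM : sqrt (INR M) ^ 2 = INR M) by (apply pow2_sqrt; lra).
assert (Hs3 : sqrt A = sqrt 3 * sqrt (INR M)) by (apply sqrt_mult; lra).
assert (H3 : sqrt 3 <= 2) by (rewrite <- (sqrt_pow2 2) by lra; apply sqrt_le_1_alt; lra).
assert (H33 : sqrt 3 ^ 2 = 3) by (apply pow2_sqrt; lra).
assert (HP2 : Rpower (INR N) (2 * s) = P ^ 2).
{ unfold P; simpl; rewrite Rmult_1_r, <- Rpower_plus; f_equal; ring. }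
rewrite HP2.
replace (K * (q * / P * sqrt (INR M)) * (sqrt A * (q * P)) ^ 3)
  with (3 * sqrt 3 * (K * q ^ 4 * P ^ 2 * INR M ^ 2)) in HLu.
2:{ rewrite Hs3; replace (INR M ^ 2) with ((sqrt (INR M) ^ 2) ^ 2) by (rewrite HsM; reflexivity).
    transitivity (sqrt 3 ^ 2 * sqrt 3 * (K * q ^ 4 * P ^ 2 * (sqrt (INR M) ^ 2) ^ 2));
      [rewrite H33; ring|field; lra]. }
set (X := K * q ^ 4 * P ^ 2 * INR M ^ 2) in *.
assert (HX : 0 <= X).
{ unfold X; repeat apply Rmult_le_pos; try apply pow_le; lra. }
pose proof (Rle_abs L).
(* The factor 3 sqrt 3 is rounded up to 6, after which M^2 cancels. *)
assert (HF : 3 * (T * INR M) * INR M ^ 2 <= 3 * (2 * K * q ^ 4 * P ^ 2) * INR M ^ 2).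
{ replace (3 * (2 * K * q ^ 4 * P ^ 2) * INR M ^ 2) with (6 * X) by (unfold X; ring).
  replace (3 * (T * INR M) * INR M ^ 2) with (6 * (T * INR M ^ 3 / 2)) by field.
  nra. }
apply Rmult_le_reg_r in HF; [lra|apply pow_lt, HMr].
Qed.

Theorem theorem1p2 (alpha s : R) (r T : posreal)
    (halpha : 1 / 2 < alpha < 1) (hs : s < (1 - alpha) / 2)
    (Phi : Hs s -> C0 T (Hs s))
    (hcont : continuous_on (fun v : Hs s => norm v <= r) Phi)
    (hext : extends_data_to_solution alpha s r T Phi) :
  ~ Ck_at 3 Phi zero.
Proof.
intro HC3; pose proof (cond_pos T) as HT.
destruct (C3_third_derivative Phi HC3) as [K [HK HC]].
set (C := 2 * K * Rpower 3 (Rabs s) ^ 4).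
assert (HC0 : 0 <= C).
{ apply Rmult_le_pos; [lra|apply pow_le; left; apply exp_pos]. }
(* Dividing the constant by [T] matches the factor [T] on the left of [wave_bound], which then
   contradicts the strict inequality obtained here. *)
destruct (parameters alpha s T (C / T) halpha hs HT) as [N [M [HM [HMN [Hph Hlt]]]]].
{ apply Rmult_le_pos; [exact HC0|left; apply Rinv_0_lt_compat, HT]. }
pose proof (wave_bound alpha s r T Phi K N M halpha hext HK HC HM HMN Hph) as H.
fold C in H.
assert (T * (C / T * Rpower (INR N) (2 * s)) < T * INR M) by (apply Rmult_lt_compat_l; assumption).
replace (T * (C / T * Rpower (INR N) (2 * s))) with (C * Rpower (INR N) (2 * s)) in H0 by (field; lra).
lra.
Qed.
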